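(* Let $\Bbbk$ be a field, $d\ge1$, $R=\Bbbk[x_1,\ldots,x_{d+1}]$ the standard graded polynomial ring, $\mathfrak m=(x_1,\ldots,x_{d+1})$, and $\mathbb M=\{\mathfrak m^n\}_{n\in\mathbb N}$. Let $(K_1,\ldots,K_r)$ be a sequence of convex bodies in $\mathbb R^d_{\ge0}$, let $K_0\subset\mathbb R^d$ be the convex hull of $\mathbf 0,\mathbf e_1,\ldots,\mathbf e_d$, and let $\mathbf K=(K_0,K_1,\ldots,K_r)$. Then there exist graded families of monomial ideals $\mathbb J(1)=\{J(1)_n\}_{n\in\mathbb N},\ldots,\mathbb J(r)=\{J(r)_n\}_{n\in\mathbb N}$ in $R$ (satisfying the conditions in the context under which mixed multiplicities are defined) such that, for each $(d_0,\mathbf d)\in\mathbb N^{r+1}$ with $d_0+|\mathbf d|=d$, $$\mathrm{MV}_d\big(\mathbf K_{(d_0,\mathbf d)}\big)=e_{(d_0,\mathbf d)}\big(\mathbb M\mid\mathbb J(1),\ldots,\mathbb J(r)\big)=\lim_{p\to\infty}\frac{e_{(d_0,\mathbf d)}(\mathfrak m^p\mid J(1)_p,\ldots,J(r)_p)}{p^{d+1}}=\lim_{p\to\infty}\frac{e_{(d_0,\mathbf d)}(\mathfrak m\mid J(1)_p,\ldots,J(r)_p)}{p^{|\mathbf d|}}.$$ In particular, when $r=d$, $$\mathrm{MV}_d(K_1,\ldots,K_d)=e_{(0,1,\ldots,1)}\big(\mathbb M\mid\mathbb J(1),\ldots,\mathbb J(d)\big)=\lim_{p\to\infty}\frac{e_{(0,1,\ldots,1)}(\mathfrak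 m^p\mid J(1)_p,\ldots,J(d)_p)}{p^{d+1}}=\lim_{p\to\infty}\frac{e_{(0,1,\ldots,1)}(\mathfrak m\mid J(1)_p,\ldots,J(d)_p)}{p^{d}}.$$
   Context: $\mathbb N$ contains $0$; for $\mathbf d=(d_1,\ldots,d_r)\in\mathbb N^r$: $|\mathbf d|=d_1+\cdots+d_r$, $\mathbf d!=d_1!\cdots d_r!$, $\mathbf n^{\mathbf d}=n_1^{d_1}\cdots n_r^{d_r}$. A convex body is a nonempty compact convex set. $\mathbf e_1,\ldots,\mathbf e_d$ is the standard basis of $\mathbb R^d$. Mixed volumes: the mixed volumes $\mathrm{MV}_d$ are the symmetric functions of $d$ convex bodies in $\mathbb R^d$ determined by $\mathrm{Vol}_d(\lambda_0K_0+\cdots+\lambda_rK_r)=\sum_{d_0+|\mathbf d|=d}\frac{1}{d_0!\mathbf d!}\mathrm{MV}_d(\mathbf K_{(d_0,\mathbf d)})\lambda_0^{d_0}\cdots\lambda_r^{d_r}$ for all $\lambda_i\ge0$, where $\mathbf K_{(d_0,\mathbf d)}$ is the multiset with $d_i$ copies of $K_i$ for $0\le i\le r$ (so $\mathrm{MV}_d(K,\ldots,K)=d!\,\mathrm{Vol}_d(K)$). A graded family of monomial ideals is a sequence $\{J_n\}_{n\in\mathbb N}$ of monomial ideals of $R$ with $J_0=R$ and $J_iJ_j\subseteq J_{i+j}$ for all $i,j$. Mixed multiplicities of families: let $\mathbb I=\{I_n\}$ be a graded family of monomial ideals with $I_n$ $\mathfrak m$-primary for $n>0$, and let $\mathbb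 J(1),\ldots,\mathbb J(r)$ be graded families of monomial ideals such that $J(i)_n\ne0$ for all large $n$ and such that, for some $\beta\in\mathbb N$, every nonzero $J(i)_n$ is generated in degrees $\le\beta n$. Then $$F(n_0,\mathbf n)=\lim_{m\to\infty}\frac{\dim_{\Bbbk}\big(J(1)_{mn_1}\cdots J(r)_{mn_r}/I_{mn_0}J(1)_{mn_1}\cdots J(r)_{mn_r}\big)}{m^{d+1}}$$ exists and agrees for all $n_0\in\mathbb N$, $\mathbf n\in\mathbb N^r$ with a homogeneous real polynomial of degree $d+1=\dim R$, all of whose terms are divisible by $n_0$; the mixed multiplicities are the real numbers $e_{(d_0,\mathbf d)}(\mathbb I\mid\mathbb J(1),\ldots,\mathbb J(r))\ge0$ ($d_0+|\mathbf d|=d$) defined by $$F(n_0,\mathbf n)=\sum_{d_0+|\mathbf d|=d}\frac{1}{(d_0+1)!\,\mathbf d!}\,e_{(d_0,\mathbf d)}(\mathbb I\mid\mathbb J(1),\ldots,\mathbb J(r))\,n_0^{d_0+1}\mathbf n^{\mathbf d}.$$ Mixed multiplicities of ideals: for an $\mathfrak m$-primary homogeneous ideal $I$ and nonzero homogeneous ideals $J_1,\ldots,J_r$ of $R$, the integers $e_{(d_0,\mathbf d)}(I\mid J_1,\ldots,J_r)\ge0$ are defined by $$\lim_{m\to\infty}\frac{\dim_{\Bbbk}\big(J_1^{mn_1}\cdots J_r^{mn_r}/I^{mn_0}J_1^{mn_1}\cdots J_r^{mn_r}\big)}{m^{d+1}}=\sum_{d_0+|\mathbf d|=d}\frac{e_{(d_0,\mathbf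 d)}(I\mid J_1,\ldots,J_r)}{(d_0+1)!\,\mathbf d!}\,n_0^{d_0+1}\mathbf n^{\mathbf d}\quad\text{for all }n_0,\ldots,n_r\ge0.$$ In the limits over $p$, only $p$ large enough that all $J(i)_p\ne0$ are considered. *)

(* Defs.v *)
(* [mpoly] has to be imported before the analysis libraries: in the other order
   their notations clash. *)
From HB Require Import structures.
From mathcomp Require Import all_boot all_order all_algebra.
From mathcomp Require Import mpoly.
From mathcomp Require Import all_classical all_reals.
From mathcomp Require Import ereal topology normedtype sequences convex.

Set Implicit Arguments.
Unset Strict Implicit.
Unset Printing Implicit Defensive.

Import Order.TTheory GRing.Theory Num.Theory.
Import numFieldNormedType.Exports.

Local Open Scope classical_set_scope.
Local Open Scope ring_scope.

(* The family with [a i] copies of each [K i], as a sequence of length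
   [\sum_i a i]. *)
Definition copies (T : Type) (r : nat) (K : 'I_r -> T) (a : 'I_r -> nat) :
    seq T :=
  flatten [seq nseq (a i) (K i) | i <- enum 'I_r].

Section MixedVolumes.
Context {R : realType} {d : nat}.
Implicit Types A : set 'rV[R]_d.

Definition convex_body A : Prop := [/\ A !=set0, compact A & convex_set A].

Definition convex_hull A : set 'rV[R]_d :=
  smallest (fun C : set 'rV[R]_d => convex_set C) A.

(* The convex hull of 0, e_1, ..., e_d. *)
Definition std_simplex : set 'rV[R]_d :=
  convex_hull ([set 0] `|` range (fun i : 'I_d => delta_mx 0 i)).

(* Lebesgue (outer) measure on R^d: infimum of the total volumes of the
   countable covers by boxes [a_k, b_k].  It is finite on bounded sets, and
   agrees with the Lebesgue measure on compact sets. *)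
Definition volume A : R := fine (ereal_inf
  [set v : \bar R | exists a b : nat -> 'rV[R]_d,
    [/\ forall k i, a k 0 i <= b k 0 i,
        A `<=` \bigcup_k
          [set x : 'rV[R]_d | forall i, a k 0 i <= x 0 i <= b k 0 i] &
        v = (\sum_(0 <= k <oo) (\prod_(i < d) (b k 0 i - a k 0 i))%:E)%E]]).

Definition minkowski_comb (r : nat) (lam : 'I_r -> R)
    (K : 'I_r -> set 'rV[R]_d) : set 'rV[R]_d :=
  [set x | exists2 y : 'I_r -> 'rV[R]_d,
    (forall i, K i (y i)) & x = \sum_(i < r) lam i *: y i].

(* The property determining the mixed volumes.  The d arguments are given as a
   sequence; nothing is required of sequences of another length. *)
Definition is_mixed_volume (MV : seq (set 'rV[R]_d) -> R) : Prop :=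
  (forall s t : seq (set 'rV[R]_d), size s = d ->
     (forall A, A \in s -> convex_body A) -> perm_eq s t -> MV s = MV t) /\
  (forall (r : nat) (K : 'I_r.+1 -> set 'rV[R]_d) (lam : 'I_r.+1 -> R),
     (forall i, convex_body (K i)) -> (forall i, 0 <= lam i) ->
     volume (minkowski_comb lam K) =
     \sum_(a : {ffun 'I_r.+1 -> 'I_d.+1} | (\sum_i a i == d)%N)
        (\prod_i (a i)`!)%N%:R^-1 * MV (copies K (fun i => a i))
        * \prod_i lam i ^+ a i).

(* The defining property has a solution by Minkowski's theorem; two solutions
   agree on sequences of d convex bodies. *)
Definition mixed_volume : seq (set 'rV[R]_d) -> R :=
  xget (fun=> 0) [set MV | is_mixed_volume MV].

End MixedVolumes.

(* [B] is meant to be a subspace of the subspace [A]: [A]/[B] has dimension n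
   when some n vectors of [A] form a basis of [A] modulo [B].  The value is 0
   by convention if no such n exists. *)
Definition quot_dim (k : fieldType) (V : lmodType k) (A B : set V) : nat :=
  xget 0%N [set n | exists2 v : 'I_n -> V, (forall i, A (v i)) &
    forall f, A f ->
      exists! c : {ffun 'I_n -> k}, B (f - \sum_(i < n) c i *: v i)].

(* Ideals as sets; the ideals of the library are proper by definition, whereas
   the unit ideal [setT] is needed here. *)
Section Ideals.
Context {A : comNzRingType}.
Implicit Types I J : set A.

Definition is_ideal I : Prop :=
  [/\ I 0, (forall f g, I f -> I g -> I (f + g)) &
      (forall a f, I f -> I (a * f))].

Definition ideal_gen (S : set A) : set A := smallest is_ideal S.

Definition ideal_mul I J : set A := ideal_gen [set f * g | f in I & g in J].

Definition ideal_prod (r : nat) (J : 'I_r -> set A) : set A :=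
  \big[ideal_mul/setT]_(i < r) J i.

Definition ideal_exp I (n : nat) : set A := iter n (ideal_mul I) setT.

End Ideals.

Section MonomialIdeals.
Context {k : fieldType} {N : nat}.
Implicit Types I : set {mpoly k[N]}.

Definition max_ideal : set {mpoly k[N]} :=
  ideal_gen (range (fun i : 'I_N => 'X_i)).

Definition monomial_ideal I : Prop :=
  exists M : set 'X_{1..N}, I = ideal_gen [set 'X_[m] | m in M].

Definition generated_in_degrees_le (b : nat) I : Prop :=
  I = ideal_gen [set f | I f /\ exists2 j, (j <= b)%N & f \is j.-homog].

Definition graded_family (J : nat -> set {mpoly k[N]}) : Prop :=
  [/\ forall n, monomial_ideal (J n), J 0%N = setT &
      forall i j, ideal_mul (J i) (J j) `<=` J (i + j)%N].

(* The conditions on J(1), ..., J(r) under which the mixed multiplicities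
   exist. *)
Definition admissible_families (r : nat) (J : 'I_r -> nat -> set {mpoly k[N]}) :
    Prop :=
  [/\ forall i, graded_family (J i),
      forall i, \forall n \near \oo, J i n <> [set 0] &
      exists beta : nat, forall i n, J i n <> [set 0] ->
        generated_in_degrees_le (beta * n) (J i n)].

End MonomialIdeals.

Section MixedMultiplicities.
Variables (R : realType) (k : fieldType) (d r : nat).
Implicit Types (I : nat -> set {mpoly k[d.+1]})
  (J : 'I_r -> nat -> set {mpoly k[d.+1]}) (e : nat -> ('I_r -> nat) -> R).

(* [e d0 dd] is the coefficient e_(d0, dd); it is determined for
   d0 + |dd| = d. *)
Definition is_mixed_mult_family I J e : Prop :=
  forall (n0 : nat) (n : 'I_r -> nat),
    (fun m : nat =>
       let P := ideal_prod (fun i => J i (m * n i)%N) in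
       (quot_dim P (ideal_mul (I (m * n0)%N) P))%:R / m%:R ^+ d.+1) @ \oo -->
    \sum_(d0 < d.+1)
      \sum_(dd : {ffun 'I_r -> 'I_d.+1} | (d0 + \sum_i dd i == d)%N)
        ((d0.+1)`! * \prod_i (dd i)`!)%N%:R^-1 * e d0 (fun i => dd i)
        * n0%:R ^+ d0.+1 * \prod_i (n i)%:R ^+ dd i.

(* Used only for admissible [J] and for graded families [I] of monomial ideals
   which are m-primary in positive degrees; then the limits exist and are given
   by a polynomial as above, so that the choice below is not the default one. *)
Definition mixed_mult_family I J : nat -> ('I_r -> nat) -> R :=
  xget (fun=> fun=> 0) [set e | is_mixed_mult_family I J e].

(* The defining limits for the ideals are those for their families of powers.
   The values are integers, regarded here in [R]. *)
Definition mixed_mult_ideal (I0 : set {mpoly k[d.+1]})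
    (J0 : 'I_r -> set {mpoly k[d.+1]}) : nat -> ('I_r -> nat) -> R :=
  mixed_mult_family (ideal_exp I0) (fun i => ideal_exp (J0 i)).

End MixedMultiplicities.

(* Main.v *)
Require Import Defs.
From HB Require Import structures.
From mathcomp Require Import all_boot all_order all_algebra.
From mathcomp Require Import mpoly.
From mathcomp Require Import all_classical all_reals.
From mathcomp Require Import ereal topology normedtype sequences convex.
From mathcomp Require Import zify ring lra.

(** Fix an integer w such that every K_i lies in the simplex of size w.  A point
    x of K_i then has homogeneous coordinates (w - |x|, x_1, ..., x_d), which are
    nonnegative and of sum w.  For n > 0, the ideal J(i)_n is generated by the
    monomials of degree wn + d + 1 whose exponent dominates n times the homogeneous
    coordinates of some point of K_i; the d + 1 extra degrees leave room for
    rounding up the d + 1 coordinates.  Convexity makes this a graded family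
    ([gens_sadd]), and after setting the first variable to 1 the generators of
    J(i)_n form a set of lattice points at bounded Hausdorff distance from n K_i
    ([near_gens]).

    The products of the ideals are again generated in a single degree E, so that
    multiplication by a power m^s only cuts off the degrees below E + s.  The
    quotient therefore has a monomial basis, split by degree into s slices, and
    the slice of degree E + j corresponds to the lattice points of
    j Delta + Y, where Delta is the standard simplex and Y the set of
    dehomogenised generators ([quot_dim_slices]).  If Y is close to a convex
    body X, the number of these points lies between the volumes of X plus
    simplices of sizes j - c and j + c, with c depending only on the distance
    of Y and X ([cnt_le_volume], [volume_le_cnt]).  Since the simplex is one of the bodies,
    the error of a lattice approximation is absorbed by enlarging the simplex,
    even for bodies with empty interior.  These volumes
    are forms whose coefficients are mixed volumes; summation over j < mn_0
    integrates the power j^(d_0) to (mn_0)^(d_0 + 1) / (d_0 + 1), which is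
    exactly the normalisation of the mixed multiplicities
    ([is_mixed_mult_monid]).  Hence e(M | J(1), ..., J(r)) is the mixed volume of
    the simplex and the K_i.

    For the powers of the ideals J(i)_p with p fixed, the generators of the n-th
    power are the n-fold sumset of the generators of J(i)_p, which stays within
    bounded distance of n L, where L is the convex hull of the dehomogenised
    generators ([near_nfold]).  So the mixed multiplicities of these ideals are
    mixed volumes of the hulls, multiplied by p^(d_0 + 1) when m^p replaces m
    ([hulls_of_generators]).  As the hulls are within bounded distance of p K_i,
    their rescalings tend to K_i, and coefficients of forms converge when the
    values do ([cvg_simplex_mixed_volume]).

    That volumes of Minkowski combinations are forms in the coefficients
    ([minkowski]) is itself proved by counting.  For lattice polytopes, the
    cardinality of a sum of iterated sumsets is eventually a polynomial in the
    numbers of summands ([evpoly_sumset], by Dickson's lemma), and the volume is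
    its leading form.  General bodies are limits of rescaled lattice polytopes,
    and forms of a given degree are closed under pointwise limits.  The mixed
    volumes then arise as iterated differences of the volume, which are visibly
    symmetric ([mixed_volume_exists]). *)

Set Implicit Arguments.
Unset Strict Implicit.
Unset Printing Implicit Defensive.

Import Order.TTheory GRing.Theory Num.Theory.
Import numFieldNormedType.Exports.
Local Open Scope classical_set_scope.
Local Open Scope ring_scope.

(** * Cardinality of finite sets *)

Definition cnt (T : choiceType) (A : set T) : nat :=
  size (finmap.enum_fset (fset_set A)).

Lemma cnt_seq (T : choiceType) (A : set T) (s : seq T) :
  uniq s -> (forall x, A x <-> x \in s) -> cnt A = size s.
Proof.
move=> us As.
have -> : A = [set` s] by apply/seteqP; split => x /As.
rewrite /cnt; apply/perm_size/uniq_perm => //.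
move=> x; rewrite in_fset_set; last exact: finite_seq.
by apply/idP/idP; rewrite inE.
Qed.

Lemma finite_cnt (T : choiceType) (A : set T) : finite_set A ->
  exists s : seq T, [/\ uniq s, forall x, A x <-> x \in s & cnt A = size s].
Proof.
move=> /finite_seqP[s As]; exists (undup s).
have sP x : A x <-> x \in undup s by rewrite As mem_undup.
by split=> //; [exact: undup_uniq|apply: cnt_seq => //; exact: undup_uniq].
Qed.

Lemma cnt_inj (T U : choiceType) (A : set T) (B : set U) (f : T -> U) :
  finite_set A -> finite_set B -> (forall x y, A x -> A y -> f x = f y -> x = y) ->
  (forall x, A x -> B (f x)) -> (cnt A <= cnt B)%N.
Proof.
move=> /finite_cnt[s [us sA ->]] /finite_cnt[t [ut tB ->]] finj AB.
rewrite -(size_map f); apply: uniq_leq_size.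
  rewrite map_inj_in_uniq // => x y /sA Ax /sA Ay; exact: finj.
by move=> _ /mapP[x /sA Ax ->]; apply/tB/AB.
Qed.

Lemma cnt_le (T : choiceType) (A B : set T) :
  finite_set B -> A `<=` B -> (cnt A <= cnt B)%N.
Proof.
by move=> fB AB; apply: (@cnt_inj _ _ _ _ id) => //; exact: sub_finite_set AB fB.
Qed.

Lemma cnt_image (T U : choiceType) (A : set T) (f : T -> U) :
  finite_set A -> (forall x y, A x -> A y -> f x = f y -> x = y) ->
  cnt (f @` A) = cnt A.
Proof.
move=> /finite_cnt[s [us sA ->]] finj; rewrite -(size_map f); apply: cnt_seq.
  rewrite map_inj_in_uniq // => x y /sA Ax /sA Ay; exact: finj.
move=> y; split; first by move=> [x /sA xs <-]; apply: map_f.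
by move=> /mapP[x /sA Ax ->]; exists x.
Qed.

Lemma cnt_setID (T : choiceType) (A B : set T) : finite_set A ->
  cnt A = (cnt (A `&` B) + cnt (A `\` B))%N.
Proof.
move=> /finite_cnt[s [us sA ->]].
rewrite (@cnt_seq _ (A `&` B) [seq x <- s | `[< B x >]]) ?filter_uniq //; last first.
  move=> x; rewrite mem_filter; split; first by move=> [/sA -> /asboolP ->].
  by move=> /andP[/asboolP Bx /sA].
rewrite (@cnt_seq _ (A `\` B) [seq x <- s | ~~ `[< B x >]]) ?filter_uniq //; last first.
  move=> x; rewrite mem_filter; split; first by move=> [/sA -> /asboolPn ->].
  by move=> /andP[/asboolPn Bx /sA].
by rewrite -(count_predC (fun x => `[< B x >]) s) !size_filter.
Qed.

Lemma cnt_fibers (T : choiceType) (A : set T) (h : T -> nat) n :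
  finite_set A -> (forall x, A x -> (h x < n)%N) ->
  cnt A = (\sum_(j < n) cnt (A `&` [set x | h x = j]))%N.
Proof.
elim: n A => [|n IH] A fA hA.
  rewrite big_ord0 (@cnt_seq _ A [::]) // => x; split=> // /hA; by rewrite ltn0.
rewrite (cnt_setID [set x | (h x < n)%N] fA) big_ord_recr /=; congr addn.
  rewrite IH; [|exact: finite_setIl|by move=> x []].
  apply: eq_bigr => j _; congr cnt; apply/seteqP; split=> x /=; first by move=> [[]].
  by move=> [Ax hx]; rewrite hx.
congr cnt; apply/seteqP; split=> x /=.
  move=> [Ax /negP]; rewrite -leqNgt => hx; split=> //.
  by apply/eqP; rewrite eqn_leq hx -ltnS hA.
by move=> [Ax ->]; split=> //; rewrite ltnn.
Qed.

Lemma cnt_bigcup_le (T : choiceType) (A : set T) (B : nat -> set T) n :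
  (forall k, (k < n)%N -> finite_set (B k)) ->
  (forall x, A x -> exists2 k, (k < n)%N & B k x) ->
  (cnt A <= \sum_(k < n) cnt (B k))%N.
Proof.
elim: n A => [|n IH] A fB AB.
  rewrite (@cnt_seq _ A [::]) // => x; split=> // /AB[k]; by rewrite ltn0.
have fA : finite_set A.
  apply: (@sub_finite_set _ _ (\bigcup_(k < n.+1) B k)).
    by move=> x /AB[k kn Bx]; exists k.
  by apply: bigcup_finite => //; exact: finite_II.
rewrite (cnt_setID (B n) fA) big_ord_recr /= addnC leq_add //.
  apply: IH; first by move=> k kn; apply/fB/ltnW.
  move=> x [/AB[k kn Bkx] Bnx]; exists k => //.
  by rewrite ltn_neqAle -ltnS kn andbT; apply/eqP => kE; apply: Bnx; rewrite -kE.
by apply: cnt_le; [exact: fB|exact: subIsetr].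
Qed.

(** * Sums of sets *)

Definition sadd (V : nmodType) (A B : set V) : set V :=
  [set a + b | a in A & b in B].

Section SumSets.
Variable V : nmodType.
Implicit Types A B C : set V.

Lemma saddC : commutative (@sadd V).
Proof. by move=> A B; apply/seteqP; split=> _ [a Aa [b Bb <-]]; exists b => //; exists a => //; rewrite addrC. Qed.

Lemma saddA : associative (@sadd V).
Proof.
move=> A B C; apply/seteqP; split=> [_ [a Aa [_ [b Bb [c Cc <-]] <-]]|_ [_ [a Aa [b Bb <-]] [c Cc <-]]].
  by exists (a + b); [exists a => //; exists b|exists c => //; rewrite addrA].
by exists a => //; exists (b + c); [exists b => //; exists c|rewrite addrA].
Qed.

Lemma sadd0s : left_id [set 0] (@sadd V).
Proof.
move=> A; apply/seteqP; split=> [_ [_ -> [a Aa <-]]|a Aa]; first by rewrite add0r.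
by exists 0 => //; exists a => //; rewrite add0r.
Qed.
End SumSets.

HB.instance Definition _ (V : nmodType) :=
  Monoid.isComLaw.Build (set V) [set 0] (@sadd V) (@saddA V) (@saddC V) (@sadd0s V).

Definition nfold (V : nmodType) (n : nat) (A : set V) : set V :=
  iter n (sadd A) [set 0].

Section SumSetTheory.
Variable V : nmodType.
Implicit Types A B C : set V.

Lemma big_saddP r (A : 'I_r -> set V) x :
  (\big[@sadd V/[set 0]]_(i < r) A i) x <->
  exists2 y : 'I_r -> V, (forall i, A i (y i)) & x = \sum_(i < r) y i.
Proof.
elim: r A x => [|r IH] A x.
  rewrite big_ord0; split=> [->|[y _ ->]]; last by rewrite big_ord0.
  by exists (fun=> 0) => [[]//|]; rewrite big_ord0.
rewrite big_ord_recl; split.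
  move=> [a Aa [b /IH[y yA ->] <-]].
  exists (fun i => if unlift ord0 i is Some j then y j else a).
    by move=> i; case: unliftP => [j|] ->.
  rewrite big_ord_recl unlift_none; congr (_ + _).
  by apply: eq_bigr => j _; rewrite liftK.
move=> [y yA ->]; rewrite big_ord_recl; exists (y ord0) => //.
exists (\sum_(i < r) y (lift ord0 i)) => //.
by apply/IH; exists (fun i => y (lift ord0 i)).
Qed.

Lemma finite_sadd A B : finite_set A -> finite_set B -> finite_set (sadd A B).
Proof. by move=> fA fB; apply: finite_image2. Qed.

Lemma nfold_rangeP k (A : 'I_k -> V) n x :
  nfold n (range A) x <->
  exists2 c : 'I_k -> nat, (\sum_i c i = n)%N & x = \sum_i A i *+ c i.
Proof.
elim: n x => [|n IH] x /=.
  split=> [->|[c c0 ->]].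
    by exists (fun=> 0%N); [exact: big1|rewrite big1].
  by rewrite big1 // => i _; move/eqP: c0; rewrite sum_nat_eq0 => /forallP/(_ i)/eqP ->.
split.
  move=> [_ [i _ <-] [_ /IH[c cn ->] <-]].
  exists (fun j => (c j + (j == i))%N).
    by rewrite big_split /= cn (bigD1 i) //= eqxx big1 ?addn1// => j /negPf ->.
  under [RHS]eq_bigr do rewrite mulrnDr.
  rewrite big_split /= addrC; congr (_ + _).
  by rewrite (bigD1 i) //= eqxx big1 ?addr0 // => j /negPf ->.
move=> [c cn ->].
have [i ci] : exists i, (0 < c i)%N.
  apply/existsP; rewrite -(negbK [exists _, _]); apply/negP => /existsPn c0.
  by move: cn; rewrite big1 // => i _; apply/eqP; rewrite -leqn0 leqNgt c0.
exists (A i) => //; exists (\sum_j A j *+ (c j - (j == i))).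
  apply/IH; exists (fun j => c j - (j == i))%N => //.
  apply/eqP; rewrite -eqSS -cn [X in _ == X](bigD1 i) //= (bigD1 i) //= eqxx.
  rewrite -addSn -subSn // subn1 /=; apply/eqP; congr addn.
  by apply: eq_bigr => j /negPf ->; exact: subn0.
rewrite (bigD1 i) //= eqxx addrA -mulrS -subSn // subn1 /= [RHS](bigD1 i) //=; congr (_ + _).
by apply: eq_bigr => j /negPf ->; rewrite subn0.
Qed.
End SumSetTheory.

Lemma image_sadd (V W : nmodType) (f : V -> W) (A B : set V) :
  {morph f : x y / x + y} -> f @` (sadd A B) = sadd (f @` A) (f @` B).
Proof.
move=> fD; apply/seteqP; split.
  by move=> _ [_ [a Aa [b Bb <-]] <-]; exists (f a); [exists a|exists (f b); [exists b|rewrite fD]].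
by move=> _ [_ [a Aa <-] [_ [b Bb <-] <-]]; exists (a + b); [exists a => //; exists b|rewrite fD].
Qed.

Lemma image_big_sadd (V W : nmodType) (f : V -> W) r (A : 'I_r -> set V) :
  f 0 = 0 -> {morph f : x y / x + y} ->
  f @` (\big[@sadd V/[set 0]]_(i < r) A i) = \big[@sadd W/[set 0]]_(i < r) (f @` A i).
Proof.
move=> f0 fD; elim/big_rec2: _ => [|i X Y _ <-]; first by rewrite image_set1 f0.
by rewrite image_sadd.
Qed.

Lemma image_nfold (V W : nmodType) (f : V -> W) n (A : set V) :
  f 0 = 0 -> {morph f : x y / x + y} -> f @` (nfold n A) = nfold n (f @` A).
Proof.
move=> f0 fD; elim: n => [|n IH] /=; first by rewrite image_set1 f0.
by rewrite -/(nfold n A) image_sadd // IH.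
Qed.

(** * Eventually polynomial counts of sumsets *)

(** Induction on the number k of coordinates taken into account. Let Y answer
    the question for the first k coordinates, and let h bound coordinate k on
    Y. An element whose coordinate k is at least h lies above an element of Y;
    for each of the finitely many smaller values the induction hypothesis is
    applied to the elements with this value. *)
Lemma dickson_fun k (S : set (nat -> nat)) :
  exists2 Y : seq (nat -> nat), (forall y, y \in Y -> S y) &
    forall x, S x -> exists2 y, y \in Y & forall i, (i < k)%N -> (y i <= x i)%N.
Proof.
elim: k S => [|k IH] S.
  have [[s Ss]|S0] := pselect (exists s, S s).
    by exists [:: s] => [y|x _]; [rewrite inE => /eqP ->|exists s; rewrite ?inE].
  by exists [::] => // x Sx; case: S0; exists x.
have [Y YS Yx] := IH S.
pose h := (\max_(y <- Y) y k)%N.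
have /choice[Z ZP] : forall j, exists Z : seq (nat -> nat),
    (forall y, y \in Z -> S y /\ y k = j) /\
    forall x, S x -> x k = j -> exists2 y, y \in Z & forall i, (i < k)%N -> (y i <= x i)%N.
  move=> j; have [Z ZS Zx] := IH [set x | S x /\ x k = j].
  by exists Z; split=> // x Sx xk; apply: Zx.
exists (Y ++ flatten [seq Z j | j <- iota 0 h]).
  move=> y; rewrite mem_cat => /orP[/YS//|/flatten_mapP[j _ /(ZP j).1[]//]].
move=> x Sx; have [hx|xh] := leqP h (x k).
  have [y yY yx] := Yx _ Sx; exists y; first by rewrite mem_cat yY.
  move=> i; rewrite ltnS leq_eqVlt => /orP[/eqP ->|/yx//].
  by apply: leq_trans hx; rewrite /h (big_rem y) //= leq_maxl.
have [y yZ yx] := (ZP (x k)).2 _ Sx erefl; exists y.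
  by rewrite mem_cat; apply/orP; right; apply/flatten_mapP; exists (x k); rewrite ?mem_iota.
by move=> i; rewrite ltnS leq_eqVlt => /orP[/eqP ->|/yx//]; rewrite ((ZP (x k)).1 _ yZ).2.
Qed.

Lemma dickson n (S : set 'X_{1..n}) :
  exists2 Y : seq 'X_{1..n}, (forall y, y \in Y -> S y) &
    forall x, S x -> exists2 y, y \in Y & (y <= x)%MM.
Proof.
pose e (m : 'X_{1..n}) : nat -> nat := nth 0%N m.
pose g (f : nat -> nat) : 'X_{1..n} := [multinom f i | i < n].
have eK : cancel e g by move=> m; apply/mnmP => i; rewrite mnmE (mnm_nth 0%N).
have [Y YS Yx] := dickson_fun n (e @` S).
exists (map g Y) => [_ /mapP[y /YS[m Sm <-] ->]|x Sx]; first by rewrite eK.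
have [y yY yx] := Yx (e x) (imageP _ Sx); exists (g y); first exact: map_f.
by apply/mnm_lepP => i; rewrite mnmE (mnm_nth 0%N); exact: yx.
Qed.

Lemma cnt_compositions k m :
  finite_set [set t : {ffun 'I_k.+1 -> nat} | (\sum_a t a = m)%N] /\
  cnt [set t : {ffun 'I_k.+1 -> nat} | (\sum_a t a = m)%N] = 'C(m + k, k).
Proof.
pose S := [set t : k.+1.-tuple 'I_m.+1 | (\sum_(i <- t) i)%N == m]%SET.
pose g (t : k.+1.-tuple 'I_m.+1) : {ffun 'I_k.+1 -> nat} :=
  [ffun a => nat_of_ord (tnth t a)].
have ginj : injective g.
  move=> t u /ffunP tu; apply: eq_from_tnth => a; apply: val_inj.
  by have := tu a; rewrite !ffunE.
have gP (x : {ffun _ -> nat}) : (\sum_a x a = m)%N <-> x \in map g (enum S).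
  split=> [xm|/mapP[t]].
    have lt a : (x a < m.+1)%N by rewrite ltnS -xm (bigD1 a) //= leq_addr.
    apply/mapP; exists [tuple Ordinal (lt a) | a < k.+1].
      rewrite mem_enum inE big_tuple -[X in _ == X]xm; apply/eqP.
      by apply: eq_bigr => a _; rewrite tnth_mktuple.
    by apply/ffunP => a; rewrite ffunE tnth_mktuple.
  rewrite mem_enum inE big_tuple => /eqP tm ->; rewrite -[RHS]tm.
  by apply: eq_bigr => a _; rewrite ffunE.
split; first by apply/finite_seqP; exists (map g (enum S)); apply/seteqP; split => x /gP.
rewrite (@cnt_seq _ _ (map g (enum S))) //; last by rewrite map_inj_uniq ?enum_uniq.
by rewrite size_map -cardE addnC card_ord_partitions addnC.
Qed.

(** Multiplicativity of cardinality, by passing to the finite type of the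
    values that occur. *)
Lemma cnt_ffun r (T : choiceType) (P : 'I_r -> set T) :
  (forall i, finite_set (P i)) ->
  finite_set [set x : {ffun 'I_r -> T} | forall i, P i (x i)] /\
  cnt [set x : {ffun 'I_r -> T} | forall i, P i (x i)] = (\prod_i cnt (P i))%N.
Proof.
move=> fP.
have /choice[s sP] : forall i, exists s : seq T,
    [/\ uniq s, forall x, P i x <-> x \in s & cnt (P i) = size s].
  by move=> i; exact: finite_cnt.
pose S := flatten [seq s i | i <- enum 'I_r].
pose F i : pred (seq_sub S) := [pred t | ssval t \in s i].
pose g (x : {ffun 'I_r -> seq_sub S}) : {ffun 'I_r -> T} := [ffun i => ssval (x i)].
have ginj : injective g.
  move=> x y /ffunP xy; apply/ffunP => i; apply: val_inj.
  by have := xy i; rewrite !ffunE.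
have gP (x : {ffun _ -> T}) : (forall i, P i (x i)) <-> x \in map g (enum (family F)).
  split=> [xP|/mapP[t]].
    have xS i : x i \in S.
      by apply/flatten_mapP; exists i; [rewrite mem_enum|case: (sP i) => _ <- _].
    apply/mapP; exists [ffun i => SeqSub (xS i)].
      rewrite mem_enum; apply/familyP => i; rewrite ffunE inE /=.
      by case: (sP i) => _ <- _.
    by apply/ffunP => i; rewrite !ffunE.
  rewrite mem_enum => /familyP tF -> i; rewrite ffunE.
  by case: (sP i) => _ -> _; have := tF i; rewrite inE.
split; first by apply/finite_seqP; exists (map g (enum (family F))); apply/seteqP; split => x /gP.
rewrite (@cnt_seq _ _ (map g (enum (family F)))) //; last by rewrite map_inj_uniq ?enum_uniq.
rewrite size_map -cardE card_family foldrE big_map big_enum /=.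
apply: eq_bigr => i _; have [us _ ->] := sP i.
rewrite cardE -(size_map val); apply/perm_size/uniq_perm => //.
  by rewrite map_inj_uniq ?enum_uniq //; exact: val_inj.
move=> x; apply/mapP/idP => [[t]|xs].
  by rewrite mem_enum inE => ts ->.
have xS : x \in S by apply/flatten_mapP; exists i; rewrite ?mem_enum.
by exists (SeqSub xS); rewrite // mem_enum inE.
Qed.

Section EventuallyPolynomial.
Variables (R : realType) (r : nat).

Definition evpoly (f : ('I_r -> nat) -> R) : Prop :=
  exists B (p : {mpoly R[r]}), forall b, (forall i, (B <= b i)%N) ->
    f b = p.@[fun i => (b i)%:R].

Lemma evpolyB f g : evpoly f -> evpoly g -> evpoly (fun b => f b - g b).
Proof.
move=> [B [p fp]] [C [q gq]]; exists (maxn B C), (p - q) => b hb.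
rewrite mevalB fp ?gq // => i; apply: leq_trans (hb i); first exact: leq_maxr.
exact: leq_maxl.
Qed.

(** In this form the binomial coefficient is visibly a polynomial in n. *)
Lemma binom_prod k n :
  'C(n + k, k)%:R = \prod_(j < k) ((n + j.+1)%:R / j.+1%:R) :> R.
Proof.
elim: k => [|k IH]; first by rewrite bin0 big_ord0.
rewrite big_ord_recr /= -IH mulrA; apply: (canRL (mulfK _)).
  by rewrite pnatr_eq0.
by rewrite -!natrM addnS mulnC -mul_bin_diag /= mulnC.
Qed.

Lemma evpoly_binom k (e : 'I_r -> nat) (f : ('I_r -> nat) -> R) :
  (forall b, (forall i, (e i <= b i)%N) -> f b = (\prod_i 'C(b i - e i + k, k))%N%:R) ->
  evpoly f.
Proof.
move=> fE; exists (\sum_i e i)%N.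
exists (\prod_i \prod_(j < k) (('X_i - (e i)%:R%:MP + j.+1%:R%:MP) * (j.+1%:R^-1)%:MP)).
move=> b hb.
have eb i : (e i <= b i)%N.
  by apply: leq_trans (hb i); rewrite (bigD1 i) //= leq_addr.
rewrite fE // natr_prod rmorph_prod /=; apply: eq_bigr => i _.
rewrite binom_prod rmorph_prod /=; apply: eq_bigr => j _.
by rewrite mevalM mevalD mevalB !mevalC mevalXU natrD natrB.
Qed.
End EventuallyPolynomial.

Section NathansonRuzsa.
Variables (V : nmodType) (r k : nat) (A : 'I_r -> 'I_k.+1 -> V).

Let n := #|{: 'I_r * 'I_k.+1}|.
Let ix (i : 'I_r) (a : 'I_k.+1) : 'I_n := enum_rank (i, a).

(* A word is a multiset of letters A i a, encoded as a monomial in one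
   variable for each pair (i, a). It has a multidegree wdeg, counting its
   letters for each i, and a value wval, the sum of its letters; the sumset
   consists of the values of the words of a given multidegree. *)
Let wdeg (x : 'X_{1..n}) i := (\sum_a x (ix i a))%N.
Let wval (x : 'X_{1..n}) : V := \sum_i \sum_a A i a *+ x (ix i a).

Let pack (t : 'I_r -> 'I_k.+1 -> nat) : 'X_{1..n} :=
  [multinom t (enum_val l).1 (enum_val l).2 | l < n].

Let packE t i a : pack t (ix i a) = t i a.
Proof. by rewrite mnmE enum_rankK. Qed.

Let ixP (l : 'I_n) : exists i a, l = ix i a.
Proof.
exists (enum_val l).1, (enum_val l).2.
by apply: (can_inj enum_valK); rewrite /ix enum_rankK -surjective_pairing.
Qed.

Let words (b : 'I_r -> nat) : set 'X_{1..n} := [set x | forall i, wdeg x i = b i].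

Let wordsE b : words b =
  (fun t : {ffun 'I_r -> {ffun 'I_k.+1 -> nat}} => pack (fun i a => t i a)) @`
    [set t : {ffun _ -> {ffun _ -> nat}} | forall i, (\sum_a t i a = b i)%N].
Proof.
apply/seteqP; split=> [x xb|_ [t tb <-] i]; last first.
  by rewrite -tb; apply: eq_bigr => a _; rewrite packE.
exists [ffun i => [ffun a => x (ix i a)]].
  by move=> i; rewrite -xb; apply: eq_bigr => a _; rewrite !ffunE.
by apply/mnmP => l; have [i [a ->]] := ixP l; rewrite packE !ffunE.
Qed.

Let finite_words b : finite_set (words b).
Proof.
rewrite wordsE; apply: finite_image.
by apply: (cnt_ffun (P := fun i => [set t : {ffun _ -> nat} | (\sum_a t a = b i)%N]) _).1 => i; exact: (cnt_compositions _ _).1.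
Qed.

Let cnt_words b : cnt (words b) = (\prod_i 'C(b i + k, k))%N.
Proof.
rewrite wordsE cnt_image.
- have fP i : finite_set [set t : {ffun 'I_k.+1 -> nat} | (\sum_a t a = b i)%N].
    exact: (cnt_compositions _ _).1.
  rewrite (cnt_ffun fP).2; apply: eq_bigr => i _; exact: (cnt_compositions _ _).2.
- by apply: (cnt_ffun (P := fun i => [set t : {ffun _ -> nat} | (\sum_a t a = b i)%N]) _).1 => i; exact: (cnt_compositions _ _).1.
- move=> t u _ _ tu; apply/ffunP => i; apply/ffunP => a.
  by rewrite -(packE (fun i a => t i a)) tu packE.
Qed.

Let wdegD x y i : wdeg (x + y)%MM i = (wdeg x i + wdeg y i)%N.
Proof. by rewrite -big_split; apply: eq_bigr => a _; rewrite mnmDE. Qed.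

Let wvalD x y : wval (x + y)%MM = wval x + wval y.
Proof.
rewrite -big_split; apply: eq_bigr => i _; rewrite -big_split.
by apply: eq_bigr => a _; rewrite mnmDE mulrnDr.
Qed.

(** Standard words represent the elements of the sumset without repetition. *)
Let standard (x : 'X_{1..n}) : Prop := forall y,
  (forall i, wdeg y i = wdeg x i) -> wval y = wval x -> (x <= y)%O.

Let sumset b := \big[@sadd V/[set 0]]_(i < r) nfold (b i) (range (A i)).

Let sumsetE b : sumset b = wval @` (words b `&` standard).
Proof.
apply/seteqP; split=> [v|_ [x [xb _] <-]]; last first.
  apply/big_saddP; exists (fun i => \sum_a A i a *+ x (ix i a)) => // i.
  by apply/nfold_rangeP; exists (fun a => x (ix i a)) => //; exact: xb.
move=> /big_saddP[y yA ->].
have /choice[t tP] : forall i, exists c : 'I_k.+1 -> nat,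
    (\sum_a c a = b i)%N /\ y i = \sum_a A i a *+ c a.
  by move=> i; have /nfold_rangeP[c ? ?] := yA i; exists c.
pose W := words b `&` [set x | wval x = \sum_i y i].
have tW : W (pack t).
  split; first by move=> i; rewrite -(tP i).1; apply: eq_bigr => a _; rewrite packE.
  apply: eq_bigr => i _; rewrite (tP i).2.
  by apply: eq_bigr => a _; rewrite packE.
have fW : finite_set W by apply: finite_setIl.
have [s [us sW _]] := finite_cnt fW.
have [x xW xmin] : exists2 x, W x & forall z, W z -> (x <= z)%O.
  have := sort_sorted (@le_total _ 'X_{1..n}) s.
  have mem_s z : z \in sort <=%O s <-> W z by rewrite mem_sort; split=> /sW.
  case: (sort _ s) mem_s => [/(_ (pack t))[_ /(_ tW)]//|x s' mem_s ss'].
  exists x; first by apply/mem_s; rewrite inE eqxx.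
  move=> z /mem_s; rewrite inE => /orP[/eqP -> //|zs'].
  by have /allP := order_path_min le_trans ss'; apply.
exists x; last exact: xW.2.
split; first exact: xW.1.
move=> z zx zv; apply: xmin; split; first by move=> i; rewrite zx xW.1.
by rewrite /= zv xW.2.
Qed.

(** Inclusion-exclusion, one element of Y at a time: the words above y0 and y
    are those above the least common multiple of y0 and y. When Y is empty,
    the words above y0 are the products of y0 with arbitrary words, of the
    multidegree lowered by that of y0. *)
Let count_above (Y : seq 'X_{1..n}) (y0 : 'X_{1..n}) (R : realType) :
  @evpoly R r (fun b => (cnt (words b `&` [set x | (y0 <= x)%MM /\
    forall y, y \in Y -> ~~ (y <= x)%MM]))%:R).
Proof.
elim: Y y0 => [|y Y IH] y0; last first.
  have [B [p pE]] := evpolyB (IH y0) (IH (mlcm y0 y)).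
  exists B, p => b /pE <-.
  rewrite [X in _ = X%:R - _](cnt_setID [set x | (y <= x)%MM]); last exact: finite_setIl.
  rewrite natrD addrAC -natrB; last first.
    apply: cnt_le; first by do 2! apply: finite_setIl.
    move=> x [xb [/=]]; rewrite lem_mlcm => /andP[y0x yx] xY.
    by split.
  have -> : (words b `&` [set x | (y0 <= x)%MM /\ (forall z, z \in Y -> ~~ (z <= x)%MM)])
      `&` [set x | (y <= x)%MM] =
      words b `&` [set x | (mlcm y0 y <= x)%MM /\ (forall z, z \in Y -> ~~ (z <= x)%MM)].
    apply/seteqP; split=> x /=.
      by move=> [[xb [y0x xY]] yx]; split=> //; split=> //; rewrite lem_mlcm y0x.
    by move=> [xb []]; rewrite lem_mlcm => /andP[y0x yx] xY.
  rewrite subnn add0r; congr (cnt _)%:R; apply/seteqP; split=> x /=.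
    move=> [xb [y0x xY]]; split.
      by split=> //; split=> // z zY; apply: xY; rewrite inE zY orbT.
    by apply/negP/xY; rewrite inE eqxx.
  move=> [[xb [y0x xY]] /negP yx]; split=> //; split=> // z.
  by rewrite inE => /orP[/eqP ->|/xY].
apply: (@evpoly_binom _ _ k (wdeg y0)) => b hb; congr _%:R.
rewrite -(cnt_words (fun i => b i - wdeg y0 i)%N).
rewrite -(@cnt_image _ _ (words _) (fun x => (y0 + x)%MM)) //; last first.
  by move=> x y _ _ /addmI.
congr cnt; apply/seteqP; split=> [x [xb [y0x _]]|_ [x xb <-]].
  exists (x - y0)%MM; last by rewrite addmC submK.
  by move=> i; rewrite -xb -[in RHS](submK y0x) wdegD addnK.
split; first by move=> i; rewrite wdegD xb subnKC.
by split=> //; rewrite lem_addr.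
Qed.

(** The theorem of Nathanson and Ruzsa. A multiple of a word that is not
    standard is not standard, because the monomial order is compatible with
    multiplication. By Dickson's lemma the standard words are those that are
    divisible by none of finitely many words. *)
Theorem evpoly_sumset (R : realType) :
  @evpoly R r (fun b => (cnt (\big[@sadd V/[set 0]]_(i < r) nfold (b i) (range (A i))))%:R).
Proof.
have [Y Ybad Yx] := dickson (~` standard).
have [B [p pE]] := count_above Y 0%MM R.
exists B, p => b /pE <-; rewrite -/(sumset b) sumsetE cnt_image.
- congr (cnt _)%:R; apply/seteqP; split=> x [xb] /=.
    move=> xs; split=> //; split; first by apply/mnm_lepP => i; rewrite mnm0E.
    move=> y /Ybad ys; apply/negP => yx; apply: ys => z zy zv.
    rewrite -(lemc_add2r (x - y)%MM) submK //; apply: xs.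
      by move=> i; rewrite -[in RHS](submK yx) !wdegD zy.
    by rewrite -[in RHS](submK yx) !wvalD zv.
  move=> [_ xY]; split=> //; apply: contrapT => /Yx[y yY yx].
  by have := xY y yY; rewrite yx.
- exact: finite_setIl.
- move=> x y [xb xs] [yb ys] xy; apply/eqP; rewrite eq_le.
  by rewrite xs ?ys // => i; rewrite xb yb.
Qed.
End NathansonRuzsa.

(** * Limits of polynomial sequences *)

Section Limits.
Variable R : realType.
Implicit Types (u v : nat -> R) (l : R).

Lemma cvg_near_eq u v l : (\forall m \near \oo, u m = v m) ->
  v @ \oo --> l -> u @ \oo --> l.
Proof.
move=> uv vl; apply: cvg_trans vl; apply: near_eq_cvg.
by apply: filterS uv => m ->.
Qed.

Lemma cvg_sumr (I : Type) (s : seq I) (P : pred I) (f : I -> nat -> R) (l : I -> R) :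
  (forall i, P i -> f i n @[n --> \oo] --> l i) ->
  (fun n => \sum_(i <- s | P i) f i n) @ \oo --> \sum_(i <- s | P i) l i.
Proof.
by move=> fl; apply: cvg_big => //; exact: add_continuous.
Qed.

Lemma cvg_prodr (I : Type) (s : seq I) (P : pred I) (f : I -> nat -> R) (l : I -> R) :
  (forall i, P i -> f i n @[n --> \oo] --> l i) ->
  (fun n => \prod_(i <- s | P i) f i n) @ \oo --> \prod_(i <- s | P i) l i.
Proof.
by move=> fl; apply: cvg_big => //; exact: mul_continuous.
Qed.

Lemma cvg_exprn u l n : u @ \oo --> l -> (fun m => u m ^+ n) @ \oo --> l ^+ n.
Proof.
move=> ul; elim: n => [|n IH].
  by rewrite expr0; under eq_fun do rewrite expr0; exact: cvg_cst.
by rewrite exprS; under eq_fun do rewrite exprS; exact: cvgM.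
Qed.

Lemma cvg_invn : (fun n : nat => n%:R^-1 : R) @ \oo --> (0 : R).
Proof.
apply/gtr0_cvgV0; last exact: cvgr_idn.
by near=> n; rewrite ltr0n; near: n; exact: nbhs_infty_gt.
Unshelve. all: by end_near. Qed.

Lemma cvg_powdiv i e : (i <= e)%N ->
  (fun m : nat => m%:R ^+ i / m%:R ^+ e : R) @ \oo --> ((i == e)%:R : R).
Proof.
move=> ie.
have near_pos : \forall m \near \oo, (m%:R ^+ i / m%:R ^+ e : R) = m%:R^-1 ^+ (e - i).
  near=> m.
  have m0 : (m%:R : R) != 0.
    by rewrite pnatr_eq0 -lt0n; near: m; exact: nbhs_infty_gt.
  rewrite -{1}(subnK ie) exprD invfM mulrCA mulfV ?mulr1 ?expf_neq0 //.
  by rewrite exprVn.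
apply: (cvg_near_eq near_pos).
rewrite eqn_leq ie -subn_eq0 -expr0n; apply: cvg_exprn; exact: cvg_invn.
Unshelve. all: by end_near. Qed.

Lemma cvg_horner_div (Q : {poly R}) e : (size Q <= e.+1)%N ->
  (fun m : nat => Q.[m%:R] / m%:R ^+ e) @ \oo --> Q`_e.
Proof.
move=> sQ.
have -> : (fun m : nat => Q.[m%:R] / m%:R ^+ e) =
    (fun m => \sum_(i < e.+1) Q`_i * (m%:R ^+ i / m%:R ^+ e)).
  apply/funext => m; rewrite (horner_coef_wide _ sQ) mulr_suml.
  by apply: eq_bigr => i _; rewrite mulrA.
have -> : Q`_e = \sum_(i < e.+1) Q`_i * (i == e :> nat)%:R.
  rewrite (bigD1 ord_max) //= eqxx mulr1 big1 ?addr0 // => i ie.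
  by rewrite [_ == _](negPf ie) mulr0.
apply: cvg_sumr => i _; apply: cvgMl_tmp; apply: cvg_powdiv; exact: leq_ord.
Qed.

(** A degree e greater than d is impossible: the quotient by m^e would tend
    both to the leading coefficient and to 0. *)
Lemma cvg_poly_growth (Q : {poly R}) (C : R) d M :
  (forall m : nat, (M <= m)%N -> `|Q.[m%:R]| <= C * m%:R ^+ d) ->
  (fun m : nat => Q.[m%:R] / m%:R ^+ d) @ \oo --> Q`_d.
Proof.
move=> QC; apply: cvg_horner_div; rewrite leqNgt; apply/negP => sQ.
have Q0 : Q != 0 by rewrite -size_poly_gt0 (leq_ltn_trans _ sQ).
pose e := (size Q).-1; have eQ : size Q = e.+1 by rewrite prednK ?size_poly_gt0.
have de : (d < e)%N by move: sQ; rewrite eQ.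
have lim1 : (fun m : nat => Q.[m%:R] / m%:R ^+ e) @ \oo --> lead_coef Q.
  by apply: cvg_horner_div; rewrite eQ.
have lim2 : (fun m : nat => Q.[m%:R] / m%:R ^+ e) @ \oo --> (0 : R).
  apply/norm_cvg0P; apply: (@squeeze_cvgr _ _ _ _ (fun=> 0) (fun m => C * (m%:R ^+ d / m%:R ^+ e))).
  - near=> m; rewrite normr_ge0 /= normrM normfV (ger0_norm (exprn_ge0 _ _)) // mulrA.
    by rewrite ler_wpM2r ?invr_ge0 ?exprn_ge0 //; apply: QC; near: m; exact: nbhs_infty_ge.
  - exact: cvg_cst.
  - rewrite -[X in _ --> X](mulr0 C); apply: cvgMl_tmp.
    by have := cvg_powdiv (ltnW de); rewrite ltn_eqF.
move: Q0; rewrite -lead_coef_eq0 => /eqP; apply.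
exact: cvg_unique lim1 lim2.
Unshelve. all: by end_near. Qed.
End Limits.

(** * Homogeneous forms and their values at positive integers *)

Section Forms.
Variables (R : realType) (d s : nat).
Local Notation expo := {ffun 'I_s -> 'I_d.+1}.
Implicit Types (c : expo -> R) (a b x : expo).

Definition hform c (v : 'I_s -> R) : R :=
  \sum_(a : expo | (\sum_i a i == d)%N) c a * \prod_i v i ^+ a i.

Lemma hform_scale c t v : hform c (fun i => t * v i) = t ^+ d * hform c v.
Proof.
rewrite mulr_sumr; apply: eq_bigr => a /eqP ad.
under eq_bigr do rewrite exprMn.
by rewrite big_split /= -expr_sum ad mulrCA.
Qed.

(** In one variable, the weights are the entries of the inverse of the
    Vandermonde matrix with nodes 1, ..., d + 1. In several variables their
    products work, by distributivity. *)
Lemma interpolation_weights : exists W : expo -> expo -> R, forall a b,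
  \sum_x W a x * \prod_i (x i).+1%:R ^+ b i = (a == b)%:R.
Proof.
pose v : 'rV[R]_d.+1 := \row_j j.+1%:R.
have Vu : Vandermonde d.+1 v \in unitmx.
  rewrite unitmxE det_Vandermonde unitfE; apply/prodf_neq0 => i _.
  apply/prodf_neq0 => j ij; rewrite !mxE subr_eq0 eqr_nat eqSS.
  by rewrite gtn_eqF.
pose w := invmx (Vandermonde d.+1 v).
have wP (a b : 'I_d.+1) : \sum_x w x a * x.+1%:R ^+ b = (a == b)%:R.
  have := mulmxV Vu => /matrixP/(_ b a); rewrite !mxE eq_sym => <-.
  by apply: eq_bigr => x _; rewrite !mxE mulrC.
exists (fun a x => \prod_i w (x i) (a i)) => a b.
under eq_bigr do rewrite -big_split.
rewrite -(bigA_distr_bigA (fun (i : 'I_s) (y : 'I_d.+1) => w y (a i) * y.+1%:R ^+ b i)) /=.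
under eq_bigr do rewrite wP.
have [->|ab] := eqVneq a b; first by rewrite big1 // => i _; rewrite eqxx.
have /existsP[i /negPf ai] : [exists i, a i != b i].
  rewrite -negb_forall; apply: contra ab => /forallP ab; apply/eqP/ffunP => i.
  exact/eqP.
by rewrite (bigD1 i) //= ai mul0r.
Qed.

(** Each coefficient is a linear combination, with weights independent of the
    form, of the values at finitely many points with positive integer
    coordinates. Identities and limits therefore pass between coefficients and
    values. *)
Lemma coef_from_values : exists W : expo -> expo -> R, forall c a,
  (\sum_i a i = d)%N -> c a = \sum_x W a x * hform c (fun i => (x i).+1%:R).
Proof.
have [W WP] := interpolation_weights; exists W => c a ad.
under eq_bigr do rewrite /hform mulr_sumr.
rewrite exchange_big /= (bigD1 a) ?ad //= [X in _ + X]big1 ?addr0.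
  by under eq_bigr do rewrite mulrCA; rewrite -mulr_sumr WP eqxx mulr1.
move=> b /andP[_ ba]; under eq_bigr do rewrite mulrCA.
by rewrite -mulr_sumr WP eq_sym (negPf ba) mulr0.
Qed.

Lemma hform_coef_inj c c' :
  (forall n : 'I_s -> nat, (forall i, (0 < n i)%N) ->
     hform c (fun i => (n i)%:R) = hform c' (fun i => (n i)%:R)) ->
  forall a, (\sum_i a i = d)%N -> c a = c' a.
Proof.
move=> cc' a ad; have [W WP] := coef_from_values.
rewrite (WP c) // (WP c') //; apply: eq_bigr => x _.
by rewrite (cc' (fun i => (x i).+1)).
Qed.

Lemma hform_coef_cvg (c : nat -> expo -> R) c0 :
  (forall n : 'I_s -> nat, (forall i, (0 < n i)%N) ->
     (fun p => hform (c p) (fun i => (n i)%:R)) @ \oo --> hform c0 (fun i => (n i)%:R)) ->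
  forall a, (\sum_i a i = d)%N -> (fun p => c p a) @ \oo --> c0 a.
Proof.
move=> cF a ad; have [W WP] := coef_from_values.
rewrite (WP c0) //; under eq_fun do rewrite (WP (c _) a ad).
apply: cvg_sumr => x _; apply: cvgMl_tmp.
by apply: (cF (fun i => (x i).+1)).
Qed.

(** The coefficients of the limit are the interpolated limits of the values. *)
Lemma hform_closed (c : nat -> expo -> R) (F : ('I_s -> nat) -> R) :
  (forall n : 'I_s -> nat, (forall i, (0 < n i)%N) ->
     (fun p => hform (c p) (fun i => (n i)%:R)) @ \oo --> F n) ->
  exists c0, forall n : 'I_s -> nat, (forall i, (0 < n i)%N) ->
    F n = hform c0 (fun i => (n i)%:R).
Proof.
move=> cF; have [W WP] := coef_from_values.
exists (fun a => \sum_x W a x * F (fun i => (x i).+1)) => n n0.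
apply: (cvg_unique _ (cF n n0)) => //.
apply: cvg_sumr => a /eqP ad; apply: cvgMr_tmp.
under eq_fun do rewrite (WP (c _) a ad).
by apply: cvg_sumr => x _; apply: cvgMl_tmp; apply: cF.
Qed.

Lemma cvg_hform (c : nat -> expo -> R) c0 (v : nat -> 'I_s -> R) v0 :
  (forall a, (\sum_i a i = d)%N -> (fun p => c p a) @ \oo --> c0 a) ->
  (forall i, (fun p => v p i) @ \oo --> v0 i) ->
  (fun p => hform (c p) (v p)) @ \oo --> hform c0 v0.
Proof.
move=> cc vv; apply: cvg_sumr => a /eqP ad; apply: cvgM; first exact: cc.
by apply: cvg_prodr => i _; apply: cvg_exprn.
Qed.

(** On the ray through n the function is eventually a polynomial in m. The
    bound removes its coefficients above m^d, and the coefficient of m^d is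
    the part of degree d of the given polynomial, evaluated at n. *)
Lemma evpoly_leading_form (f : ('I_s -> nat) -> R) : evpoly f ->
  exists c, forall n : 'I_s -> nat, (forall i, (0 < n i)%N) ->
    (exists C : R, forall m : nat, (0 < m)%N -> `|f (fun i => m * n i)%N| <= C * m%:R ^+ d) ->
    (fun m => f (fun i => m * n i)%N / m%:R ^+ d) @ \oo --> hform c (fun i => (n i)%:R).
Proof.
move=> [B [p fp]]; pose ex a : 'X_{1..s} := [multinom (a i : nat) | i < s].
exists (fun a => p@_(ex a)) => n n0 [C fC].
pose Q : {poly R} := \sum_(m <- msupp p) (p@_m * \prod_i (n i)%:R ^+ m i) *: 'X^(mdeg m).
have fQ m : (B <= m)%N -> f (fun i => m * n i)%N = Q.[m%:R].
  move=> Bm; rewrite fp; last by move=> i; rewrite (leq_trans Bm) // leq_pmulr.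
  rewrite mevalE horner_sum; apply: eq_bigr => mu _.
  rewrite hornerZ hornerXn -mulrA; congr (_ * _).
  under eq_bigr do rewrite natrM exprMn.
  by rewrite big_split /= -expr_sum -mdegE mulrC.
have Qd : Q`_d = hform (fun a => p@_(ex a)) (fun i => (n i)%:R).
  pose G (m : 'X_{1..s}) := p@_m * \prod_i (n i)%:R ^+ m i.
  have -> : hform (fun a => p@_(ex a)) (fun i => (n i)%:R) =
      \sum_(a : expo | (\sum_i a i == d)%N && (ex a \in msupp p)) G (ex a).
    rewrite big_mkcondr; apply: eq_bigr => a _; rewrite /G.
    under [X in if _ then _ * X else _]eq_bigr do rewrite mnmE.
    by case: ifPn => // /memN_msupp_eq0 ->; rewrite mul0r.
  rewrite coef_sum; under eq_bigr do rewrite coefZ coefXn mulr_natr mulrb.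
  rewrite -big_mkcond -big_filter -[RHS]big_filter -[RHS](big_map ex xpredT G).
  apply/perm_big/uniq_perm; first by rewrite filter_uniq.
    rewrite map_inj_in_uniq ?filter_uniq ?index_enum_uniq // => a b _ _ /mnmP ab.
    by apply/ffunP => i; apply: val_inj; have := ab i; rewrite !mnmE.
  move=> m; rewrite mem_filter; apply/andP/mapP.
    move=> [/eqP/esym md mp]; have lt i : (m i < d.+1)%N.
      by rewrite ltnS -md mdegE (bigD1 i) //= leq_addr.
    have exm : ex [ffun i => Ordinal (lt i)] = m.
      by apply/mnmP => i; rewrite mnmE ffunE.
    exists [ffun i => Ordinal (lt i)] => //.
    rewrite mem_filter mem_index_enum exm mp !andbT -[X in _ == X]md mdegE; apply/eqP.
    by apply: eq_bigr => i _; rewrite ffunE.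
  move=> [a]; rewrite mem_filter => /andP[/andP[/eqP ad exp] _] ->; split => //.
  by rewrite mdegE -[X in X == _]ad; apply/eqP/eq_bigr => i _; rewrite mnmE.
rewrite -Qd; apply: (cvg_near_eq (v := fun m => Q.[m%:R] / m%:R ^+ d)).
  by near=> m; rewrite fQ //; near: m; exact: nbhs_infty_ge.
apply: (@cvg_poly_growth _ _ C _ B.+1) => m Bm; rewrite -fQ ?(ltnW Bm) //.
by apply: fC; apply: leq_ltn_trans Bm.
Unshelve. all: by end_near. Qed.
End Forms.

(** * Power sums *)

Section PowerSums.
Variable R : realType.

(** The difference is the sum of the products (x + 1)^(e - i) x^i, each of
    which lies between x^e and (x + 1)^e. *)
Lemma diff_expr_bounds (x : R) e : 0 <= x ->
  e.+1%:R * x ^+ e <= (x + 1) ^+ e.+1 - x ^+ e.+1 <= e.+1%:R * (x + 1) ^+ e.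
Proof.
move=> x0; rewrite subrXX addrAC subrr add0r mul1r.
have x1 : 0 <= x + 1 by lra.
have xx1 : x <= x + 1 by lra.
have sumE (y : R) : e.+1%:R * y ^+ e = \sum_(i < e.+1) y ^+ (e - i) * y ^+ i.
  under eq_bigr => i _ do rewrite -exprD subnK ?leq_ord //.
  by rewrite sumr_const card_ord mulr_natl.
rewrite !sumE; apply/andP; split; apply: ler_sum => i _.
  by apply: ler_wpM2r; [exact: exprn_ge0|apply: lerXn2r; rewrite ?nnegrE].
by apply: ler_wpM2l; [exact: exprn_ge0|apply: lerXn2r; rewrite ?nnegrE].
Qed.

(** Summation of the bounds for consecutive differences. The shift c allows
    for the bounded errors in the sizes of simplices below. *)
Lemma powsum_bounds e c N :
  N%:R ^+ e.+1 - e.+1%:R * N%:R ^+ e <= e.+1%:R * \sum_(j < N) (j + c)%:R ^+ e :> R /\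
  e.+1%:R * \sum_(j < N) (j + c)%:R ^+ e <= (N + c)%:R ^+ e.+1 :> R.
Proof.
split.
  rewrite lerBlDr; elim: N => [|N IH].
    by rewrite big_ord0 mulr0 add0r expr0n /= mulr_ge0 ?exprn_ge0.
  rewrite big_ord_recr /= mulrDr.
  have /andP[_] := diff_expr_bounds e (ler0n R N); rewrite -(natrD _ N 1) addn1 => h.
  have : (N%:R ^+ e : R) <= (N + c)%:R ^+ e by apply: lerXn2r; rewrite ?nnegrE ?ler_nat ?leq_addr.
  move=> h2; have := ler_wpM2l (ler0n R e.+1) h2; lra.
elim: N => [|N IH]; first by rewrite big_ord0 mulr0 exprn_ge0.
rewrite big_ord_recr /= mulrDr.
have /andP[] := diff_expr_bounds e (ler0n R (N + c)); rewrite -(natrD _ _ 1) addn1 -addSn; lra.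
Qed.

Lemma cvg_powsum e c (N : nat -> nat) (nu : R) :
  (fun m => (N m)%:R / m%:R : R) @ \oo --> nu ->
  (fun m => (\sum_(j < N m) (j + c)%:R ^+ e) / m%:R ^+ e.+1) @ \oo --> nu ^+ e.+1 / e.+1%:R.
Proof.
move=> Nnu; rewrite -[nu ^+ _ / _]mulrC.
have -> : (fun m => (\sum_(j < N m) (j + c)%:R ^+ e) / m%:R ^+ e.+1 : R) =
    (fun m => e.+1%:R^-1 * (e.+1%:R * (\sum_(j < N m) (j + c)%:R ^+ e) / m%:R ^+ e.+1)).
  by apply/funext => m; rewrite -!mulrA mulKf ?pnatr_eq0.
apply: cvgMl_tmp.
apply: (@squeeze_cvgr _ _ _ _
  (fun m => ((N m)%:R / m%:R) ^+ e.+1 - e.+1%:R * (((N m)%:R / m%:R) ^+ e * m%:R^-1))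
  (fun m => ((N m)%:R / m%:R + c%:R * m%:R^-1) ^+ e.+1)).
- near=> m.
  have m0 : 0 < m%:R :> R by rewrite ltr0n; near: m; exact: nbhs_infty_gt.
  have [h1 h2] := powsum_bounds e c (N m).
  apply/andP; split.
    rewrite ler_pdivlMr ?exprn_gt0 //; apply: le_trans h1.
    rewrite le_eqVlt; apply/orP; left; apply/eqP; rewrite !expr_div_n !exprS.
    by move: (m%:R : R) (lt0r_neq0 m0) => x x0; field; rewrite ?expf_neq0 ?x0.
  rewrite ler_pdivrMr ?exprn_gt0 //; apply: le_trans h2 _.
  by rewrite -mulrDl expr_div_n divfK ?expf_neq0 ?gt_eqF // natrD.
- rewrite -[X in _ --> X]subr0; apply: cvgB; first exact: cvg_exprn.
  rewrite -[X in _ --> X](mulr0 e.+1%:R); apply: cvgMl_tmp.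
  rewrite -[X in _ --> X](mulr0 (nu ^+ e)); apply: cvgM; first exact: cvg_exprn.
  exact: cvg_invn.
- apply: cvg_exprn; rewrite -[X in _ --> X]addr0; apply: cvgD => //.
  rewrite -[X in _ --> X](mulr0 c%:R); apply: cvgMl_tmp; exact: cvg_invn.
Unshelve. all: by end_near. Qed.
End PowerSums.

(** * Covers by boxes *)

Section Volume.
Variables (R : realType) (d : nat).
Hypothesis d_gt0 : (0 < d)%N.
Implicit Types (A B : set 'rV[R]_d) (x y : 'rV[R]_d) (t : R).

Definition box (a b : 'rV[R]_d) : set 'rV[R]_d :=
  [set x | forall i, a 0 i <= x 0 i <= b 0 i].

Definition bounded_coord A := exists C : R, forall x i, A x -> `|x 0 i| <= C.

Definition fatten t A : set 'rV[R]_d :=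
  [set x | exists2 y, A y & forall i, `|x 0 i - y 0 i| <= t].

Definition cover_sums A : set (\bar R) :=
  [set v : \bar R | exists a b : nat -> 'rV[R]_d,
    [/\ forall k i, a k 0 i <= b k 0 i,
        A `<=` \bigcup_k box (a k) (b k) &
        v = (\sum_(0 <= k <oo) (\prod_(i < d) (b k 0 i - a k 0 i))%:E)%E]].

Lemma volumeE A : volume A = fine (ereal_inf (cover_sums A)).
Proof. by []. Qed.

Lemma prod_sides_ge0 (a b : 'rV[R]_d) : (forall i, a 0 i <= b 0 i) ->
  0 <= \prod_(i < d) (b 0 i - a 0 i).
Proof. by move=> ab; apply: prodr_ge0 => i _; rewrite subr_ge0. Qed.

Lemma cover_sums_ge0 A : (0 <= ereal_inf (cover_sums A))%E.
Proof.
apply/ereal_infP => _ [a [b [ab _ ->]]]; apply: nneseries_ge0 => k _ _.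
by rewrite lee_fin; apply: prod_sides_ge0.
Qed.

(** A finite cover is completed by boxes reduced to the origin, which have
    volume 0 because the dimension is positive. *)
Lemma cover_sums_seq A (s : seq ('rV[R]_d * 'rV[R]_d)) :
  (forall p, p \in s -> forall i, p.1 0 i <= p.2 0 i) ->
  (forall x, A x -> exists2 p, p \in s & box p.1 p.2 x) ->
  cover_sums A (\sum_(p <- s) \prod_(i < d) (p.2 0 i - p.1 0 i))%:E.
Proof.
move=> sP As; pose q k := nth (0, 0) s k.
have qP k i : (q k).1 0 i <= (q k).2 0 i.
  have [ks|ks] := ltnP k (size s); first by apply/sP/mem_nth.
  by rewrite /q nth_default.
exists (fun k => (q k).1), (fun k => (q k).2); split=> //.
  by move=> x /As[p ps px]; exists (index p s); rewrite // /q nth_index.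
rewrite (nneseries_split 0 (size s)); last first.
  by move=> k _; rewrite lee_fin; apply: prod_sides_ge0.
rewrite add0n eseries0 ?adde0; last first.
  move=> k ks _; rewrite /q nth_default // (bigD1 (Ordinal d_gt0)) //=.
  by rewrite !mxE subrr mul0r.
by rewrite sumEFin (big_nth (0, 0)).
Qed.

Lemma volume_le_seq A (s : seq ('rV[R]_d * 'rV[R]_d)) :
  (forall p, p \in s -> forall i, p.1 0 i <= p.2 0 i) ->
  (forall x, A x -> exists2 p, p \in s & box p.1 p.2 x) ->
  volume A <= \sum_(p <- s) \prod_(i < d) (p.2 0 i - p.1 0 i).
Proof.
move=> sP /(cover_sums_seq sP) /ereal_inf_lbound h.
have := cover_sums_ge0 A; rewrite volumeE.
by case: (ereal_inf _) h => //= r; rewrite ?lee_fin.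
Qed.

Lemma bounded_fin_num A : bounded_coord A ->
  ereal_inf (cover_sums A) \is a fin_num.
Proof.
move=> [C AC]; rewrite ge0_fin_numE ?cover_sums_ge0 //.
pose C' := `|C|; pose p : 'rV[R]_d * 'rV[R]_d := (const_mx (- C'), const_mx C').
apply: le_lt_trans (ltry _).
apply: ereal_inf_lbound; apply: (@cover_sums_seq A [:: p]).
  move=> q; rewrite inE => /eqP -> i; rewrite !mxE; have := normr_ge0 C; rewrite /C'; lra.
move=> x Ax; exists p; rewrite ?inE // => i; rewrite !mxE -ler_norml.
by apply: le_trans (AC _ i Ax) _; exact: ler_norm.
Qed.

Lemma volume_ge0 A : 0 <= volume A.
Proof. by apply: fine_ge0; exact: cover_sums_ge0. Qed.

Lemma bounded_coord_sub A B : A `<=` B -> bounded_coord B -> bounded_coord A.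
Proof. by move=> AB [C BC]; exists C => x i /AB; apply: BC. Qed.

Lemma volume_le A B : A `<=` B -> bounded_coord B -> volume A <= volume B.
Proof.
move=> AB bB; have bA := bounded_coord_sub AB bB.
apply: fine_le; rewrite ?bounded_fin_num //.
apply/ereal_infP => _ [a [b [ab Bab ->]]]; apply: ereal_inf_lbound.
by exists a, b; split=> // x /AB /Bab.
Qed.

(** The volume is only an infimum over countable covers; a nearly optimal
    cover bounds all its finite subcovers. *)
Lemma volume_cover A e : bounded_coord A -> 0 < e ->
  exists a b : nat -> 'rV[R]_d,
    [/\ forall k i, a k 0 i <= b k 0 i, A `<=` \bigcup_k box (a k) (b k) &
        forall n, \sum_(k < n) \prod_(i < d) (b k 0 i - a k 0 i) <= volume A + e].
Proof.
move=> bA e0; have [_ [a [b [ab Aab ->]]] lt] :=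
  lb_ereal_inf_adherent e0 (bounded_fin_num bA).
exists a, b; split=> // n.
rewrite -lee_fin EFinD volumeE fineK ?bounded_fin_num //.
apply: le_trans (ltW lt); rewrite -sumEFin.
have := @nneseries_lim_ge R (fun k => (\prod_(i < d) (b k 0 i - a k 0 i))%:E) xpredT 0 n.
rewrite big_mkord; apply=> k _ _; rewrite lee_fin; exact: prod_sides_ge0.
Qed.

Lemma compact_bounded_coord A : compact A -> bounded_coord A.
Proof.
move=> cA; have /choice[C CP] : forall i, exists C : R, forall x, A x -> `|x 0 i| <= C.
  move=> i; have : compact ((fun x : 'rV[R]_d => x 0 i) @` A).
    by apply: continuous_compact => //; apply: continuous_subspaceT => x; apply: coord_continuous.
  move=> /compact_bounded[M [_ /(_ (M + 1))]]; rewrite ltrDl => /(_ ltr01) h.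
  by exists (M + 1) => x Ax; apply: h; exists x.
exists (\sum_i `|C i|) => x i Ax; apply: le_trans (CP _ _ Ax) _.
rewrite (bigD1 i) //=; apply: le_trans (ler_norm _) _.
by rewrite lerDl sumr_ge0.
Qed.

Lemma open_box (a b : 'rV[R]_d) :
  open [set x : 'rV[R]_d | forall i, a 0 i < x 0 i < b 0 i].
Proof.
rewrite openE => x xab.
have h i : \forall y \near x, a 0 i < (y : 'rV[R]_d) 0 i < b 0 i.
  have [ax xb] := andP (xab i).
  have h : \forall y \near x 0 i, a 0 i < y < b 0 i.
    near=> y; apply/andP; split; near: y; [exact: lt_nbhsr|exact: lt_nbhsl].
  exact: coord_continuous h.
have H := @filter_forall _ _ (fun i (y : 'rV[R]_d) => a 0 i < y 0 i < b 0 i) (nbhs x) _ h.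
exact: H.
Unshelve. all: by end_near. Qed.

(** The sides of a box will be moved outwards by 2h at both ends. *)
Lemma enlarge_sides (l : 'I_d -> R) e : 0 < e ->
  exists2 h, 0 < h & \prod_i (l i + 4 * h) <= \prod_i l i + e.
Proof.
move=> e0.
have : (fun n : nat => \prod_i (l i + 4 * n%:R^-1)) @ \oo --> \prod_i l i.
  apply: cvg_prodr => i _; rewrite -[X in _ --> X]addr0; apply: cvgD; first exact: cvg_cst.
  rewrite -[X in _ --> X](mulr0 4); apply: cvgMl_tmp; exact: cvg_invn.
move=> /cvgrPdist_le/(_ e e0) => -[N _ Nh].
exists N.+1%:R^-1; first by rewrite invr_gt0.
have := Nh N.+1 (leqnSn N); rewrite /= distrC => /(le_trans (ler_norm _)).
by rewrite lerBlDr addrC.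
Qed.

(** Moving the sides of a nearly optimal countable cover outwards by h gives
    open boxes, finitely many of which cover the compact set. Moving them by h
    once more makes these cover a uniform neighbourhood. The increase for box
    k is at most a fixed part of e times 2^-k. *)
Lemma volume_outer A e : compact A -> 0 < e ->
  exists t (s : seq ('rV[R]_d * 'rV[R]_d)),
    [/\ 0 < t, forall p, p \in s -> forall i, p.1 0 i <= p.2 0 i,
        forall x, fatten t A x -> exists2 p, p \in s & box p.1 p.2 x &
        \sum_(p <- s) \prod_(i < d) (p.2 0 i - p.1 0 i) <= volume A + e].
Proof.
move=> cA e0; have e20 : 0 < e / 2 by lra.
have [a [b [ab Aab sumab]]] := volume_cover (compact_bounded_coord cA) e20.
have /choice[h hP] : forall k, exists h : R, 0 < h /\
    \prod_i (b k 0 i - a k 0 i + 4 * h) <= \prod_i (b k 0 i - a k 0 i) + e / 2 / 2 ^+ k.+1.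
  move=> k; have [h h0 hP] := enlarge_sides (fun i => b k 0 i - a k 0 i)
    (divr_gt0 e20 (exprn_gt0 k.+1 (ltr0n R 2))).
  by exists h.
pose U k := [set x : 'rV[R]_d | forall i,
  (a k - const_mx (h k)) 0 i < x 0 i < (b k + const_mx (h k)) 0 i].
have : cover_compact A by rewrite -compact_cover.
move=> /(_ nat setT U)[k _|x Ax|D _ AD]; first exact: open_box.
  have [k _ kx] := Aab _ Ax; exists k => // i; rewrite !mxE.
  by have /andP[] := kx i; have := (hP k).1; lra.
(* Taking all boxes up to the largest index needed keeps the sum a partial sum
   of the series. *)
pose n := (\max_(k <- finmap.enum_fset D) k.+1)%N.
have Dn k : k \in finmap.enum_fset D -> (k < n)%N.
  by move=> kD; rewrite /n (big_rem k) //= leq_maxl.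
have [t t0 th] : exists2 t, 0 < t & forall k, (k < n)%N -> t <= h k.
  elim: n {Dn} => [|n [t t0 th]]; first by exists 1.
  exists (Num.min t (h n)); first by rewrite lt_min t0 (hP n).1.
  move=> k; rewrite ltnS leq_eqVlt => /orP[/eqP ->|/th]; first by rewrite ge_min lexx orbT.
  by move=> tk; rewrite ge_min tk.
pose q k := (a k - const_mx (2 * h k), b k + const_mx (2 * h k)).
exists t, [seq q k | k <- index_iota 0 n]; split=> //.
- move=> _ /mapP[k _ ->] i; rewrite !mxE; have := ab k i; have := (hP k).1; lra.
- move=> x [y /AD[k kD ky] xy]; have kn := Dn _ kD.
  exists (q k); first by apply: map_f; rewrite mem_index_iota.
  move=> i; rewrite !mxE; have := ky i; rewrite !mxE => /andP[h1 h2].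
  have := xy i; rewrite ler_norml => /andP[h3 h4]; have := th k kn.
  by move=> h5; apply/andP; split; lra.
- rewrite big_map big_mkord.
  apply: (@le_trans _ _ (\sum_(k < n) (\prod_i (b k 0 i - a k 0 i) + e / 2 / 2 ^+ k.+1))).
    apply: ler_sum => k _; apply: le_trans (hP k).2.
    rewrite le_eqVlt; apply/orP; left; apply/eqP; apply: eq_bigr => i _.
    by rewrite !mxE; ring.
  rewrite big_split /=; apply: (@le_trans _ _ (volume A + e / 2 + e / 2)); last lra.
  apply: lerD; first exact: sumab.
  rewrite -mulr_sumr ler_piMr //; first exact: ltW.
  suff : \sum_(k < n) (2 ^+ k.+1)^-1 <= 1 - (2 ^+ n)^-1 :> R.
    by move=> /le_trans; apply; rewrite gerBl invr_ge0 exprn_ge0.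
  elim: n {Dn th} => [|n IH]; first by rewrite big_ord0 expr0 invr1 subrr.
  rewrite big_ord_recr /= exprS invfM; move: (2 ^+ n)^-1 IH => z; lra.
Qed.
End Volume.

(** * Lattice cubes *)

Section LatticeAndVolume.
Variables (R : realType) (d : nat).
Hypothesis d_gt0 : (0 < d)%N.
Implicit Types (A B : set 'rV[R]_d) (x y : 'rV[R]_d) (t : R) (z : 'rV[int]_d).

Definition ztor (z : 'rV[int]_d) : 'rV[R]_d := map_mx intr z.

Definition cube z : set 'rV[R]_d := box (ztor z) (ztor z + const_mx 1).

Lemma cnt_int_itv (a b : R) : a <= b ->
  finite_set [set y : int | a <= y%:~R <= b] /\
  (cnt [set y : int | a <= y%:~R <= b])%:R <= b - a + 1.
Proof.
move=> ab; pose S := [set y : int | a <= y%:~R <= b].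
pose N : nat := absz (Num.floor b - Num.ceil a + 1)%R.
have cS : S `<=` [set y | y \in [seq Num.ceil a + k%:Z | k <- iota 0 N]].
  move=> y /= /andP[ay yb].
  have h1 : (Num.ceil a <= y) by rewrite ceil_le_int_tmp.
  have h2 : (y <= Num.floor b) by rewrite floor_ge_int_tmp.
  apply/mapP; exists (absz (y - Num.ceil a)%R); last lia.
  rewrite mem_iota; lia.
have fS : finite_set S by apply: sub_finite_set cS _; apply: finite_seq.
split=> //.
have [m [um mS ->]] := finite_cnt fS.
have [cf|fc] := lerP (Num.ceil a) (Num.floor b); last first.
  case: m mS {um} => [|y m] mS; first by rewrite /=; lra.
  have := (mS y).2; rewrite inE eqxx => /(_ isT) /cS /mapP[k].
  rewrite mem_iota => h1 h2.
  have /andP[ay yb] : S y by apply/mS; rewrite inE eqxx.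
  have h3 : (Num.ceil a <= y) by rewrite ceil_le_int_tmp.
  have h4 : (y <= Num.floor b) by rewrite floor_ge_int_tmp.
  by move: fc; rewrite ltNge (le_trans h3 h4).
have sz : (size m <= N)%N.
  have := @uniq_leq_size _ m [seq Num.ceil a + k%:Z | k <- iota 0 N] um.
  by rewrite size_map size_iota; apply=> y /mS /cS.
apply: (@le_trans _ _ (N%:R : R)); first by rewrite ler_nat.
rewrite -[_%:R]/((_%:Z)%:~R) /N gez0_abs; last lia.
have := ceil_ge a; have := floor_le_tmp b; rewrite intrD intrB; lra.
Qed.

Lemma cnt_lattice_box (a b : 'rV[R]_d) : (forall i, a 0 i <= b 0 i) ->
  finite_set [set z | box a b (ztor z)] /\
  (cnt [set z | box a b (ztor z)])%:R <= \prod_(i < d) (b 0 i - a 0 i + 1).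
Proof.
move=> ab; pose P i := [set y : int | a 0 i <= y%:~R <= b 0 i].
have fP i : finite_set (P i) by exact: (cnt_int_itv (ab i)).1.
have [fX cX] := cnt_ffun fP.
pose g (x : {ffun 'I_d -> int}) : 'rV[int]_d := \row_i x i.
have SE : [set z | box a b (ztor z)] = g @` [set x : {ffun 'I_d -> int} | forall i, P i (x i)].
  apply/seteqP; split=> [z zab|_ [x xP <-] i]; last by rewrite !mxE; apply: xP.
  exists [ffun i => z 0 i]; first by move=> i; rewrite ffunE /P /=; have := zab i; rewrite mxE.
  by apply/rowP => i; rewrite !mxE ffunE.
rewrite SE; split; first exact: finite_image.
rewrite cnt_image //; last first.
  by move=> x y _ _ /rowP xy; apply/ffunP => i; have := xy i; rewrite !mxE.
rewrite cX natr_prod; apply: ler_prod => i _; rewrite ler0n /=.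
exact: (cnt_int_itv (ab i)).2.
Qed.

Lemma finite_lattice A : bounded_coord A -> finite_set [set z | A (ztor z)].
Proof.
move=> [C AC].
apply: sub_finite_set (cnt_lattice_box (a := const_mx (- `|C|)) (b := const_mx `|C|) _).1.
  move=> z /AC zC i; rewrite ![const_mx _ _ _]mxE -ler_norml.
  by apply: le_trans (zC i) _; exact: ler_norm.
by move=> i; rewrite !mxE; have := normr_ge0 C; lra.
Qed.

Definition meets A z := cube z `&` A !=set0.

Lemma floor_cube x : cube (\row_i Num.floor (x 0 i)) x.
Proof.
move=> i; rewrite !mxE; have /andP[h1 h2] := floor_itv (x 0 i).
by rewrite h1 /= ltW // -[1]/(1%:~R) -intrD.
Qed.

Lemma finite_meets A : bounded_coord A -> finite_set [set z | meets A z].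
Proof.
move=> [C AC].
apply: sub_finite_set (finite_lattice (A := fatten 1 A) _).
  move=> z [x [xz Ax]]; exists x => // i; have := xz i; rewrite !mxE ler_norml; lra.
exists (`|C| + 1) => x i [y Ay] /(_ i); have := AC y i Ay; rewrite !ler_norml; have := ler_norm C; lra.
Qed.

Lemma volume_le_cubes A : bounded_coord A -> volume A <= (cnt [set z | meets A z])%:R.
Proof.
move=> bA; have [s [us sP ->]] := finite_cnt (finite_meets bA).
pose q z := (ztor z, ztor z + const_mx 1).
apply: (@le_trans _ _ (\sum_(p <- map q s) \prod_(i < d) (p.2 0 i - p.1 0 i))).
  apply: volume_le_seq => //.
    by move=> _ /mapP[z _ ->] i; rewrite !mxE; lra.
  move=> x Ax; pose z : 'rV[int]_d := \row_i Num.floor (x 0 i).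
  exists (q z); last exact: floor_cube.
  by apply/map_f/sP; exists x; split=> //; exact: floor_cube.
rewrite big_map (eq_bigr (fun=> 1)).
  by rewrite big_const_seq count_predT iter_addr_0.
by move=> z _; apply: big1 => i _; rewrite !mxE; ring.
Qed.

(** A cover by boxes is compared with the cubes by counting points of the
    lattice refined M times: a cube contains M^d of them without overlap, and
    a box with sides l_i at most the product of the M l_i + 1. Dividing by M^d
    and letting M grow gives the inequality. *)
Lemma cubes_le_volume A (S : set 'rV[int]_d) : compact A ->
  (forall z, S z -> cube z `<=` A) -> (cnt S)%:R <= volume A.
Proof.
move=> cA SA; have bA := compact_bounded_coord cA.
have fS : finite_set S.
  apply: sub_finite_set (finite_meets bA) => z Sz; exists (ztor z).
  have zz : cube z (ztor z) by move=> i; rewrite !mxE; lra.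
  by split=> //; apply: SA zz.
apply/ler_addgt0Pr => e e0.
have [t [s [t0 sP As sumA]]] := volume_outer d_gt0 cA e0.
apply: le_trans sumA.
pose L (M : nat) : R := \sum_(p <- s) \prod_(i < d) (p.2 0 i - p.1 0 i + 1 * M%:R^-1).
have LP M : (0 < M)%N -> (cnt S)%:R <= L M.
  move=> M0; have Mp : 0 < M%:R :> R by rewrite ltr0n.
  have [m [um mS ->]] := finite_cnt fS.
  (* The points z + w / M, scaled by M, for w in the discrete cube of side M. *)
  pose f z (w : {ffun 'I_d -> 'I_M}) : 'rV[int]_d := \row_i (z 0 i * M%:Z + (w i)%:Z).
  pose T := [seq f z w | z <- m, w <- enum {ffun 'I_d -> 'I_M}].
  have szT : size T = (size m * M ^ d)%N.
    by rewrite size_allpairs -cardE card_ffun !card_ord.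
  have uT : uniq T.
    apply: allpairs_uniq => //; first exact: enum_uniq.
    move=> [z w] [z' w'] _ _ /= /rowP zw.
    have e1 i : z 0 i = z' 0 i /\ w i = w' i.
      have := zw i; rewrite !mxE => e2; have := ltn_ord (w i); have := ltn_ord (w' i).
      move=> h1 h2.
      have e3 : z 0 i = z' 0 i.
        have := congr1 (fun k : int => (k %/ M%:Z)%Z) e2.
        by rewrite !divzMDl ?divz_small ?addr0 //; lia.
      by split=> //; apply: val_inj; move: e2; rewrite e3 => /addrI [].
    by congr pair; [apply/rowP => i; case: (e1 i)|apply/ffunP => i; case: (e1 i)].
  have cT : cnt [set y | y \in T] = size T by apply: cnt_seq.
  pose B k := [set z | box (M%:R *: (nth (0, 0) s k).1) (M%:R *: (nth (0, 0) s k).2) (ztor z)].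
  have le1 k i : (k < size s)%N ->
      (M%:R *: (nth (0, 0) s k).1) 0 i <= (M%:R *: (nth (0, 0) s k).2) 0 i.
    by move=> ks; rewrite !mxE ler_pM2l //; apply/sP/mem_nth.
  have : (cnt [set y | y \in T] <= \sum_(k < size s) cnt (B k))%N.
    apply: cnt_bigcup_le.
      by move=> k ks; apply: (cnt_lattice_box _).1 => i; apply: le1.
    move=> _ /= /allpairsP[[z w] [/= zm _ ->]].
    pose x : 'rV[R]_d := M%:R^-1 *: ztor (f z w).
    have zx : cube z x.
      move=> i; rewrite !mxE intrD intrM !pmulrn mulrDr mulrCA mulVf ?gt_eqF // mulr1.
      have h1 : (0 <= (w i)%:R :> R) by []. 
      have h2 : ((w i)%:R < M%:R :> R) by rewrite ltr_nat.
      rewrite lerDl lerD2l mulr_ge0 ?invr_ge0 ?ler0n //= mulrC ler_pdivrMr // mul1r.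
      exact: ltW.
    have [|p ps px] := As x.
      by exists x; [apply: SA zx; apply/mS|move=> i; rewrite subrr normr0 ltW].
    exists (index p s); first by rewrite index_mem.
    rewrite /B nth_index //= => i; have := px i; rewrite /x !mxE.
    by rewrite mulrC ler_pdivlMr // ler_pdivrMr // ![_ * M%:R]mulrC.
  rewrite cT szT => h.
  rewrite -(ler_pM2r (x := M%:R ^+ d)) ?exprn_gt0 // -natrX -natrM.
  apply: (@le_trans _ _ (\sum_(k < size s) cnt (B k))%N%:R); first by rewrite ler_nat.
  rewrite natr_sum /L (big_nth (0, 0)) big_mkord mulr_suml; apply: ler_sum => k _.
  apply: le_trans (cnt_lattice_box (fun i => le1 k i (ltn_ord k))).2 _.
  have -> : (M ^ d)%:R = \prod_(i < d) M%:R :> R by rewrite prodr_const card_ord natrX.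
  rewrite -big_split /=.
  apply: ler_prod => i _; rewrite !mxE; apply/andP; split.
    by rewrite addr_ge0 // -mulrBr mulr_ge0 // subr_ge0; apply/sP/mem_nth.
  rewrite mul1r le_eqVlt; apply/orP; left; apply/eqP; field; rewrite gt_eqF //.
have : L @ \oo --> \sum_(p <- s) \prod_(i < d) (p.2 0 i - p.1 0 i).
  apply: cvg_sumr => p _; apply: cvg_prodr => i _.
  rewrite -[X in _ --> X]addr0; apply: cvgD; first exact: cvg_cst.
  rewrite -[X in _ --> X](mulr0 1); apply: cvgMl_tmp; exact: cvg_invn.
move=> /cvgr_to_ge; apply; exists 1%N => // M; exact: LP.
Qed.
End LatticeAndVolume.

(** * Volume of homothetic images *)

Section VolumeAffine.
Variables (R : realType) (d : nat).
Hypothesis d_gt0 : (0 < d)%N.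
Implicit Types (A B : set 'rV[R]_d) (v x y : 'rV[R]_d) (t : R).

Definition affine t v A : set 'rV[R]_d := (fun x => t *: x + v) @` A.

Lemma bounded_affine t v A : bounded_coord A -> bounded_coord (affine t v A).
Proof.
move=> [C AC]; exists (`|t| * C + \sum_i `|v 0 i|) => _ i [x Ax <-].
rewrite !mxE; apply: le_trans (ler_normD _ _) _; apply: lerD.
  by rewrite normrM ler_wpM2l //; exact: AC.
by rewrite (bigD1 i) //= lerDl sumr_ge0.
Qed.

(** The image of a cover by boxes is a cover by boxes. *)
Lemma volume_affine_le t v A : 0 < t -> bounded_coord A ->
  volume (affine t v A) <= t ^+ d * volume A.
Proof.
move=> t0 bA; have td : 0 < t ^+ d by rewrite exprn_gt0.
apply/ler_addgt0Pr => e e0.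
have e'0 : 0 < e / t ^+ d by rewrite divr_gt0.
have [w [a [b [ab Aab wE]]] lt] := lb_ereal_inf_adherent e'0 (bounded_fin_num d_gt0 bA).
have w0 : (0 <= w)%E.
  by rewrite wE; apply: nneseries_ge0 => k _ _; rewrite lee_fin; apply: prod_sides_ge0.
have wfin : w \is a fin_num.
  rewrite ge0_fin_numE //; apply: lt_trans lt _.
  by rewrite -[ereal_inf _]fineK ?bounded_fin_num // -EFinD ltry.
have cw : cover_sums (affine t v A) ((t ^+ d)%:E * w)%E.
  exists (fun k => t *: a k + v), (fun k => t *: b k + v); split.
  - by move=> k i; rewrite !mxE lerD2r ler_pM2l.
  - move=> _ [x /Aab[k _ kx] <-]; exists k => // i; have := kx i.
    by rewrite !mxE !lerD2r !ler_pM2l.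
  - rewrite wE -nneseriesZl; last first.
      by move=> k _; rewrite lee_fin; apply: prod_sides_ge0.
    apply: eq_eseriesr => k _; rewrite -EFinM; congr EFin.
    have -> : t ^+ d = \prod_(i < d) t by rewrite prodr_const card_ord.
    by rewrite -big_split /=; apply: eq_bigr => i _; rewrite !mxE; ring.
have : (ereal_inf (cover_sums (affine t v A)) <= (t ^+ d)%:E * w)%E.
  exact: ereal_inf_lbound.
move: lt; rewrite !volumeE.
rewrite -[X in (_ < X + _)%E](fineK (bounded_fin_num d_gt0 bA)).
rewrite -[X in (X <= _)%E](fineK (bounded_fin_num d_gt0 (bounded_affine t v bA))).
rewrite -(fineK wfin) -EFinD -EFinM lte_fin lee_fin => h1 h2.
apply: le_trans h2 _; rewrite -lerBlDl -mulrBr mulrC -ler_pdivlMr //; lra.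
Qed.

Lemma volume_affine t v A : 0 < t -> bounded_coord A ->
  volume (affine t v A) = t ^+ d * volume A.
Proof.
move=> t0 bA; apply/eqP; rewrite eq_le volume_affine_le //=.
rewrite mulrC -ler_pdivlMr ?exprn_gt0 // mulrC -exprVn.
have ti : 0 < t^-1 by rewrite invr_gt0.
have := volume_affine_le (- (t^-1 *: v)) ti (bounded_affine t v bA).
congr (volume _ <= _); apply/seteqP; split=> [_ [_ [x Ax <-] <-]|x Ax].
  by rewrite scalerDr scalerA mulVf ?gt_eqF // scale1r addrK.
exists (t *: x + v); first by exists x.
by rewrite scalerDr scalerA mulVf ?gt_eqF // scale1r addrK.
Qed.

(** Continuity of the volume from outside, on compact sets. *)
Lemma volume_fatten A e : compact A -> 0 < e ->
  exists2 t, 0 < t & volume (fatten t A) <= volume A + e.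
Proof.
move=> cA e0; have [t [s [t0 sP As sumA]]] := volume_outer d_gt0 cA e0.
by exists t => //; apply: le_trans sumA; apply: volume_le_seq.
Qed.
End VolumeAffine.

(** * Convex sets, simplices and hulls of finite families *)

Section ConvexSets.
Variables (R : realType) (d : nat).
Implicit Types (A B X Y : set 'rV[R]_d) (v x y : 'rV[R]_d) (s t : R).

Definition dil t A : set 'rV[R]_d := (fun x => t *: x) @` A.

Definition cvx A := forall x y t, A x -> A y -> 0 <= t <= 1 ->
  A (t *: x + (1 - t) *: y).

Lemma convex_setP A : convex_set A <-> cvx A.
Proof.
split=> [cA x y t Ax Ay t01|cA x y l]; last first.
  rewrite !inE => Ax Ay; apply: cA => //; apply/andP; split=> //.
have := cA x y (Itv01 (andP t01).1 (andP t01).2).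
by rewrite !inE; apply.
Qed.

(** Convexity gives the inclusion from left to right, since s x + t y is s + t
    times a convex combination of x and y. *)
Lemma dil_sadd_cvx A s t : cvx A -> 0 <= s -> 0 <= t ->
  sadd (dil s A) (dil t A) = dil (s + t) A.
Proof.
move=> cA s0 t0; apply/seteqP; split; last first.
  by move=> _ [x Ax <-]; exists (s *: x); [exists x|exists (t *: x); [exists x|rewrite scalerDl]].
move=> _ [_ [x Ax <-] [_ [y Ay <-] <-]].
have [st0|st0] := eqVneq (s + t) 0.
  have [-> ->] : s = 0 /\ t = 0 by split; lra.
  by exists x => //; rewrite addr0 !scale0r addr0.
exists ((s / (s + t)) *: x + (1 - s / (s + t)) *: y).
  apply: cA => //; have stp : 0 < s + t by rewrite lt0r st0 addr_ge0.
  by rewrite divr_ge0 ?addr_ge0 //= ler_pdivrMr // mul1r lerDl.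
rewrite scalerDr !scalerA; congr (_ *: _ + _ *: _); field; exact: st0.
Qed.

Lemma cvx_sadd A B : cvx A -> cvx B -> cvx (sadd A B).
Proof.
move=> cA cB _ _ t [x Ax [y By <-]] [x' Ax' [y' By' <-]] t01.
exists (t *: x + (1 - t) *: x'); first exact: cA.
exists (t *: y + (1 - t) *: y'); first exact: cB.
by rewrite !scalerDr addrACA.
Qed.

Lemma cvx_dil A t : cvx A -> cvx (dil t A).
Proof.
move=> cA _ _ u [x Ax <-] [y Ay <-] u01.
exists (u *: x + (1 - u) *: y); first exact: cA.
by rewrite scalerDr !scalerA ![t * _]mulrC.
Qed.

Lemma dil_sadd t A B : dil t (sadd A B) = sadd (dil t A) (dil t B).
Proof. by apply: image_sadd => x y; rewrite scalerDr. Qed.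

Lemma dil_dil s t A : dil s (dil t A) = dil (s * t) A.
Proof.
apply/seteqP; split=> [_ [_ [x Ax <-] <-]|_ [x Ax <-]].
  by exists x => //; rewrite scalerA.
by exists (t *: x); [exists x|rewrite scalerA].
Qed.

Lemma dil1 A : dil 1 A = A.
Proof.
by apply/seteqP; split=> [_ [x Ax <-]|x Ax]; [rewrite scale1r|exists x; rewrite ?scale1r].
Qed.

Lemma dil0 A : A !=set0 -> dil 0 A = [set 0].
Proof.
move=> [x Ax]; apply/seteqP; split=> [_ [y _ <-]|_ ->]; first by rewrite scale0r.
by exists x; rewrite ?scale0r.
Qed.

Lemma compact_sadd A B : compact A -> compact B -> compact (sadd A B).
Proof.
move=> cA cB.
have -> : sadd A B = (fun p : 'rV[R]_d * 'rV[R]_d => p.1 + p.2) @` (A `*` B).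
  apply/seteqP; split=> [_ [x Ax [y By <-]]|_ [[x y] [/= Ax By] <-]]; last by exists x => //; exists y.
  by exists (x, y).
apply: continuous_compact; last exact: compact_setX.
by apply: continuous_subspaceT; exact: add_continuous.
Qed.

Lemma compact_dil t A : compact A -> compact (dil t A).
Proof.
move=> cA; apply: continuous_compact => //; apply: continuous_subspaceT.
exact: scaler_continuous.
Qed.

Lemma bounded_sadd A B : bounded_coord A -> bounded_coord B -> bounded_coord (sadd A B).
Proof.
move=> [C AC] [D BD]; exists (C + D) => _ i [x Ax [y By <-]].
by rewrite mxE; apply: le_trans (ler_normD _ _) _; apply: lerD; [exact: AC|exact: BD].
Qed.

Lemma bounded_fatten t A : bounded_coord A -> bounded_coord (fatten t A).
Proof.
move=> [C AC]; exists (t + C) => x i [y Ay /(_ i)].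
have := AC y i Ay; rewrite !ler_norml => h1 h2; apply/andP; split; lra.
Qed.

Definition simplex t : set 'rV[R]_d :=
  [set x | (forall i, 0 <= x 0 i) /\ \sum_i x 0 i <= t].

Lemma simplex_le s t : s <= t -> simplex s `<=` simplex t.
Proof. by move=> st x [x0 xs]; split=> //; apply: le_trans st. Qed.

Lemma dil_simplex s t : 0 < s -> dil s (simplex t) = simplex (s * t).
Proof.
move=> s0; apply/seteqP; split=> [_ [x [x0 xt] <-]|x [x0 xt]].
  split=> [i|]; first by rewrite mxE mulr_ge0 // ltW.
  by under eq_bigr do rewrite mxE; rewrite -mulr_sumr ler_pM2l.
exists (s^-1 *: x); last by rewrite scalerA mulfV ?gt_eqF // scale1r.
split=> [i|]; first by rewrite mxE mulr_ge0 // invr_ge0 ltW.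
under eq_bigr do rewrite mxE.
by rewrite -mulr_sumr mulrC ler_pdivrMr // mulrC.
Qed.

Lemma simplexD s t : 0 <= s -> 0 <= t ->
  sadd (simplex s) (simplex t) = simplex (s + t).
Proof.
move=> s0 t0; apply/seteqP; split.
  move=> _ [x [x0 xs] [y [y0 yt] <-]]; split=> [i|]; first by rewrite mxE addr_ge0.
  by under eq_bigr do rewrite mxE; rewrite big_split lerD.
move=> x [x0 xst]; have [st0|st0] := eqVneq (s + t) 0.
  have [s00 t00] : s = 0 /\ t = 0 by split; lra.
  exists 0; first by split=> [i|]; rewrite ?mxE // big1 // => i _; rewrite mxE.
  by exists x; rewrite ?add0r //; split=> //; apply: le_trans xst _; rewrite s00 add0r.
have stp : 0 < s + t by rewrite lt0r st0 addr_ge0.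
have h u : 0 <= u -> simplex u ((u / (s + t)) *: x).
  move=> u0; split=> [i|]; first by rewrite mxE mulr_ge0 // divr_ge0 // ltW.
  under eq_bigr do rewrite mxE.
  rewrite -mulr_sumr mulrAC ler_pdivrMr // ler_wpM2l //.
exists ((s / (s + t)) *: x); first exact: h.
exists ((t / (s + t)) *: x); first exact: h.
by rewrite -scalerDl -mulrDl mulfV // scale1r.
Qed.

Lemma cvx_simplex t : cvx (simplex t).
Proof.
move=> x y u [x0 xt] [y0 yt] /andP[u0 u1]; have u1' : 0 <= 1 - u by lra.
split=> [i|]; first by rewrite !mxE addr_ge0 // mulr_ge0.
under eq_bigr do rewrite !mxE.
rewrite big_split /= -!mulr_sumr.
apply: (@le_trans _ _ (u * t + (1 - u) * t)); last by lra.
by apply: lerD; apply: ler_wpM2l.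
Qed.

Lemma continuous_sumf (T : topologicalType) (V : normedModType R) (I : Type)
    (r : seq I) (f : I -> T -> V) :
  (forall i, continuous (f i)) -> continuous (fun w => \sum_(i <- r) f i w).
Proof.
move=> cf; elim: r => [|i r IH] x.
  by under eq_fun do rewrite big_nil; exact: cst_continuous.
under eq_fun do rewrite big_cons.
by apply: continuousD; [exact: cf|exact: IH].
Qed.

Lemma closed_half n (f : 'rV[R]_n -> R) (D : set R) :
  continuous f -> closed D -> closed [set x | D (f x)].
Proof. by move=> cf cD; apply: preimage_closed => // x _; exact: cf. Qed.

Lemma compact_simplex t : compact (simplex t).
Proof.
apply: (@subclosed_compact _ _ [set v : 'rV[R]_d | forall i, (`[0, t]%classic : set R) (v ord0 i)]).
- have -> : simplex t = (\bigcap_(i in setT) [set x : 'rV[R]_d | [set y : R | 0 <= y] (x 0 i)]) `&`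
      [set x | [set y : R | y <= t] (\sum_i x 0 i)].
    by apply/seteqP; split=> [x [x0 xt]|x [x0 xt]]; split=> // i; [move=> _; exact: x0|exact: (x0 i)].
  apply: closedI.
    apply: closed_bigI => i _; apply: closed_half; last exact: closed_ge.
    exact: coord_continuous.
  by apply: closed_half; [by apply: continuous_sumf => i; exact: coord_continuous|exact: closed_le].
- by apply: (@rV_compact R d (fun=> `[0, t]%classic)) => i; exact: segment_compact.
- move=> x [x0 xt] i; rewrite /= in_itv /= x0; apply: le_trans xt.
  by rewrite (bigD1 i) //= lerDl sumr_ge0.
Qed.

(** The weights form a row vector, which makes the hull a continuous image of
    a compact subset of a matrix space. *)
Definition hull k (A : 'I_k.+1 -> 'rV[R]_d) : set 'rV[R]_d :=
  [set x | exists2 l : 'rV[R]_k.+1,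
     (forall a, 0 <= l 0 a) /\ \sum_a l 0 a = 1 & x = \sum_a l 0 a *: A a].

Lemma hull_vertex k (A : 'I_k.+1 -> 'rV[R]_d) a : hull A (A a).
Proof.
exists (delta_mx 0 a); first split.
- by move=> b; rewrite mxE; case: (_ && _).
- rewrite (bigD1 a) //= mxE !eqxx big1 ?addr0 // => b ba.
  by rewrite mxE (negPf ba) andbF.
- rewrite (bigD1 a) //= mxE !eqxx scale1r big1 ?addr0 // => b ba.
  by rewrite mxE (negPf ba) andbF scale0r.
Qed.

Lemma cvx_hull k (A : 'I_k.+1 -> 'rV[R]_d) : cvx (hull A).
Proof.
move=> _ _ t [l [l0 l1] ->] [m [m0 m1] ->] /andP[t0 t1].
have t1' : 0 <= 1 - t by lra.
exists (t *: l + (1 - t) *: m); first split.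
- by move=> a; rewrite !mxE addr_ge0 // mulr_ge0.
- under eq_bigr do rewrite !mxE.
  by rewrite big_split /= -!mulr_sumr l1 m1; ring.
- rewrite !scaler_sumr -big_split; apply: eq_bigr => a _ /=.
  by rewrite !mxE !scalerA -scalerDl.
Qed.

Lemma compact_hull k (A : 'I_k.+1 -> 'rV[R]_d) : compact (hull A).
Proof.
pose S : set 'rV[R]_k.+1 := (\bigcap_(a in setT) [set l : 'rV[R]_k.+1 | [set y : R | 0 <= y] (l 0 a)]) `&`
      [set l | [set y : R | y = 1] (\sum_a l 0 a)].
have -> : hull A = (fun l => \sum_a l 0 a *: A a) @` S.
  apply/seteqP; split=> [_ [l [l0 l1] ->]|_ [l [l0 l1] <-]]; exists l => //; split=> // a; [move=> _; exact: l0|exact: (l0 a)].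
apply: continuous_compact.
  apply: continuous_subspaceT; apply: continuous_sumf => a l.
  have h := @coord_continuous R 1 k.+1 0 a l; exact: cvgZr_tmp h.
apply: (@subclosed_compact _ _ [set v : 'rV[R]_k.+1 | forall i, (`[0, 1]%classic : set R) (v ord0 i)]).
- apply: closedI.
    apply: closed_bigI => i _; apply: closed_half; last exact: closed_ge.
    exact: coord_continuous.
  by apply: closed_half; [by apply: continuous_sumf => i; exact: coord_continuous|exact: closed_eq].
- by apply: (@rV_compact R k.+1 (fun=> `[0, 1]%classic)) => i; exact: segment_compact.
- move=> l [l0 l1] a; rewrite /= in_itv /= [0 <= _]l0 //= -[X in _ <= X]l1.
  by rewrite (bigD1 a) //= lerDl sumr_ge0 // => b _; apply: l0.
Qed.

(** Induction on the number of points, splitting off the first one and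
    rescaling the remaining weights; if the first weight is 1 the others
    vanish. *)
Lemma hull_min k (A : 'I_k.+1 -> 'rV[R]_d) B : cvx B -> (forall a, B (A a)) ->
  hull A `<=` B.
Proof.
move=> cB; elim: k A => [|k IH] A BA x [l [l0 l1] ->].
  by move: l1; rewrite !big_ord1 => ->; rewrite scale1r.
have [l01|l01] := eqVneq (l 0 ord0) 1.
  have lz a : l 0 (lift ord0 a) = 0.
    apply/eqP; rewrite eq_le l0 andbT.
    move: l1; rewrite big_ord_recl l01 (bigD1 a) //=.
    have : 0 <= \sum_(i < k.+1 | i != a) l 0 (lift ord0 i) by apply: sumr_ge0.
    lra.
  rewrite big_ord_recl big1 ?addr0; last by move=> a _; rewrite lz scale0r.
  by rewrite l01 scale1r.
have l0le : l 0 ord0 <= 1 by rewrite -[X in _ <= X]l1 big_ord_recl lerDl sumr_ge0.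
have l0lt : 0 < 1 - l 0 ord0 by rewrite subr_gt0 lt_neqAle l01.
rewrite big_ord_recl.
have -> : \sum_(i < k.+1) l 0 (lift ord0 i) *: A (lift ord0 i) = (1 - l 0 ord0) *:
    \sum_(i < k.+1) (\row_a (l 0 (lift ord0 a) / (1 - l 0 ord0))) 0 i *: A (lift ord0 i).
  rewrite scaler_sumr; apply: eq_bigr => i _; rewrite mxE scalerA; congr (_ *: _).
  by rewrite mulrC divfK ?gt_eqF.
apply: cB => //; last by rewrite l0 l0le.
apply: (IH (fun a => A (lift ord0 a))) => //.
exists (\row_a (l 0 (lift ord0 a) / (1 - l 0 ord0))) => //; split.
  by move=> a; rewrite mxE divr_ge0 // ltW.
under eq_bigr do rewrite mxE.
rewrite -mulr_suml -[X in X / _](addKr (l 0 ord0)).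
by rewrite -big_ord_recl l1 addrC mulfV ?gt_eqF.
Qed.

Lemma std_simplexE : (@std_simplex R d) = simplex 1.
Proof.
apply/seteqP; split.
  apply: smallest_sub; first exact/convex_setP/cvx_simplex.
  move=> _ [->|[i _ <-]].
    split=> [i|]; first by rewrite mxE.
    by rewrite big1 // => i _; rewrite mxE.
  split=> [j|]; first by rewrite mxE; case: (_ && _).
  rewrite (bigD1 i) //= mxE !eqxx big1 ?addr0 // => j ji.
  by rewrite mxE (negPf ji) andbF.
move=> x [x0 x1] C [/convex_setP cC CS].
pose A (a : 'I_d.+1) : 'rV[R]_d := if unlift ord0 a is Some i then delta_mx 0 i else 0.
apply: (hull_min (A := A) cC).
  by move=> a; apply: CS; rewrite /A; case: unliftP => [i|] _; [right; exists i|left].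
exists (\row_a if unlift ord0 a is Some i then x 0 i else 1 - \sum_i x 0 i).
  split=> [a|]; first by rewrite mxE; case: unliftP => [i|] _; rewrite ?subr_ge0.
  rewrite big_ord_recl mxE unlift_none.
  under [X in _ + X]eq_bigr do rewrite mxE liftK.
  by rewrite subrK.
rewrite big_ord_recl /A unlift_none scaler0 add0r.
under eq_bigr do rewrite mxE liftK.
exact: row_sum_delta.
Qed.
End ConvexSets.

(** * Lattice points of a body plus a simplex *)

Section Sandwich.
Variables (R : realType) (d : nat).
Hypothesis d_gt0 : (0 < d)%N.
Implicit Types (X Y : set 'rV[R]_d) (Z : set 'rV[int]_d).

Definition lsimplex (j : nat) : set 'rV[int]_d :=
  [set z | (forall i, 0 <= z 0 i) /\ \sum_i z 0 i <= j%:Z].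

(** A bound C for the Hausdorff distance of Z and X in the sup norm. *)
Definition near_sets (C : nat) Z X : Prop :=
  (forall z, Z z -> exists2 x, X x & forall i, `|ztor R z 0 i - x 0 i| <= C%:R) /\
  (forall x, X x -> exists2 z, Z z & forall i, `|ztor R z 0 i - x 0 i| <= C%:R).

Lemma near_bounded C Z X : near_sets C Z X -> bounded_coord X -> finite_set Z.
Proof.
move=> [ZX _] bX; apply: sub_finite_set (finite_lattice d_gt0 (bounded_fatten C%:R bX)).
by move=> z /ZX[x Xx zx]; exists x.
Qed.

Lemma finite_lsimplex j : finite_set (lsimplex j).
Proof.
apply: sub_finite_set (finite_lattice d_gt0 (R := R) (A := simplex j%:R) _).
  move=> z [z0 zj]; split=> [i|]; first by rewrite mxE ler0z.
  under eq_bigr do rewrite mxE.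
  by rewrite -rmorph_sum /= -[j%:R]/((j%:Z)%:~R) ler_int.
by apply: compact_bounded_coord; exact: compact_simplex.
Qed.

Lemma simplex_sadd_bounded t X : bounded_coord X -> bounded_coord (sadd (simplex t) X).
Proof.
move=> bX; apply: bounded_sadd => //; apply: compact_bounded_coord; exact: compact_simplex.
Qed.

(** After a shift by C in all directions, the unit cube at a lattice point u +
    z is contained in the body plus a simplex: if x is the point of X near z,
    the coordinates of q - x for q in the cube lie between u_i and u_i + 2C +
    1. *)
Lemma cnt_le_volume C Z X j : near_sets C Z X -> compact X ->
  (cnt (sadd (lsimplex j) Z))%:R <= volume (sadd (simplex (j%:R + ((2 * C + 1) * d)%N%:R)) X).
Proof.
move=> nZX cX; pose one : 'rV[int]_d := const_mx C%:Z.
pose W := (fun z => z + one) @` (sadd (lsimplex j) Z).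
have -> : cnt (sadd (lsimplex j) Z) = cnt W.
  rewrite cnt_image //; last by move=> x y _ _ /addIr.
  apply: finite_sadd; first exact: finite_lsimplex.
  exact: near_bounded nZX (compact_bounded_coord cX).
apply: cubes_le_volume => //.
  by apply: compact_sadd => //; exact: compact_simplex.
move=> _ [_ [u [u0 uj] [z /nZX.1[x Xx zx] <-]] <-] q qc.
exists (q - x); last by exists x; rewrite // subrK.
have qx i : (u 0 i)%:~R <= q 0 i - x 0 i <= (u 0 i)%:~R + (2 * C + 1)%N%:R.
  have := qc i; have := zx i; rewrite !mxE !intrD natrD natrM ler_norml => /andP[h1 h2] /andP[h3 h4].
  rewrite -[(C%:Z)%:~R]/(C%:R) in h3 h4; apply/andP; split; lra.
split=> [i|].
  by rewrite !mxE; apply: le_trans (andP (qx i)).1; rewrite ler0z.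
under eq_bigr do rewrite !mxE.
apply: (@le_trans _ _ (\sum_(i < d) ((u 0 i)%:~R + (2 * C + 1)%N%:R))).
  by apply: ler_sum => i _; case/andP: (qx i).
rewrite big_split /= sumr_const card_ord -mulrnA lerD2r.
by rewrite -rmorph_sum /= -[j%:R]/((j%:Z)%:~R) ler_int.
Qed.

(** The volume is at most the number of cubes meeting the set. After a shift
    by C + 1, the corner of such a cube is the sum of an element y of Z and a
    point with coordinates between 0 and u_i + 2C + 1, where u is the simplex
    part of a point of the cube. *)
Lemma volume_le_cnt C Z X j : near_sets C Z X -> bounded_coord X ->
  volume (sadd (simplex j%:R) X) <= (cnt (sadd (lsimplex (j + (2 * C + 1) * d)) Z))%:R.
Proof.
move=> nZX bX; pose one : 'rV[int]_d := const_mx C.+1%:Z.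
apply: le_trans (volume_le_cubes d_gt0 (simplex_sadd_bounded j%:R bX)) _.
rewrite ler_nat.
apply: (@cnt_inj _ _ _ _ (fun z => z + one)).
- apply: finite_meets => //; exact: simplex_sadd_bounded.
- by apply: finite_sadd; [exact: finite_lsimplex|exact: near_bounded nZX bX].
- by move=> x y _ _ /addIr.
- move=> z [q [qz [u [u0 uj] [x Xx uxq]]]].
  have [y Yy yx] := nZX.2 _ Xx.
  exists (z + one - y); last by exists y; rewrite // subrK.
  have qx i : 0 <= ((z + one - y) 0 i)%:~R :> R /\
     ((z + one - y) 0 i)%:~R <= u 0 i + (2 * C + 1)%N%:R :> R.
    have := qz i; have := yx i; rewrite -uxq !mxE !(intrD, intrB, rmorphN) /=.
    rewrite natrD natrM -[(C.+1%:Z)%:~R]/(C.+1%:R) -natr1 ler_norml.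
    by have := u0 i => h0 /andP[h1 h2] /andP[h3 h4]; split; lra.
  split=> [i|]; first by have [] := qx i; rewrite ler0z.
  rewrite -(ler_int R) rmorph_sum /=.
  apply: (@le_trans _ _ (\sum_(i < d) (u 0 i + (2 * C + 1)%N%:R))).
    by apply: ler_sum => i _; case: (qx i).
  rewrite big_split /= sumr_const card_ord -mulrnA.
  by rewrite -[X in _ <= X]/((j + (2 * C + 1) * d)%:R) natrD lerD2r.
Qed.

(** The set on the left lies in a translate of 1 + t times the set on the
    right. The displacement between X and Y, made nonnegative by adding e in
    all directions, has coordinate sum at most 2de = st and so fits into the
    enlarged simplex; the point y of Y is replaced by a convex combination of
    y and a fixed point y0, which accounts for the translation by t y0. *)
Lemma volume_simplex_fatten s e X Y : 0 < s -> 0 <= e -> Y !=set0 -> cvx Y ->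
  bounded_coord Y -> X `<=` fatten e Y ->
  volume (sadd (simplex s) X) <= (1 + 2 * d%:R * e / s) ^+ d * volume (sadd (simplex s) Y).
Proof.
move=> s0 e0 [y0 Yy0] cY bY XY.
set t := 2 * d%:R * e / s.
have t0 : 0 <= t by rewrite /t divr_ge0 ?(ltW s0) // mulr_ge0 // mulr_ge0.
have t1 : 0 < 1 + t by lra.
rewrite -(@volume_affine _ _ d_gt0 _ (- (t *: y0 + const_mx e))) //; last exact: simplex_sadd_bounded.
apply: volume_le => //; last by apply: bounded_affine; exact: simplex_sadd_bounded.
move=> _ [u [u0 us] [x /XY[y Yy xy] <-]].
pose w : 'rV[R]_d := x - y + const_mx e.
have w0 i : 0 <= w 0 i <= 2 * e.
  have := xy i; rewrite !mxE ler_norml => /andP[h1 h2]; apply/andP; split; lra.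
have yE : (1 + t) *: ((1 + t)^-1 *: y + (1 - (1 + t)^-1) *: y0) = y + t *: y0.
  rewrite scalerDr !scalerA mulfV ?gt_eqF // scale1r; congr (_ + _ *: _).
  by field; rewrite gt_eqF.
have uE : (1 + t) *: ((1 + t)^-1 *: (u + w)) = u + w.
  by rewrite scalerA mulfV ?gt_eqF // scale1r.
exists ((1 + t)^-1 *: (u + w) + ((1 + t)^-1 *: y + (1 - (1 + t)^-1) *: y0)); last first.
  rewrite scalerDr yE uE /w; apply/rowP => i; rewrite !mxE; ring.
exists ((1 + t)^-1 *: (u + w)); last first.
  exists ((1 + t)^-1 *: y + (1 - (1 + t)^-1) *: y0) => //; apply: cY => //.
  by rewrite invr_ge0 ltW //= invf_le1 //; lra.
split=> [i|].
  by rewrite 2!mxE mulr_ge0 ?invr_ge0 ?(ltW t1) // addr_ge0 //; case/andP: (w0 i).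
under eq_bigr do rewrite 2!mxE.
rewrite -mulr_sumr mulrC ler_pdivrMr // big_split /=.
have st : s * (1 + t) = s + 2 * d%:R * e by rewrite /t; field; rewrite gt_eqF.
rewrite st; apply: lerD => //.
apply: (@le_trans _ _ (\sum_(i < d) 2 * e)).
  by apply: ler_sum => i _; case/andP: (w0 i).
by rewrite sumr_const card_ord -mulr_natr; lra.
Qed.
End Sandwich.

(** * Continuity of the volume of a body plus a simplex *)

Section MinkowskiCombinations.
Variables (R : realType) (d : nat).
Hypothesis d_gt0 : (0 < d)%N.
Implicit Types (X Y : set 'rV[R]_d) (s t e : R).

Lemma cvx_body X : convex_body X <-> [/\ X !=set0, compact X & cvx X].
Proof. by split=> -[? ? /convex_setP ?]; split. Qed.

Section Comb.
Variable r : nat.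
Implicit Types (K L : 'I_r -> set 'rV[R]_d) (lam mu : 'I_r -> R).

Lemma minkowski_combE lam K :
  minkowski_comb lam K = \big[@sadd _/[set 0]]_(i < r) dil (lam i) (K i).
Proof.
apply/seteqP; split=> x.
  by move=> [y Ky ->]; apply/big_saddP; exists (fun i => lam i *: y i) => // i; exists (y i).
move=> /big_saddP[y Ky ->].
have /choice[z zP] : forall i, exists z, K i z /\ lam i *: z = y i.
  by move=> i; have [z Kz zy] := Ky i; exists z.
exists z; first by move=> i; case: (zP i).
by apply: eq_bigr => i _; case: (zP i).
Qed.

Lemma minkowski_comb_body lam K : (forall i, convex_body (K i)) ->
  convex_body (minkowski_comb lam K).
Proof.
move=> cK; apply/cvx_body; split.
- have /choice[y yK] : forall i, exists y, K i y by move=> i; case: (cK i).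
  by exists (\sum_i lam i *: y i); exists y.
- rewrite minkowski_combE; elim/big_ind: _ => [|A B|i _]; first exact: compact_set1.
    exact: compact_sadd.
  by apply: compact_dil; case: (cK i).
- rewrite minkowski_combE; elim/big_ind: _ => [|A B|i _].
  + by move=> x y t -> -> _; rewrite !scaler0 addr0.
  + exact: cvx_sadd.
  + by apply: cvx_dil; have /cvx_body[] := cK i.
Qed.

Lemma dil_minkowski_comb t lam K :
  dil t (minkowski_comb lam K) = minkowski_comb (fun i => t * lam i) K.
Proof.
apply/seteqP; split=> [_ [_ [y Ky ->] <-]|_ [y Ky ->]].
  by exists y => //; rewrite scaler_sumr; apply: eq_bigr => i _; rewrite scalerA.
exists (\sum_i lam i *: y i); first by exists y.
by rewrite scaler_sumr; apply: eq_bigr => i _; rewrite scalerA.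
Qed.

Lemma minkowski_comb_fatten (e : 'I_r -> R) lam K L : (forall i, 0 <= lam i) ->
  (forall i, K i `<=` fatten (e i) (L i)) ->
  minkowski_comb lam K `<=` fatten (\sum_i lam i * e i) (minkowski_comb lam L).
Proof.
move=> lam0 KL _ [y Ky ->].
have /choice[z zP] : forall i, exists z, L i z /\ forall j, `|y i 0 j - z 0 j| <= e i.
  by move=> i; have [z Lz yz] := KL i _ (Ky i); exists z.
exists (\sum_i lam i *: z i); first by exists z => // i; case: (zP i).
move=> j; rewrite !summxE -sumrB; apply: le_trans (ler_norm_sum _ _ _) _.
apply: ler_sum => i _; rewrite !mxE -mulrBr normrM ger0_norm // ler_wpM2l //.
by have [_] := zP i.
Qed.

Lemma minkowski_comb_close (C : 'I_r -> R) lam mu K :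
  (forall i x j, K i x -> `|x 0 j| <= C i) ->
  minkowski_comb lam K `<=`
    fatten (\sum_i `|lam i - mu i| * C i) (minkowski_comb mu K).
Proof.
move=> KC _ [y Ky ->]; exists (\sum_i mu i *: y i); first by exists y.
move=> j; rewrite !summxE -sumrB; apply: le_trans (ler_norm_sum _ _ _) _.
apply: ler_sum => i _; rewrite !mxE -mulrBl normrM ler_wpM2l //; exact: KC.
Qed.
End Comb.

(** A point of a simplex of size t has coordinates at most t. *)
Lemma fatten_sadd_simplex e t X Y : X `<=` fatten e Y ->
  sadd (simplex t) X `<=` fatten (t + e) Y.
Proof.
move=> XY _ [u [u0 ut] [x /XY[y Yy xy] <-]]; exists y => // i.
rewrite !mxE -addrA; apply: le_trans (ler_normD _ _) _; apply: lerD => //.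
rewrite ger0_norm //; apply: le_trans ut.
by rewrite (bigD1 i) //= lerDl sumr_ge0.
Qed.

(** The simplex of size t lies in the sum of simplices of sizes s and |t - s|,
    and the second one is treated as part of the distance between X and Y. *)
Lemma volume_simplex_close s t e X Y : 0 < s -> 0 <= t -> 0 <= e ->
  convex_body X -> convex_body Y -> X `<=` fatten e Y ->
  volume (sadd (simplex t) X) <=
    (1 + 2 * d%:R * (`|t - s| + e) / s) ^+ d * volume (sadd (simplex s) Y).
Proof.
move=> s0 t0 e0 /cvx_body[_ kX _] /cvx_body[nY kY cY] XY.
apply: (@le_trans _ _ (volume (sadd (simplex s) (sadd (simplex `|t - s|) X)))).
  apply: volume_le => //; last first.
    by do 2! apply: simplex_sadd_bounded => //; exact: compact_bounded_coord.
  rewrite saddA simplexD // ?(ltW s0) //.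
  move=> _ [u ut [x Xx <-]]; exists u; last by exists x.
  by apply: simplex_le ut; have := ler_norm (t - s); lra.
apply: volume_simplex_fatten => //; first by rewrite addr_ge0.
  exact: compact_bounded_coord.
exact: fatten_sadd_simplex.
Qed.

(** By [volume_simplex_close] in both directions, the quotient of the volumes
    tends to 1. The limit size s must be positive: the simplex makes the
    volumes comparable even if the bodies have empty interior. *)
Lemma cvg_volume (s : R) (t e : nat -> R) X (Y : nat -> set 'rV[R]_d) :
  0 < s -> t @ \oo --> s -> e @ \oo --> (0 : R) -> (forall m, 0 <= e m) ->
  convex_body X -> (forall m, convex_body (Y m)) ->
  (forall m, X `<=` fatten (e m) (Y m)) -> (forall m, Y m `<=` fatten (e m) X) ->
  (fun m => volume (sadd (simplex (t m)) (Y m))) @ \oo --> volume (sadd (simplex s) X).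
Proof.
move=> s0 ts e0 epos bX bY XY YX.
pose k m := `|t m - s| + e m.
have k0 : k @ \oo --> (0 : R).
  rewrite -[X in _ --> X]addr0; apply: cvgD => //.
  rewrite -(normr0 R); apply: cvg_norm; rewrite -(subrr s); apply: cvgB => //; exact: cvg_cst.
have f1 (c : R) : (fun m => (1 + 2 * d%:R * k m / c) ^+ d) @ \oo --> (1 : R).
  rewrite -[X in _ --> X](expr1n _ d); apply: cvg_exprn.
  rewrite -[X in _ --> X]addr0; apply: cvgD; first exact: cvg_cst.
  have -> : 0 = 2 * d%:R * 0 / c :> R by rewrite mulr0 mul0r.
  by apply: cvgMr_tmp; apply: cvgMl_tmp.
set V := volume (sadd (simplex s) X).
apply: (@squeeze_cvgr _ _ _ _ (fun m => V / (1 + 2 * d%:R * k m / (s / 2)) ^+ d)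
  (fun m => (1 + 2 * d%:R * k m / s) ^+ d * V)).
- have tnear : \forall m \near \oo, s / 2 < t m.
    by apply: (cvgr_gt s) => //; lra.
  near=> m; have tm : s / 2 < t m by near: m.
  have tm0 : 0 < t m by lra.
  have km : 0 <= k m by rewrite addr_ge0.
  have dk : 0 <= 2 * d%:R * k m by rewrite mulr_ge0 // mulr_ge0.
  apply/andP; split; last exact: (volume_simplex_close s0 (ltW tm0) (epos m) (bY m) bX (YX m)).
  have s20 : 0 < s / 2 by lra.
  have den : 0 < 1 + 2 * d%:R * k m / (s / 2).
    by rewrite ltr_pwDl // divr_ge0 // ltW.
  rewrite ler_pdivrMr ?exprn_gt0 //.
  have := volume_simplex_close tm0 (ltW s0) (epos m) bX (bY m) (XY m).
  rewrite -/V distrC -/(k m) => /le_trans; apply; rewrite mulrC.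
  apply: ler_wpM2l; first exact: volume_ge0.
  apply: lerXn2r; rewrite ?nnegrE.
  + by rewrite addr_ge0 // divr_ge0 // ltW.
  + exact: ltW.
  + rewrite lerD2l ler_wpM2l // lef_pV2 ?posrE //; exact: ltW.
- rewrite -[X in _ --> X]divr1 ; apply: cvgMl_tmp; apply: cvgV; last exact: f1.
  exact: oner_neq0.
- by rewrite -[X in _ --> X]mul1r; apply: cvgMr_tmp; exact: f1.
Unshelve. all: by end_near. Qed.
End MinkowskiCombinations.

(** * Lattice sets close to convex bodies *)

Lemma posz_sum (I : Type) (s : seq I) (c : I -> nat) :
  \sum_(i <- s) (c i)%:Z = (\sum_(i <- s) c i)%N%:Z.
Proof. by elim/big_rec2: _ => // i x y _ ->; rewrite PoszD. Qed.

Section NearSets.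
Variables (R : realType) (d : nat).
Hypothesis d_gt0 : (0 < d)%N.
Implicit Types (X Y : set 'rV[R]_d) (Z : set 'rV[int]_d).

Lemma ztorD (z w : 'rV[int]_d) : ztor R (z + w) = ztor R z + ztor R w.
Proof. by rewrite /ztor map_mxD. Qed.

Lemma ztor0 : ztor R (0 : 'rV[int]_d) = 0.
Proof. by rewrite /ztor map_mx0. Qed.

Lemma ztor_sum (I : Type) (s : seq I) (P : pred I) (f : I -> 'rV[int]_d) :
  ztor R (\sum_(i <- s | P i) f i) = \sum_(i <- s | P i) ztor R (f i).
Proof. by elim/big_rec2: _ => [|i x y _ <-]; [exact: ztor0|exact: ztorD]. Qed.

Lemma ztorMn (z : 'rV[int]_d) n : ztor R (z *+ n) = n%:R *: ztor R z.
Proof. by rewrite scaler_nat; elim: n => [|n IH]; [exact: ztor0|rewrite !mulrS ztorD IH]. Qed.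

Lemma near_big r (C : 'I_r -> nat) (Z : 'I_r -> set 'rV[int]_d) (X : 'I_r -> set 'rV[R]_d) :
  (forall i, near_sets (C i) (Z i) (X i)) ->
  near_sets (\sum_i C i)%N (\big[@sadd _/[set 0]]_(i < r) Z i) (\big[@sadd _/[set 0]]_(i < r) X i).
Proof.
move=> nZX.
have key (z : 'I_r -> 'rV[int]_d) (x : 'I_r -> 'rV[R]_d) :
    (forall i j, `|ztor R (z i) 0 j - x i 0 j| <= (C i)%:R) ->
    forall j, `|ztor R (\sum_i z i) 0 j - (\sum_i x i) 0 j| <= (\sum_i C i)%N%:R.
  move=> zx j; rewrite ztor_sum !summxE -sumrB natr_sum.
  by apply: le_trans (ler_norm_sum _ _ _) _; apply: ler_sum => i _; apply: zx.
split=> [_ /big_saddP[z zZ ->]|_ /big_saddP[x xX ->]].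
  have /choice[x xP] : forall i, exists x, X i x /\ forall j, `|ztor R (z i) 0 j - x 0 j| <= (C i)%:R.
    by move=> i; have [x ? ?] := (nZX i).1 _ (zZ i); exists x.
  exists (\sum_i x i); first by apply/big_saddP; exists x => // i; case: (xP i).
  by apply: key => i; case: (xP i).
have /choice[z zP] : forall i, exists z, Z i z /\ forall j, `|ztor R z 0 j - x i 0 j| <= (C i)%:R.
  by move=> i; have [z ? ?] := (nZX i).2 _ (xX i); exists z.
exists (\sum_i z i); first by apply/big_saddP; exists z => // i; case: (zP i).
by apply: key => i; case: (zP i).
Qed.

(** A sum of n points of the range is n times a convex combination with
    weights in (1/n)Z. Conversely, the weights n l_a of a point of the dilated
    hull are rounded down, except the first, which takes what is missing to n.
    Since the changes of the weights add up to 0, the error is a combination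
    of the differences A_a - A_0 with coefficients of absolute value at most
    1, for a different from 0. *)
Lemma near_nfold k (A : 'I_k.+1 -> 'rV[int]_d) : exists C, forall n,
  near_sets C (nfold n (range A)) (dil n%:R (hull (fun a => ztor R (A a)))).
Proof.
pose D a j : nat := absz (A a 0 j - A ord0 0 j)%R.
exists (\sum_a \sum_j D a j)%N => n; split.
  move=> z /nfold_rangeP[c cn ->]; exists (ztor R (\sum_i A i *+ c i)); last first.
    by move=> i; rewrite subrr normr0.
  have [n0|n0] := posnP n.
    exists (ztor R (A ord0)); first exact: (hull_vertex (fun a => ztor R (A a))).
    rewrite n0 scale0r big1 ?ztor0 // => i _.
    by move: cn; rewrite n0 => /eqP; rewrite sum_nat_eq0 => /forallP/(_ i)/eqP ->.
  have nR : n%:R != 0 :> R by rewrite pnatr_eq0 -lt0n.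
  exists (\sum_a (\row_a ((c a)%:R / n%:R)) 0 a *: ztor R (A a)).
    exists (\row_a ((c a)%:R / n%:R)) => //; split=> [a|]; first by rewrite mxE divr_ge0.
    under eq_bigr do rewrite mxE.
    by rewrite -mulr_suml -natr_sum cn mulfV.
  rewrite scaler_sumr ztor_sum; apply: eq_bigr => a _.
  by rewrite mxE scalerA mulrC divfK // ztorMn.
move=> _ [_ [l [l0 l1] ->] <-].
pose c a : nat := absz (Num.floor (n%:R * l 0 a)).
have cE a : (c a)%:R <= n%:R * l 0 a < (c a)%:R + 1.
  have nl0 : 0 <= n%:R * l 0 a by rewrite mulr_ge0.
  rewrite -[(c a)%:R]/((c a)%:Z%:~R) gez0_abs; last by rewrite floor_ge_int_tmp.
  by rewrite -[1]/(1%:~R) -intrD; exact: floor_itv.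
have cn : (\sum_(a < k) c (lift ord0 a) <= n)%N.
  rewrite -(ler_nat R) natr_sum.
  apply: (@le_trans _ _ (\sum_(a < k) n%:R * l 0 (lift ord0 a))).
    by apply: ler_sum => a _; case/andP: (cE (lift ord0 a)).
  rewrite -mulr_sumr ler_piMr // -[X in _ <= X]l1 big_ord_recl lerDr //.
pose c' a := if unlift ord0 a is Some b then c a else (n - \sum_(a < k) c (lift ord0 a))%N.
have c'n : (\sum_a c' a = n)%N.
  rewrite big_ord_recl {1}/c' unlift_none.
  have -> : (\sum_(i < k) c' (lift ord0 i) = \sum_(i < k) c (lift ord0 i))%N.
    by apply: eq_bigr => b _; rewrite /c' liftK.
  by rewrite subnK.
exists (\sum_a A a *+ c' a); first by apply/nfold_rangeP; exists c'.
move=> j; rewrite ztor_sum scaler_sumr !summxE -sumrB.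
have -> : \sum_a (ztor R (A a *+ c' a) 0 j - (n%:R *: (l 0 a *: ztor R (A a))) 0 j) =
    \sum_a ((c' a)%:R - n%:R * l 0 a) * (A a 0 j - A ord0 0 j)%:~R.
  have s0 : \sum_a ((c' a)%:R - n%:R * l 0 a) = 0.
    by rewrite sumrB -natr_sum c'n -mulr_sumr l1 mulr1 subrr.
  under [RHS]eq_bigr do rewrite intrB mulrBr.
  rewrite [RHS]sumrB -mulr_suml s0 mul0r subr0.
  by apply: eq_bigr => a _; rewrite ztorMn !mxE mulrA -mulrBl.
apply: le_trans (ler_norm_sum _ _ _) _; rewrite natr_sum; apply: ler_sum => a _.
apply: (@le_trans _ _ (D a j)%:R); last first.
  by rewrite ler_nat (bigD1 j) //= leq_addr.
rewrite normrM -intr_norm -[X in _ * X]/((D a j)%:R) /c'.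
have [b _|->] := unliftP ord0 a; last by rewrite /D subrr /= mulr0.
rewrite ler_piMl // ler_norml; have := cE a => /andP[h1 h2]; apply/andP; split; lra.
Qed.

Definition lvertex (a : 'I_d.+1) : 'rV[int]_d :=
  if unlift ord0 a is Some i then delta_mx 0 i else 0.

(** This puts the simplex on the same footing as the other summands when
    sumsets are counted. *)
Lemma lsimplex_nfold j : lsimplex j = nfold j (range lvertex).
Proof.
have sumE (c : 'I_d.+1 -> nat) (i : 'I_d) :
    (\sum_a lvertex a *+ c a) 0 i = (c (lift ord0 i))%:Z.
  rewrite big_ord_recl /lvertex unlift_none mul0rn add0r summxE.
  under eq_bigr do rewrite liftK mulmxnE mxE eqxx /=.
  rewrite (bigD1 i) //= eqxx big1 ?addr0; last by move=> b /negPf; rewrite eq_sym => ->; rewrite mul0rn.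
  by rewrite pmulrn intz.
apply/seteqP; split=> [z [z0 zj]|z /nfold_rangeP[c cj ->]]; last first.
  split=> [i|]; first by rewrite sumE.
  under eq_bigr do rewrite sumE.
  by rewrite posz_sum lez_nat -cj big_ord_recl leq_addl.
apply/nfold_rangeP.
pose c a := if unlift ord0 a is Some i then absz (z 0%R i) else (j - \sum_i absz (z 0%R i))%N.
have zj' : (\sum_i absz (z 0%R i) <= j)%N.
  rewrite -lez_nat; apply: le_trans zj; rewrite -posz_sum.
  by apply: ler_sum => i _; rewrite gez0_abs.
exists c.
  rewrite big_ord_recl {1}/c unlift_none.
  have -> : (\sum_i c (lift ord0 i) = \sum_i absz (z 0%R i))%N.
    by apply: eq_bigr => b _; rewrite /c liftK.
  by rewrite subnK.
by apply/rowP => i; rewrite sumE /c liftK gez0_abs.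
Qed.

End NearSets.

Lemma finite_ranges (V : choiceType) r (Z : 'I_r -> set V) :
  (forall i, finite_set (Z i)) -> (forall i, Z i !=set0) ->
  exists k, exists A : 'I_r -> 'I_k.+1 -> V, forall i, range (A i) = Z i.
Proof.
move=> fZ nZ; have /choice[s sP] : forall i, exists s : seq V, forall x, Z i x <-> x \in s.
  by move=> i; have [s [_ sP _]] := finite_cnt (fZ i); exists s.
have /choice[x0 x0P] : forall i, exists x, Z i x by exact: nZ.
pose k := (\sum_i size (s i))%N.
have sk i : (size (s i) <= k)%N by rewrite /k (bigD1 i) //= leq_addr.
exists k, (fun i a => nth (x0 i) (s i) a) => i; apply/seteqP; split=> [_ [a _ <-]|x /sP xs].
  have [ai|ai] := ltnP a (size (s i)); first by apply/sP/mem_nth.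
  by rewrite nth_default.
have lt : (index x (s i) < k.+1)%N by rewrite ltnS (leq_trans _ (sk i)) // index_size.
by exists (Ordinal lt) => //=; rewrite nth_index.
Qed.

(** * Volumes of Minkowski combinations *)

Section MinkowskiPolynomial.
Variables (R : realType) (d : nat).
Hypothesis d_gt0 : (0 < d)%N.
Implicit Types (X Y : set 'rV[R]_d) (Z : set 'rV[int]_d).

Lemma volume_dil_simplex (t s : R) X : 0 < t -> bounded_coord X ->
  volume (sadd (simplex (t * s)) (dil t X)) = t ^+ d * volume (sadd (simplex s) X).
Proof.
move=> t0 bX; rewrite -dil_simplex // -dil_sadd.
have -> : dil t (sadd (simplex s) X) = affine t 0 (sadd (simplex s) X).
  by congr (_ @` _); apply/funext => x; rewrite addr0.
by rewrite volume_affine //; exact: simplex_sadd_bounded.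
Qed.

Lemma fatten_refl X (e : R) : 0 <= e -> X `<=` fatten e X.
Proof. by move=> e0 x Xx; exists x => // i; rewrite subrr normr0. Qed.

Lemma volume_simplex_le (s t : R) X : s <= t -> bounded_coord X ->
  volume (sadd (simplex s) X) <= volume (sadd (simplex t) X).
Proof.
move=> st bX; apply: volume_le => //; last exact: simplex_sadd_bounded.
by move=> _ [u us [x Xx <-]]; exists u; [exact: simplex_le us|exists x].
Qed.

(** The count lies between the volumes with the simplex of size m n0 changed
    by a constant c; divided by m, this change is c / m. The second part is
    the growth bound that [evpoly_leading_form] requires. *)
Lemma cvg_cnt_near C (Z : nat -> set 'rV[int]_d) X (n0 : nat) :
  (0 < n0)%N -> convex_body X ->
  (forall m, near_sets C (Z m) (dil m%:R X)) ->
  (fun m => (cnt (sadd (lsimplex (m * n0)) (Z m)))%:R / m%:R ^+ d : R) @ \oo -->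
    volume (sadd (simplex n0%:R) X) /\
  exists D : R, forall m, (0 < m)%N ->
    `|(cnt (sadd (lsimplex (m * n0)) (Z m)))%:R| <= D * m%:R ^+ d.
Proof.
move=> n00 bX nZ; have kX : compact X by case: bX.
have bdX := compact_bounded_coord kX.
pose c := ((2 * C + 1) * d)%N.
have n0R : 0 < n0%:R :> R by rewrite ltr0n.
have upper m : (0 < m)%N -> (cnt (sadd (lsimplex (m * n0)) (Z m)))%:R <=
    volume (sadd (simplex (n0%:R + c%:R * m%:R^-1)) X) * m%:R ^+ d.
  move=> m0; have mR : 0 < m%:R :> R by rewrite ltr0n.
  rewrite mulrC -volume_dil_simplex //.
  have -> : m%:R * (n0%:R + c%:R * m%:R^-1) = (m * n0)%:R + c%:R :> R.
    by rewrite natrM; field; rewrite gt_eqF.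
  by apply: cnt_le_volume => //; exact: compact_dil.
split; last first.
  exists (volume (sadd (simplex (n0%:R + c%:R)) X)) => m m0.
  rewrite ger0_norm //; apply: le_trans (upper m m0) _.
  rewrite ler_wpM2r ?exprn_ge0 //; apply: volume_simplex_le => //.
  by rewrite lerD2l ler_piMr // invf_le1 ?ltr0n // ler1n.
have lim (sg : R) : (fun m => volume (sadd (simplex (n0%:R + sg * c%:R * m%:R^-1)) X)) @ \oo -->
    volume (sadd (simplex n0%:R) X).
  apply: (@cvg_volume _ _ d_gt0 n0%:R _ (fun=> 0) X (fun=> X)) => //.
  - rewrite -[X in _ --> X]addr0; apply: cvgD; first exact: cvg_cst.
    rewrite -[X in _ --> X](mulr0 (sg * c%:R)); apply: cvgMl_tmp; exact: cvg_invn.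
  - exact: cvg_cst.
  - by move=> m; exact: fatten_refl.
  - by move=> m; exact: fatten_refl.
apply: squeeze_cvgr (lim (-1)) (lim 1).
near=> m.
have m0 : (0 < m)%N by near: m; exact: nbhs_infty_gt.
have mc : (c <= m)%N by near: m; exact: nbhs_infty_ge.
have mR : 0 < m%:R :> R by rewrite ltr0n.
have cmn : (c <= m * n0)%N by apply: leq_trans mc _; rewrite leq_pmulr.
apply/andP; split; last by rewrite ler_pdivrMr ?exprn_gt0 // mul1r; exact: upper.
rewrite ler_pdivlMr ?exprn_gt0 // mulrC -volume_dil_simplex //.
have -> : m%:R * (n0%:R + -1 * c%:R * m%:R^-1) = (m * n0 - c)%N%:R :> R.
  by rewrite natrB // natrM; field; rewrite gt_eqF.
have := @volume_le_cnt _ _ d_gt0 C (Z m) (dil m%:R X) (m * n0 - c) (nZ m)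
  (compact_bounded_coord (compact_dil (t := m%:R) kX)).
by rewrite subnK.
Unshelve. all: by end_near. Qed.

Lemma hull_body k (A : 'I_k.+1 -> 'rV[R]_d) : convex_body (hull A).
Proof.
apply/cvx_body; split; [exists (A ord0); exact: hull_vertex|exact: compact_hull|exact: cvx_hull].
Qed.

(** All the finite sets in a sumset have to be indexed by the same ordinal;
    repeating a value enlarges the index set. *)
Lemma range_widen (V : Type) k l (A : 'I_k.+1 -> V) : (k <= l)%N ->
  range (fun a : 'I_l.+1 => A (inord (minn a k))) = range A.
Proof.
move=> kl; apply/seteqP; split=> [_ [a _ <-]|_ [a _ <-]]; first by exists (inord (minn a k)).
exists (inord a) => //; congr A; apply: val_inj.
have ak : (a <= k)%N by rewrite -ltnS.
have al : (a < l.+1)%N by rewrite ltnS (leq_trans ak).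
by rewrite /= inordK // inordK // (minn_idPl ak).
Qed.

(** For lattice polytopes, the volume is the limit of the numbers of points of
    sumsets, which is the leading form of an eventually polynomial function. *)
Lemma volume_lattice_hulls r k (A : 'I_r -> 'I_k.+1 -> 'rV[int]_d) :
  exists c, forall n : 'I_r.+1 -> nat, (forall i, (0 < n i)%N) ->
    volume (sadd (simplex (n ord0)%:R)
      (minkowski_comb (fun i => (n (lift ord0 i))%:R) (fun i => hull (fun a => ztor R (A i a)))))
    = @hform R d r.+1 c (fun i => (n i)%:R).
Proof.
pose L i := hull (fun a => ztor R (A i a)).
pose l := (k + d)%N.
(* The simplex is the summand of index 0, given by its vertices. *)
pose A' (i : 'I_r.+1) (a : 'I_l.+1) : 'rV[int]_d :=
  if unlift ord0 i is Some i' then A i' (inord (minn a k)) else lvertex (inord (minn a d)).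
have [c cP] := evpoly_leading_form d (@evpoly_sumset _ _ _ A' R).
exists c => n n0.
pose X := minkowski_comb (fun i => (n (lift ord0 i))%:R) L.
have bX : convex_body X by apply: minkowski_comb_body => i; exact: hull_body.
have /choice[C CP] : forall i, exists C, forall m,
    near_sets C (nfold m (range (A i))) (dil m%:R (L i)) by move=> i; exact: near_nfold.
pose Z m := \big[@sadd _/[set 0]]_(i < r) nfold (m * n (lift ord0 i)) (range (A i)).
have nZ m : near_sets (\sum_i C i) (Z m) (dil m%:R X).
  rewrite /X dil_minkowski_comb minkowski_combE; apply: near_big => i.
  by rewrite -natrM; exact: CP.
have ZE m : \big[@sadd _/[set 0]]_(i < r.+1) nfold (m * n i) (range (A' i)) =
    sadd (lsimplex (m * n ord0)) (Z m).
  rewrite big_ord_recl /A' unlift_none range_widen ?leq_addl // -lsimplex_nfold //.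
  by congr sadd; apply: eq_bigr => i _; rewrite liftK range_widen ?leq_addr.
have [lim bnd] := cvg_cnt_near (n0 ord0) bX nZ.
apply: (cvg_unique _ lim) => //=.
have -> : (fun m => (cnt (sadd (lsimplex (m * n ord0)) (Z m)))%:R / m%:R ^+ d : R) =
    (fun m => (cnt (\big[@sadd _/[set 0]]_(i < r.+1) nfold (m * n i) (range (A' i))))%:R / m%:R ^+ d).
  by apply/funext => m; rewrite ZE.
apply: cP => //; have [D DP] := bnd; exists D => m m0; rewrite ZE; exact: DP.
Qed.
End MinkowskiPolynomial.

Section MinkowskiTheorem.
Variables (R : realType) (d : nat).
Hypothesis d_gt0 : (0 < d)%N.
Implicit Types (X Y : set 'rV[R]_d) (Z : set 'rV[int]_d).

Lemma hform_rescale s (c : {ffun 'I_s -> 'I_d.+1} -> R) (k : R) (t v : 'I_s -> R) :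
  k * hform c (fun i => t i * v i) = hform (fun a => k * (c a * \prod_i t i ^+ a i)) v.
Proof.
rewrite mulr_sumr; apply: eq_bigr => a _.
under eq_bigr do rewrite exprMn.
by rewrite big_split /= !mulrA.
Qed.

Lemma cvx_fatten (e : R) X : cvx X -> cvx (fatten e X).
Proof.
move=> cX x y t [x' Xx xx'] [y' Xy yy'] /andP[t0 t1].
exists (t *: x' + (1 - t) *: y'); first by apply: cX => //; rewrite t0.
move=> i; rewrite !mxE.
have -> : t * x 0 i + (1 - t) * y 0 i - (t * x' 0 i + (1 - t) * y' 0 i) =
  t * (x 0 i - x' 0 i) + (1 - t) * (y 0 i - y' 0 i) by ring.
have t1' : 0 <= 1 - t by lra.
apply: le_trans (ler_normD _ _) _; rewrite !normrM (ger0_norm t0) (ger0_norm t1').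
apply: (@le_trans _ _ (t * e + (1 - t) * e)); last by lra.
by apply: lerD; apply: ler_wpM2l.
Qed.

Lemma near_hull k (A : 'I_k.+1 -> 'rV[int]_d) C X : convex_body X ->
  near_sets C (range A) X ->
  X `<=` fatten C%:R (hull (fun a => ztor R (A a))) /\
  hull (fun a => ztor R (A a)) `<=` fatten C%:R X.
Proof.
move=> /cvx_body[_ _ cX] [AX XA]; split.
  move=> x /XA[_ [a _ <-] ax]; exists (ztor R (A a)); first exact: (hull_vertex (fun a => ztor R (A a))).
  by move=> i; rewrite distrC.
apply: hull_min; first exact: cvx_fatten.
by move=> a; have [|x Xx xa] := AX (A a); [exists a|exists x].
Qed.

Lemma dil_body (t : R) X : convex_body X -> convex_body (dil t X).
Proof.
move=> /cvx_body[[x Xx] kX cX]; apply/cvx_body; split.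
- by exists (t *: x); exists x.
- exact: compact_dil.
- exact: cvx_dil.
Qed.

Lemma minkowski_comb_dil r (t : R) (lam : 'I_r -> R) (K : 'I_r -> set 'rV[R]_d) :
  minkowski_comb lam (fun i => dil t (K i)) = minkowski_comb (fun i => t * lam i) K.
Proof.
rewrite !minkowski_combE; apply: eq_bigr => i _.
by rewrite dil_dil mulrC.
Qed.

(** The polytopes L p i stay within a fixed distance of (p + 1) K i, so that
    after rescaling the distance is of order 1 / (p + 1). *)
Lemma cvg_volume_hulls r (K : 'I_r -> set 'rV[R]_d) (L : nat -> 'I_r -> set 'rV[R]_d)
    (C : R) (n0 : R) (n : 'I_r -> R) :
  (forall i, convex_body (K i)) -> (forall p i, convex_body (L p i)) -> 0 <= C ->
  (forall p i, dil p.+1%:R (K i) `<=` fatten C (L p i)) ->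
  (forall p i, L p i `<=` fatten C (dil p.+1%:R (K i))) ->
  0 < n0 -> (forall i, 0 <= n i) ->
  (fun p => volume (sadd (simplex n0) (minkowski_comb (fun i => p.+1%:R^-1 * n i) (L p)))) @ \oo -->
    volume (sadd (simplex n0) (minkowski_comb n K)).
Proof.
move=> bK bL C0 KL LK n00 npos.
have KE p : minkowski_comb n K =
    minkowski_comb (fun i => p.+1%:R^-1 * n i) (fun i => dil p.+1%:R (K i)).
  rewrite minkowski_comb_dil; congr minkowski_comb.
  by apply/funext => i; rewrite mulrA mulfV ?mul1r // pnatr_eq0.
have pos p i : 0 <= p.+1%:R^-1 * n i by rewrite mulr_ge0 ?invr_ge0.
apply: (@cvg_volume _ _ d_gt0 n0 (fun=> n0) (fun p => \sum_i p.+1%:R^-1 * n i * C)) => //.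
- exact: cvg_cst.
- have -> : (fun p => \sum_i p.+1%:R^-1 * n i * C) = (fun p => p.+1%:R^-1 * \sum_i n i * C).
    by apply/funext => p; rewrite mulr_sumr; apply: eq_bigr => i _; rewrite mulrA.
  rewrite -[X in _ --> X](mul0r (\sum_i n i * C)); apply: cvgMr_tmp.
  exact: cvg_harmonic.
- by move=> p; apply: sumr_ge0 => i _; rewrite mulr_ge0.
- by apply: minkowski_comb_body.
- by move=> p; apply: minkowski_comb_body.
- by move=> p; rewrite (KE p); apply: minkowski_comb_fatten.
- by move=> p; rewrite (KE p); apply: minkowski_comb_fatten.
Qed.

(** All lattice points within distance 1 of the set; rounding down shows that
    they come close to every point of it. *)
Lemma lattice_approximation X (t : R) : convex_body X ->
  exists Z, [/\ finite_set Z, Z !=set0 & near_sets 1 Z (dil t X)].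
Proof.
move=> bX; have [[x Xx] kX _] := bX.
pose Z := [set z | fatten 1 (dil t X) (ztor R z)].
have fl (y : 'rV[R]_d) i : `|ztor R (\row_i Num.floor (y 0 i)) 0 i - y 0 i| <= 1.
  have := floor_cube y i; rewrite !mxE ler_norml => /andP[h1 h2].
  apply/andP; split; lra.
exists Z; split.
- apply: finite_lattice => //; apply: bounded_fatten; apply: compact_bounded_coord.
  exact: compact_dil.
- exists (\row_i Num.floor ((t *: x) 0 i)); exists (t *: x); first by exists x.
  by move=> i; exact: fl.
- split=> [z [y Xy zy]|y Xy]; first by exists y.
  exists (\row_i Num.floor (y 0 i)); last by move=> i; exact: fl.
  by exists y => // i; exact: fl.
Qed.

(** The polytopes spanned by lattice approximations of (p + 1) K i have
    volumes given by forms; rescaled by 1 / (p + 1) these volumes converge,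
    and the limit is a form by [hform_closed]. *)
Lemma minkowski_nat r (K : 'I_r -> set 'rV[R]_d) : (forall i, convex_body (K i)) ->
  exists c, forall n : 'I_r.+1 -> nat, (forall i, (0 < n i)%N) ->
    volume (sadd (simplex (n ord0)%:R) (minkowski_comb (fun i => (n (lift ord0 i))%:R) K))
    = @hform R d r.+1 c (fun i => (n i)%:R).
Proof.
move=> bK.
have /choice[Z ZP] : forall p : nat, exists Z : 'I_r -> set 'rV[int]_d, forall i,
    [/\ finite_set (Z i), Z i !=set0 & near_sets 1 (Z i) (dil p.+1%:R (K i))].
  move=> p; have /choice[Z ZP] := fun i => lattice_approximation p.+1%:R (bK i).
  by exists Z.
have /choice[L LP] : forall p : nat, exists L : 'I_r -> set 'rV[R]_d, [/\
    forall i, convex_body (L i),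
    forall i, dil p.+1%:R (K i) `<=` fatten 1 (L i) /\ L i `<=` fatten 1 (dil p.+1%:R (K i)) &
    exists c, forall n : 'I_r.+1 -> nat, (forall i, (0 < n i)%N) ->
      volume (sadd (simplex (n ord0)%:R) (minkowski_comb (fun i => (n (lift ord0 i))%:R) L))
      = @hform R d r.+1 c (fun i => (n i)%:R)].
  move=> p; have [k [A AZ]] := finite_ranges (fun i => let: And3 f _ _ := ZP p i in f)
    (fun i => let: And3 _ f _ := ZP p i in f).
  exists (fun i => hull (fun a => ztor R (A i a))); split.
  - by move=> i; exact: hull_body.
  - move=> i; apply: (near_hull (C := 1)); first exact: dil_body.
    by rewrite AZ; case: (ZP p i).
  - exact: volume_lattice_hulls.
have /choice[c cP] := fun p => let: And3 _ _ f := LP p in f.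
(* Scaling the polytopes but not the simplex by 1 / (p + 1) amounts to scaling
   the simplex by p + 1 and then everything by 1 / (p + 1). *)
pose t p (i : 'I_r.+1) : R := if unlift ord0 i is Some _ then 1 else p.+1%:R.
pose c' p a := (p.+1%:R ^+ d)^-1 * (c p a * \prod_i t p i ^+ a i).
have c'E p (n : 'I_r.+1 -> nat) : (forall i, (0 < n i)%N) -> hform (c' p) (fun i => (n i)%:R) =
    volume (sadd (simplex (n ord0)%:R) (minkowski_comb (fun i => p.+1%:R^-1 * (n (lift ord0 i))%:R) (L p))).
  move=> n0; have pR : 0 < p.+1%:R :> R by [].
  rewrite -hform_rescale; apply: (canLR (mulKf _)); first by rewrite expf_neq0 ?gt_eqF.
  have bY : bounded_coord (minkowski_comb (fun i => p.+1%:R^-1 * (n (lift ord0 i))%:R) (L p)).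
    apply: compact_bounded_coord.
    by have [] := minkowski_comb_body (fun i => p.+1%:R^-1 * (n (lift ord0 i))%:R) (let: And3 f _ _ := LP p in f).
  rewrite -volume_dil_simplex // dil_minkowski_comb.
  pose n' (i : 'I_r.+1) := if unlift ord0 i is Some _ then n i else (p.+1 * n i)%N.
  have := cP p n'; rewrite {2}/n' unlift_none natrM.
  have -> : (fun i => (n' (lift ord0 i))%:R) = (fun i => p.+1%:R * (p.+1%:R^-1 * (n (lift ord0 i))%:R)) :> ('I_r -> R).
    by apply/funext => i; rewrite /n' liftK mulVKf ?gt_eqF.
  move=> ->; last by move=> i; rewrite /n'; case: (unlift _ _) => [_|]; rewrite ?muln_gt0 n0.
  congr hform; apply/funext => i; rewrite /t /n'.
  by case: unliftP => [j|] _; rewrite ?mul1r // natrM.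
apply: (hform_closed (c := c')) => n n0.
under eq_fun do rewrite c'E //.
apply: (@cvg_volume_hulls r K L 1) => //.
- by move=> p; case: (LP p).
- by move=> p i; have [_ /(_ i)[]] := LP p.
- by move=> p i; have [_ /(_ i)[]] := LP p.
- by rewrite ltr0n.
Qed.

(** The form found for positive integers describes the volume at rational
    points by homogeneity, and at real points with positive simplex
    coefficient by continuity. When this coefficient is 0, [cvg_volume] does
    not apply; the volume of the fattened sum is then bounded above by
    [volume_fatten]. *)
Theorem minkowski r (K : 'I_r -> set 'rV[R]_d) : (forall i, convex_body (K i)) ->
  exists c, forall v : 'I_r.+1 -> R, (forall i, 0 <= v i) ->
    volume (sadd (simplex (v ord0)) (minkowski_comb (fun i => v (lift ord0 i)) K))
    = @hform R d r.+1 c v.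
Proof.
move=> bK; have [c cP] := minkowski_nat bK; exists c.
have /choice[B BP] : forall i, exists B : R, forall x j, K i x -> `|x 0 j| <= B.
  by move=> i; have [_ kK _] := bK i; exact: compact_bounded_coord kK.
pose X (v : 'I_r.+1 -> R) := minkowski_comb (fun i => v (lift ord0 i)) K.
have bX v : convex_body (X v) by apply: minkowski_comb_body.
have bdX v : bounded_coord (X v) by apply: compact_bounded_coord; case: (bX v).
have pos v : 0 < v ord0 -> (forall i, 0 <= v i) ->
    volume (sadd (simplex (v ord0)) (X v)) = hform c v.
  move=> v0 vpos.
  (* Rounding up keeps the approximations w N i of v i positive. *)
  pose n N i : nat := (absz (Num.floor (N.+1%:R * v i))).+1.
  pose w N i : R := N.+1%:R^-1 * (n N i)%:R.
  have wv N i : `|w N i - v i| <= N.+1%:R^-1.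
    have NR : 0 < N.+1%:R :> R by [].
    have : `|(n N i)%:R - N.+1%:R * v i| <= 1.
      rewrite /n -natr1 -[(absz _)%:R]/((absz _)%:Z%:~R) gez0_abs; last first.
        by rewrite floor_ge_int_tmp mulr_ge0.
      have := floor_itv (N.+1%:R * v i); rewrite intrD ler_norml => /andP[h1 h2].
      apply/andP; split; lra.
    rewrite -(ler_pM2l (x := N.+1%:R^-1)) ?invr_gt0 // mulr1; apply: le_trans.
    rewrite -[X in X * `|_|]ger0_norm ?invr_ge0 // -normrM mulrBr mulKf ?gt_eqF //.
  have wlim i : (fun N => w N i) @ \oo --> v i.
    apply/cvgrPdist_le => e e0; have [N _ NP] := (cvgrPdist_le _ _).1 (@cvg_invn R) e e0.
    exists N => // M NM; rewrite distrC; apply: le_trans (wv _ _) _.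
    have := NP M.+1 (leqW NM); rewrite /= sub0r normrN ger0_norm ?invr_ge0 //.
  have wE N : volume (sadd (simplex (w N ord0)) (X (w N))) = hform c (w N).
    have NR : 0 < N.+1%:R :> R by [].
    rewrite /w hform_scale exprVn; apply: (canRL (mulKf _)); first by rewrite expf_neq0 ?gt_eqF.
    rewrite -volume_dil_simplex // dil_minkowski_comb mulrA mulfV ?gt_eqF // mul1r -cP //.
    congr (volume (sadd _ (minkowski_comb _ _))); apply/funext => i.
    by rewrite mulrA mulfV ?gt_eqF // mul1r.
  have l1 : (fun N => hform c (w N)) @ \oo --> hform c v.
    by apply: cvg_hform => // a _; exact: cvg_cst.
  apply: (cvg_unique _ _ l1) => //=.
  under eq_fun do rewrite -wE.
  pose e N := \sum_i `|w N (lift ord0 i) - v (lift ord0 i)| * `|B i|.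
  apply: (@cvg_volume _ _ d_gt0 (v ord0) (fun N => w N ord0) e) => //.
  - rewrite (_ : 0 = \sum_(i < r) (0 * `|B i|)); last by rewrite big1 // => i _; rewrite mul0r.
    apply: cvg_sumr => i _; apply: cvgMr_tmp.
    rewrite -(normr0 R) -(subrr (v (lift ord0 i))); apply: cvg_norm; apply: cvgB => //; exact: cvg_cst.
  - by move=> N; apply: sumr_ge0 => i _; rewrite mulr_ge0.
  - move=> N; rewrite /e; under eq_bigr do rewrite distrC.
    apply: minkowski_comb_close => i x j Kx; apply: le_trans (BP _ _ _ Kx) _; exact: ler_norm.
  - move=> N; apply: minkowski_comb_close => i x j Kx; apply: le_trans (BP _ _ _ Kx) _; exact: ler_norm.
move=> v vpos; have [v0|v0] := eqVneq (v ord0) 0; last by apply: pos => //; rewrite lt0r v0 vpos.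
pose w (N : nat) i : R := if unlift ord0 i is Some _ then v i else N.+1%:R^-1.
have Xw N : X (w N) = X v.
  by congr minkowski_comb; apply/funext => i; rewrite /w liftK.
have inv0 : (fun N : nat => N.+1%:R^-1 : R) @ \oo --> (0 : R).
  exact: cvg_harmonic.
have l1 : (fun N => hform c (w N)) @ \oo --> hform c v.
  apply: cvg_hform => [a _|i]; first exact: cvg_cst.
  by rewrite /w; case: unliftP => [j _|->]; [exact: cvg_cst|rewrite v0].
apply: (cvg_unique _ _ l1) => //=.
have wE N : hform c (w N) = volume (sadd (simplex N.+1%:R^-1) (X v)).
  rewrite -pos.
  - by rewrite Xw /w unlift_none.
  - by rewrite /w unlift_none invr_gt0.
  - by move=> i; rewrite /w; case: (unlift _ _) => [_|]; rewrite ?invr_ge0.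
under eq_fun do rewrite wE.
rewrite v0; apply/cvgrPdist_le => e e0.
have kX : compact (sadd (simplex 0) (X v)).
  by apply: compact_sadd; [exact: compact_simplex|case: (bX v)].
have [t t0 tP] := volume_fatten d_gt0 kX e0.
have [N _ NP] := (cvgrPdist_le _ _).1 inv0 t t0.
exists N => // M NM; have tM : M.+1%:R^-1 <= t.
  by have := NP M NM; rewrite /= sub0r normrN ger0_norm ?invr_ge0.
have h1 : volume (sadd (simplex 0) (X v)) <= volume (sadd (simplex M.+1%:R^-1) (X v)).
  by apply: volume_simplex_le => //; rewrite invr_ge0.
rewrite distrC ger0_norm ?subr_ge0 // lerBlDl; apply: le_trans tP.
apply: volume_le => //; last by apply: bounded_fatten; exact: simplex_sadd_bounded.
have X0 : X v `<=` fatten 0 (sadd (simplex 0) (X v)).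
  move=> x Xx; exists x; last by move=> i; rewrite subrr normr0.
  exists 0; last by exists x; rewrite // add0r.
  by split=> [i|]; rewrite ?mxE // big1 // => i _; rewrite mxE.
apply: subset_trans (fatten_sadd_simplex (t := M.+1%:R^-1) X0) _.
by rewrite addr0 => x [y Xy xy]; exists y => // i; apply: le_trans (xy i) tM.
Qed.
End MinkowskiTheorem.

(** * Finite differences and mixed volumes *)

Definition fcons r (T : Type) (x : T) (a : {ffun 'I_r -> T}) : {ffun 'I_r.+1 -> T} :=
  [ffun i => if unlift ord0 i is Some j then a j else x].

Lemma fcons0 r (T : Type) (x : T) (a : {ffun 'I_r -> T}) : fcons x a ord0 = x.
Proof. by rewrite ffunE unlift_none. Qed.

Lemma fconsS r (T : Type) (x : T) (a : {ffun 'I_r -> T}) i : fcons x a (lift ord0 i) = a i.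
Proof. by rewrite ffunE liftK. Qed.

(** Sums over multi-indices are split off at the index 0, which belongs to the
    simplex. *)
Lemma sum_fcons (V : nmodType) r (T : finType) (P : pred {ffun 'I_r.+1 -> T})
    (G : {ffun 'I_r.+1 -> T} -> V) :
  \sum_(a | P a) G a = \sum_x \sum_(a | P (fcons x a)) G (fcons x a).
Proof.
rewrite pair_big_dep /= (reindex (fun p : T * {ffun 'I_r -> T} => fcons p.1 p.2)) //=.
exists (fun a => (a ord0, [ffun i => a (lift ord0 i)])) => [[x a] _|a _] /=.
  by rewrite fcons0; congr pair; apply/ffunP => i; rewrite ffunE fconsS.
by apply/ffunP => i; rewrite ffunE; case: unliftP => [j|] ->; rewrite ?ffunE.
Qed.

(** Sums over multi-indices are split off at the index 0, which belongs to the
    simplex. *)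
Lemma sum_fcons_ord r d (x : 'I_d.+1) (a : {ffun 'I_r -> 'I_d.+1}) :
  (\sum_i fcons x a i = x + \sum_i a i)%N.
Proof. by rewrite big_ord_recl fcons0; congr addn; apply: eq_bigr => i _; rewrite fconsS. Qed.

Lemma prod_fcons (R : pzSemiRingType) r d (w : 'I_r.+1 -> R) (x : 'I_d.+1)
    (a : {ffun 'I_r -> 'I_d.+1}) :
  \prod_i w i ^+ fcons x a i = w ord0 ^+ x * \prod_i w (lift ord0 i) ^+ a i.
Proof. by rewrite big_ord_recl fcons0; congr (_ * _); apply: eq_bigr => i _; rewrite fconsS. Qed.

Section FiniteDifferences.
Variable R : realType.

Definition fdiff (f : nat -> R) (n : nat) : R := f n.+1 - f n.

Lemma iter_fdiff_sum a (I : Type) (s : seq I) (k : I -> R) (f : I -> nat -> R) n :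
  iter a fdiff (fun m => \sum_(i <- s) k i * f i m) n =
  \sum_(i <- s) k i * iter a fdiff (f i) n.
Proof.
elim: a n => //= a IH n; rewrite /fdiff !IH -sumrB.
by apply: eq_bigr => i _; rewrite mulrBr.
Qed.

Lemma fdiff_exp b n : fdiff (fun x => x%:R ^+ b) n = \sum_(j < b) 'C(b, j)%:R * n%:R ^+ j.
Proof.
rewrite /fdiff -natr1 (addrC n%:R) exprDn big_ord_recr /= subnn expr0 mul1r binn mulr1n addrK.
by apply: eq_bigr => j _; rewrite expr1n mul1r mulr_natl.
Qed.

(** A difference lowers the degree by one and multiplies the leading
    coefficient by the degree. *)
Lemma iter_fdiff_exp a b : (b <= a)%N ->
  forall n, iter a fdiff (fun x => x%:R ^+ b) n = (a`!)%:R *+ (b == a).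
Proof.
elim: a b => [|a IH] b ba n.
  by move: ba; rewrite leqn0 => /eqP ->; rewrite /= expr0.
rewrite iterSr.
have -> : fdiff (fun x => x%:R ^+ b) = (fun n => \sum_(j < b) 'C(b, j)%:R * n%:R ^+ j).
  by apply/funext => m; exact: fdiff_exp.
rewrite iter_fdiff_sum.
under eq_bigr => j _ do rewrite (IH j (leq_trans (ltn_ord j) ba : j < a.+1)%N).
move: ba; rewrite leq_eqVlt => /orP[/eqP ->|ba].
  rewrite eqxx big_ord_recr /= eqxx big1 ?add0r; last first.
    by move=> j _; rewrite ltn_eqF // mulr0n mulr0.
  by rewrite mulr1n -natrM binSn factS.
rewrite [b == _]ltn_eqF // big1 // => j _.
by rewrite ltn_eqF ?mulr0n ?mulr0 // (leq_trans (ltn_ord j)).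
Qed.

Section Multi.
Variable r : nat.
Implicit Types (l : seq 'I_r) (n : 'I_r -> nat).

Definition bump1 n i : 'I_r -> nat := fun j => (n j + (j == i))%N.

Fixpoint pdiff l (f : ('I_r -> nat) -> R) n : R :=
  if l is i :: l' then pdiff l' f (bump1 n i) - pdiff l' f n else f n.

Lemma pdiff_sum l (I : Type) (s : seq I) (P : pred I) (k : I -> R) (f : I -> ('I_r -> nat) -> R) n :
  pdiff l (fun m => \sum_(i <- s | P i) k i * f i m) n =
  \sum_(i <- s | P i) k i * pdiff l (f i) n.
Proof.
elim: l n => //= i l IH n; rewrite !IH -sumrB.
by apply: eq_bigr => j _; rewrite mulrBr.
Qed.

Lemma pdiff_prod l (f : 'I_r -> nat -> R) n :
  pdiff l (fun m => \prod_i f i (m i)) n =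
  \prod_i iter (count_mem i l) fdiff (f i) (n i).
Proof.
elim: l n => //= i l IH n; rewrite !IH (bigD1 i) //= [X in _ - X](bigD1 i) //=.
rewrite [RHS](bigD1 i) //= eqxx add1n iterS /fdiff mulrBl; congr (_ * _ - _ * _).
- by rewrite /bump1 eqxx addn1.
- by apply: eq_bigr => j ji; rewrite /bump1 (negPf ji) addn0 eq_sym (negPf ji).
- by apply: eq_bigr => j ji; rewrite eq_sym (negPf ji).
Qed.
End Multi.
End FiniteDifferences.

Section MixedVolume.
Variables (R : realType) (d : nat).
Hypothesis d_gt0 : (0 < d)%N.
Implicit Types (X Y : set 'rV[R]_d) (s : seq (set 'rV[R]_d)).

(** The iterated difference of the volume at X in the directions s. At X = 0
    this is the polarisation of the volume, that is, the mixed volume. *)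
Fixpoint vdiff s X : R :=
  if s is K :: s' then vdiff s' (sadd X K) - vdiff s' X else volume X.

Lemma vdiff_swap s t K X : vdiff (s ++ K :: t) X = vdiff (K :: s ++ t) X.
Proof.
elim: s X => //= L s IH X; rewrite !IH /=.
have -> : sadd (sadd X L) K = sadd (sadd X K) L by rewrite -saddA (saddC L) saddA.
ring.
Qed.

Lemma vdiff_perm s t X : perm_eq s t -> vdiff s X = vdiff t X.
Proof.
elim: s t X => [|K s IH] t X; first by move=> /perm_size /esym /size0nil ->.
move=> st; have Kt : K \in t by rewrite -(perm_mem st) inE eqxx.
case/splitPr: Kt st => t1 t2; rewrite perm_sym -cat1s perm_catCA /= perm_cons perm_sym => st.
by rewrite vdiff_swap /= !(IH _ _ st).
Qed.

Lemma sadd_simplex0 X : sadd (simplex 0) X = X.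
Proof.
have -> : simplex 0 = [set (0 : 'rV[R]_d)].
  apply/seteqP; split=> [x [x0 xs]|_ ->].
    apply/rowP => i; rewrite mxE; apply/eqP; rewrite eq_le x0 andbT; apply: le_trans xs.
    by rewrite (bigD1 i) //= lerDl sumr_ge0.
  by split=> [i|]; rewrite ?mxE // big1 // => i _; rewrite mxE.
exact: sadd0s.
Qed.

(** The case of a simplex of size 0. *)
Lemma minkowski_form r (K : 'I_r -> set 'rV[R]_d) : (forall i, convex_body (K i)) ->
  exists c, forall v : 'I_r -> R, (forall i, 0 <= v i) ->
    volume (minkowski_comb v K) = @hform R d r c v.
Proof.
move=> bK; have [c cP] := minkowski d_gt0 bK.
exists (fun a => c (fcons ord0 a)) => v v0.
pose w (i : 'I_r.+1) := if unlift ord0 i is Some j then v j else 0.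
have w0 : w ord0 = 0 by rewrite /w unlift_none.
have := cP w; rewrite w0 sadd_simplex0.
have -> : (fun i => w (lift ord0 i)) = v by apply/funext => i; rewrite /w liftK.
move=> ->; last by move=> i; rewrite /w; case: unlift.
rewrite /hform sum_fcons (bigD1 ord0) //= [X in _ + X]big1 ?addr0.
  apply: eq_big => [a|a _]; first by rewrite sum_fcons_ord.
  rewrite prod_fcons expr0 mul1r; congr (_ * _).
  by apply: eq_bigr => i _; rewrite /w liftK.
move=> x x0; apply: big1 => a _.
by rewrite prod_fcons w0 expr0n -[_ == 0%N]/(x == ord0) (negPf x0) mul0r mulr0.
Qed.

Lemma minkowski_comb_bump r (K : 'I_r -> set 'rV[R]_d) (n : 'I_r -> nat) i :
  (forall i, convex_body (K i)) ->
  sadd (minkowski_comb (fun j => (n j)%:R) K) (K i) =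
  minkowski_comb (fun j => (bump1 n i j)%:R) K.
Proof.
move=> bK; rewrite !minkowski_combE (bigD1 i) //= [RHS](bigD1 i) //=.
have /cvx_body[_ _ cK] := bK i.
rewrite -saddA [X in sadd _ X]saddC saddA -{2}(dil1 (K i)) dil_sadd_cvx //.
rewrite /bump1 eqxx natrD; congr sadd.
by apply: eq_bigr => j /negPf ->; rewrite addn0.
Qed.

Lemma copiesE (T : Type) r (K : 'I_r -> T) (a : 'I_r -> nat) :
  copies K a = map K (copies id a).
Proof.
rewrite /copies map_flatten -map_comp; congr flatten; apply: eq_map => i /=.
by rewrite map_nseq.
Qed.

Lemma count_copies r (a : 'I_r -> nat) i : count_mem i (copies id a) = a i.
Proof.
rewrite /copies count_flatten -map_comp sumnE big_map big_enum /=.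
rewrite (bigD1 i) //= count_nseq /= eqxx mul1n big1 ?addn0 // => j /negPf ji.
by rewrite count_nseq /= ji.
Qed.

Lemma vdiff_copies r (K : 'I_r -> set 'rV[R]_d) (l : seq 'I_r) (n : 'I_r -> nat) :
  (forall i, convex_body (K i)) ->
  vdiff (map K l) (minkowski_comb (fun j => (n j)%:R) K) =
  pdiff l (fun n => volume (minkowski_comb (fun j => (n j)%:R) K)) n.
Proof.
by move=> bK; elim: l n => //= i l IH n; rewrite minkowski_comb_bump // !IH.
Qed.

(** On combinations of K with integer coefficients, the volume is a form with
    some coefficients c, and adding K i increases the coefficient i by 1. The
    difference at 0 taken a i times in each direction i kills the monomials of
    exponent b with b i < a i for some i, which are all those of the same
    degree other than b = a, and sends the monomial of exponent a to the
    product of the factorials. *)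
Lemma mixed_volume_exists : exists MV, @is_mixed_volume R d MV.
Proof.
exists (fun s => vdiff s [set 0]); split=> [s t _ _ st|r K lam bK lam0].
  exact: vdiff_perm.
have [c cP] := minkowski_form bK; rewrite cP //; apply: eq_bigr => a /eqP ad.
congr (_ * _); rewrite copiesE.
have -> : [set 0] = minkowski_comb (fun=> (0%N)%:R) K.
  rewrite minkowski_combE; rewrite big1 // => i _; rewrite dil0 //.
  by case: (bK i).
rewrite vdiff_copies //.
have -> : (fun n => volume (minkowski_comb (fun j => (n j)%:R) K)) =
    (fun n : 'I_r.+1 -> nat => \sum_(b : {ffun 'I_r.+1 -> 'I_d.+1} | (\sum_i b i == d)%N)
        c b * \prod_i (n i)%:R ^+ b i).
  by apply/funext => n; rewrite cP.
rewrite pdiff_sum (bigD1 a) ?ad //= [X in _ + X]big1 ?addr0.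
  rewrite (pdiff_prod _ (fun i x => x%:R ^+ a i)).
  rewrite [X in _ * (_ * X)](eq_bigr (fun i => ((a i)`!)%:R)); last first.
    by move=> i _; rewrite count_copies iter_fdiff_exp // eqxx mulr1n.
  rewrite natr_prod mulrCA mulVf ?mulr1 //.
  by apply/prodf_neq0 => i _; rewrite pnatr_eq0 -lt0n fact_gt0.
move=> b /andP[/eqP bd ba]; rewrite (pdiff_prod _ (fun i x => x%:R ^+ b i)).
have [i bai] : exists i, (b i < a i)%N.
  apply/existsP; rewrite -[X in is_true X]negbK; apply/negP => /existsPn ab.
  move: ba => /negP; apply; apply/eqP/ffunP => i; apply: val_inj => /=.
  have le j : (a j <= b j)%N by rewrite leqNgt ab.
  apply/eqP; rewrite eqn_leq le andbT leqNgt; apply/negP => lti.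
  have : (\sum_i a i < \sum_i b i)%N.
    rewrite (bigD1 i) //= [X in (_ < X)%N](bigD1 i) //= -addSn leq_add //.
    exact: leq_sum.
  by rewrite ad bd ltnn.
by rewrite (bigD1 i) //= count_copies iter_fdiff_exp ?(ltnW bai) // ltn_eqF // mulr0n mul0r mulr0.
Qed.

Lemma mixed_volumeP : @is_mixed_volume R d mixed_volume.
Proof.
by have [MV MVP] := mixed_volume_exists; rewrite /mixed_volume; exact: (xgetPex (fun=> 0) (ex_intro _ MV MVP)).
Qed.
End MixedVolume.

(** * Monomial ideals and dimensions of their quotients *)

(** Makes sets of exponents subject to the theory of sums of sets. *)
HB.instance Definition _ n := GRing.isNmodule.Build 'X_{1..n} (@addmA n) (@addmC n) (@add0m n).

Section IdealBasics.
Variable A : comNzRingType.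
Implicit Types I J S : set A.

Lemma ideal_gen_ideal S : is_ideal (ideal_gen S).
Proof.
split.
- by move=> I [[]].
- by move=> f g If Ig I iI; have [[I0 ID IM] _] := iI; apply: ID; [exact: If|exact: Ig].
- by move=> a f If I iI; have [[I0 ID IM] _] := iI; apply: IM; exact: If.
Qed.

Lemma ideal_gen_sub S : S `<=` ideal_gen S.
Proof. exact: sub_smallest. Qed.

Lemma ideal_gen_min S I : is_ideal I -> S `<=` I -> ideal_gen S `<=` I.
Proof. exact: smallest_sub. Qed.
End IdealBasics.

Section MonomialIdealTheory.
Variables (k : fieldType) (N : nat).
Implicit Types (G H : set 'X_{1..N}) (f : {mpoly k[N]}) (m : 'X_{1..N}).

Definition upset G : set 'X_{1..N} := [set m | exists2 g, G g & (g <= m)%MM].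

(** The ideal generated by the monomials with exponents in G, described by the
    supports of its elements. *)
Definition monid G : set {mpoly k[N]} := [set f | forall m, m \in msupp f -> upset G m].

Lemma monid_ideal G : is_ideal (monid G).
Proof.
split=> [m|f g Gf Gg m /msuppD_le|a f Gf m /msuppM_le].
- by rewrite msupp0.
- by rewrite mem_cat => /orP[/Gf|/Gg].
- move=> /allpairsP[[m1 m2] /= [_ /Gf[g Gg gm] ->]]; exists g => //.
  by apply: lepm_trans gm _; exact: lem_addl.
Qed.

Lemma monidX G m : upset G m -> monid G 'X_[m].
Proof. by move=> Gm m'; rewrite msuppX inE => /eqP ->. Qed.

(** Induction on the support of f: a polynomial in the monomial ideal is a sum
    of multiples of generators, one for each of its monomials. *)
Lemma monid_sub_ideal G (I : set {mpoly k[N]}) : is_ideal I ->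
  (forall g, G g -> I 'X_[g]) -> monid G `<=` I.
Proof.
move=> [I0 ID IM] GI f; elim/mpolyind: f => [_|c m f mf c0 IH fG]; first exact: I0.
apply: ID; last first.
  apply: IH => m' m'f; apply: fG; rewrite mcoeff_msupp mcoeffD mcoeffZ mcoeffX.
  have [mm'|mm'] := eqVneq m m'; first by rewrite mm' m'f in mf.
  by rewrite mulr0 add0r -mcoeff_msupp.
have [g Gg gm] : upset G m.
  apply: fG; rewrite mcoeff_msupp mcoeffD mcoeffZ mcoeffX eqxx mulr1.
  by rewrite (memN_msupp_eq0 mf) addr0.
by rewrite -mul_mpolyC -(submK gm) mpolyXD mulrA; apply/IM/GI.
Qed.

Lemma ideal_gen_monomials G : ideal_gen [set 'X_[m] | m in G] = monid G.
Proof.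
apply/seteqP; split.
  apply: ideal_gen_min; first exact: monid_ideal.
  by move=> _ [m Gm <-]; apply: monidX; exists m => //; exact: lepm_refl.
apply: monid_sub_ideal; first exact: ideal_gen_ideal.
by move=> g Gg; apply: ideal_gen_sub; exists g.
Qed.

Lemma monomial_ideal_monid G : monomial_ideal (monid G).
Proof. by exists G; rewrite ideal_gen_monomials. Qed.

Lemma monid_sub G H : G `<=` upset H -> monid G `<=` monid H.
Proof.
move=> GH f Gf m /Gf[g /GH[h Hh hg] gm]; exists h => //; exact: lepm_trans hg gm.
Qed.

Lemma ideal_mul_monid G H : ideal_mul (monid G) (monid H) = monid (sadd G H).
Proof.
apply/seteqP; split.
  apply: ideal_gen_min; first exact: monid_ideal.
  move=> _ [f Gf [h Hh <-]] m /msuppM_le /allpairsP[[m1 m2] /= [/Gf[g Gg gm] /Hh[h' Hh' hm] ->]].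
  exists (g + h')%R; first by exists g => //; exists h'.
  apply/mnm_lepP => i; rewrite !mnmDE leq_add //; exact: mnm_lepP.
apply: monid_sub_ideal; first exact: ideal_gen_ideal.
move=> _ [g Gg [h Hh <-]]; apply: ideal_gen_sub.
exists 'X_[g]; first by apply: monidX; exists g => //; exact: lepm_refl.
exists 'X_[h]; first by apply: monidX; exists h => //; exact: lepm_refl.
by rewrite -mpolyXD.
Qed.

Lemma monid0 : monid [set 0] = setT.
Proof.
apply/seteqP; split=> // f _ m _; exists 0 => //.
by apply/mnm_lepP => i; rewrite mnm0E.
Qed.

Lemma ideal_prod_monid r (G : 'I_r -> set 'X_{1..N}) :
  ideal_prod (fun i => monid (G i)) = monid (\big[@sadd _/[set 0]]_(i < r) G i).
Proof.
rewrite /ideal_prod; elim/big_rec2: _ => [|i X Y _ ->]; first by rewrite monid0.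
by rewrite ideal_mul_monid.
Qed.

Lemma ideal_exp_monid G n : ideal_exp (monid G) n = monid (nfold n G).
Proof.
elim: n => [|n IH]; first by rewrite /= monid0.
by rewrite /ideal_exp /= -/(ideal_exp _ _) IH ideal_mul_monid.
Qed.

Lemma sum_mnm (I : Type) (s : seq I) (F : I -> 'X_{1..N}) :
  (\sum_(i <- s) F i)%R = (\sum_(i <- s) F i)%MM.
Proof. by []. Qed.

Lemma mulrn_mnm m n : (m *+ n)%R = (m *+ n)%MM.
Proof. by elim: n => [|n IH]; rewrite ?mulmS ?mulrS ?IH. Qed.

Lemma max_ideal_exp n : ideal_exp (@max_ideal k N) n = monid [set m | mdeg m = n].
Proof.
have -> : @max_ideal k N = monid (range (fun i => U_(i)%MM)).
  rewrite -ideal_gen_monomials /max_ideal; congr ideal_gen.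
  by apply/seteqP; split=> [_ [i _ <-]|_ [_ [i _ <-] <-]]; [exists U_(i)%MM => //; exists i|exists i].
rewrite ideal_exp_monid; congr monid; apply/seteqP; split=> m.
  move=> /nfold_rangeP[c cn ->]; rewrite sum_mnm /= mdeg_sum -[X in _ = X]cn.
  by apply: eq_bigr => i _; rewrite mulrn_mnm mdegMn mdeg1 mul1n.
move=> /= mn; apply/nfold_rangeP; exists (fun i => m i); first by rewrite -mdegE.
rewrite sum_mnm {1}(multinomUE_id m).
by apply: eq_bigr => i _; rewrite mulrn_mnm.
Qed.

(** The exponents between lo and hi take all intermediate degrees. *)
Lemma mnm_between (lo hi : 'X_{1..N}) e : (lo <= hi)%MM ->
  (mdeg lo <= e)%N -> (e <= mdeg hi)%N ->
  exists v, [/\ (lo <= v)%MM, (v <= hi)%MM & mdeg v = e].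
Proof.
move=> lohi loe ehi; move: (subnK loe); move: (e - mdeg lo)%N => q.
elim: q lo lohi {loe} => [|q IH] lo lohi qe.
  by exists lo; split=> //; exact: lepm_refl.
have [i loi] : exists i, (lo i < hi i)%N.
  apply/existsP; rewrite -[X in is_true X]negbK; apply/negP => /existsPn h.
  have : (mdeg hi <= mdeg lo)%N.
    by rewrite !mdegE; apply: leq_sum => i _; rewrite leqNgt.
  by move: ehi qe; lia.
have [||v [lv vh ve]] := IH (lo + U_(i))%MM.
- apply/mnm_lepP => j; rewrite mnmDE mnm1E; case: eqP => [<-|_]; first by rewrite addn1.
  by rewrite addn0; exact: mnm_lepP.
- by rewrite mdegD mdeg1; lia.
- by exists v; split=> //; apply: lepm_trans lv; exact: lem_addr.
Qed.

(** If all generators have degree E, multiplication by the monomials of degree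
    s only removes the degrees below E + s: a multiple of a generator g of
    degree at least E + s has a divisor of degree exactly E + s that is still
    a multiple of g. *)
Lemma upset_degree_shift G E s : (forall g, G g -> mdeg g = E) ->
  forall m, upset (sadd [set m | mdeg m = s] G) m <->
    upset G m /\ (E + s <= mdeg m)%N.
Proof.
move=> GE m; split.
  move=> [_ [u us [g Gg <-]] um]; split.
    by exists g => //; apply: lepm_trans um; exact: lem_addl.
  have := um => /mnm_lepP um'; rewrite -(GE _ Gg) -us addnC -mdegD !mdegE.
  by apply: leq_sum => i _; exact: um'.
move=> [[g Gg gm] Em].
have [|v [gv vm ve]] := mnm_between (e := (E + s)%N) gm _ Em.
  by rewrite (GE _ Gg) leq_addr.
exists v => //; exists (v - g)%MM; last by exists g => //; exact: submK.
by apply/eqP; rewrite -(eqn_add2r (mdeg g)) -mdegD submK // ve (GE _ Gg) addnC.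
Qed.

Lemma graded_family_monid (G : nat -> set 'X_{1..N}) :
  G 0%N = [set 0] -> (forall i j, sadd (G i) (G j) `<=` upset (G (i + j)%N)) ->
  graded_family (fun n => monid (G n)).
Proof.
move=> G0 GG; split.
- by move=> n; exact: monomial_ideal_monid.
- by rewrite G0 monid0.
- by move=> i j; rewrite ideal_mul_monid; exact: monid_sub.
Qed.

Lemma generated_monid G b : (forall g, G g -> (mdeg g <= b)%N) ->
  generated_in_degrees_le b (monid G).
Proof.
move=> Gb; apply/seteqP; split.
  apply: monid_sub_ideal; first exact: ideal_gen_ideal.
  move=> g Gg; apply: ideal_gen_sub; split.
    by apply: monidX; exists g => //; exact: lepm_refl.
  by exists (mdeg g); [exact: Gb|by rewrite dhomogX].
by apply: ideal_gen_min; [exact: monid_ideal|move=> f []].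
Qed.

Lemma monid_neq0 G : G !=set0 -> monid G <> [set 0].
Proof.
move=> [g Gg] G0; have : monid G 'X_[g] by apply: monidX; exists g => //; exact: lepm_refl.
by rewrite G0 => /(congr1 (mcoeff g))/eqP; rewrite mcoeffX eqxx mcoeff0 oner_eq0.
Qed.
End MonomialIdealTheory.

Section QuotientDimension.

(** Two families that are bases modulo B express each other through matrices
    with product the identity, so they have the same length. *)
Lemma quot_dim_basis (k : fieldType) (V : lmodType k) (A B : set V) n (v : 'I_n -> V) :
  (forall x y, B x -> B y -> B (x + y)) -> (forall a x, B x -> B (a *: x)) -> B 0 ->
  (forall i, A (v i)) ->
  (forall f, A f -> exists! c : {ffun 'I_n -> k}, B (f - \sum_(i < n) c i *: v i)) ->
  quot_dim A B = n.
Proof.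
move=> BD BZ B0 vA vP; pose Q := [set n | exists2 v : 'I_n -> V, (forall i, A (v i)) &
    forall f, A f ->
      exists! c : {ffun 'I_n -> k}, B (f - \sum_(i < n) c i *: v i)].
have Qn : Q n by exists v.
have : Q (quot_dim A B) by apply: (xgetPex 0%N (P := Q)); exists n.
move: (quot_dim A B) => n' [v' v'A v'P].
have B_sum (I : Type) (s : seq I) (f : I -> V) : (forall i, B (f i)) -> B (\sum_(i <- s) f i).
  by move=> Bf; elim/big_ind: _.
have half m1 m2 (u : 'I_m1 -> V) (w : 'I_m2 -> V) :
    (forall i, A (u i)) -> (forall i, A (w i)) ->
    (forall f, A f -> exists! c : {ffun 'I_m1 -> k}, B (f - \sum_(i < m1) c i *: u i)) ->
    (forall f, A f -> exists! c : {ffun 'I_m2 -> k}, B (f - \sum_(i < m2) c i *: w i)) ->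
    (m1 <= m2)%N.
  move=> uA wA uP wP.
  have /choice[M MP] : forall i, exists c : {ffun 'I_m2 -> k}, B (u i - \sum_j c j *: w j).
    by move=> i; have [c [cP _]] := wP _ (uA i); exists c.
  have /choice[L LP] : forall j, exists c : {ffun 'I_m1 -> k}, B (w j - \sum_i c i *: u i).
    by move=> j; have [c [cP _]] := uP _ (wA j); exists c.
  apply: (@mulmx1_min k m1 m2 (\matrix_(i, j) M i j) (\matrix_(j, i) L j i)).
  apply/matrixP => i i'; rewrite !mxE; under eq_bigr do rewrite !mxE.
  have [c [_ cu]] := uP _ (uA i).
  have e1 : c = [ffun i' => (i == i')%:R].
    apply: cu; rewrite (bigD1 i) //= big1 => [|j /negPf]; last by rewrite ffunE eq_sym => ->; rewrite scale0r.
    by rewrite ffunE eqxx scale1r addr0 subrr.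
  have e2 : c = [ffun i' => \sum_j M i j * L j i'].
    apply: cu.
    have -> : u i - \sum_i0 [ffun i' => \sum_j M i j * L j i'] i0 *: u i0 =
        (u i - \sum_j M i j *: w j) + \sum_j M i j *: (w j - \sum_i0 L j i0 *: u i0).
      under [X in _ = _ + X]eq_bigr do rewrite scalerBr.
      rewrite sumrB addrA subrK; congr (_ - _).
      under [RHS]eq_bigr do rewrite scaler_sumr.
      rewrite exchange_big /=; apply: eq_bigr => i0 _; rewrite ffunE scaler_suml.
      by apply: eq_bigr => j _; rewrite scalerA.
    by apply: BD; [exact: MP|apply: B_sum => j; apply: BZ; exact: LP].
  by have := congr1 (fun h : {ffun 'I_m1 -> k} => h i') (etrans (esym e2) e1); rewrite !ffunE.
by apply/eqP; rewrite eqn_leq (half _ _ v' v) // (half _ _ v v').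
Qed.

(** The monomials lying in the first ideal but not in the second form a basis
    of the quotient. *)
Lemma quot_dim_monid (k : fieldType) N (G H : set 'X_{1..N}) :
  H `<=` upset G -> finite_set (upset G `\` upset H) ->
  quot_dim (@monid k N G) (@monid k N H) = cnt (upset G `\` upset H).
Proof.
move=> HG fW; have [s [us sW ->]] := finite_cnt fW.
have [H0 HD HM] := @monid_ideal k N H.
pose v (i : 'I_(size s)) : {mpoly k[N]} := 'X_[tnth (in_tuple s) i].
have vs (i : 'I_(size s)) : (upset G `\` upset H) (tnth (in_tuple s) i).
  by apply/sW; exact: mem_tnth.
have tinj (i j : 'I_(size s)) : tnth (in_tuple s) i = tnth (in_tuple s) j -> i = j.
  by move=> ij; apply/(tuple_uniqP (in_tuple s)).
have coefE (f : {mpoly k[N]}) (c : {ffun 'I_(size s) -> k}) i :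
    (f - \sum_i c i *: v i)@_(tnth (in_tuple s) i) = f@_(tnth (in_tuple s) i) - c i.
  rewrite mcoeffB raddf_sum (bigD1 i) //= mcoeffZ mcoeffX eqxx mulr1 big1 ?addr0 // => j ji.
  rewrite mcoeffZ mcoeffX; case: eqP => [/tinj ji'|_]; last by rewrite mulr0.
  by rewrite ji' eqxx in ji.
apply: (@quot_dim_basis k _ _ _ _ v) => //.
- by move=> a x Hx; rewrite -mul_mpolyC; exact: HM.
- by move=> i; apply: monidX; case: (vs i).
- move=> f Gf; exists [ffun i => f@_(tnth (in_tuple s) i)]; split.
    move=> m; rewrite mcoeff_msupp => fm.
    have [|Hm] := pselect (upset H m) => //.
    have Gm : upset G m.
      apply: contrapT => nGm; move/eqP: fm; apply.
      rewrite mcoeffB raddf_sum memN_msupp_eq0; last by apply/negP => /Gf.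
      rewrite big1 ?subr0 // => j _ /=; rewrite mcoeffZ mcoeffX.
      case: eqP => [e|_]; last by rewrite mulr0.
      by case: nGm; rewrite -e; case: (vs j).
    have : m \in s by apply/sW.
    move=> /(nth_index 0%MM) ms; have mi : (index m s < size s)%N by rewrite index_mem; apply/sW.
    move: fm; have mE : m = tnth (in_tuple s) (Ordinal mi) by rewrite (tnth_nth 0%MM) /= ms.
    by rewrite mE coefE ffunE subrr eqxx.
  move=> c Hc; apply/ffunP => i; rewrite ffunE; apply/eqP; rewrite -subr_eq0 -coefE.
  rewrite mcoeff_eq0; apply/negP => /Hc; by case: (vs i).
Qed.
End QuotientDimension.

(** * Slices of a monomial quotient by degree *)

Section Slices.
Variables (k : fieldType) (d : nat).
Implicit Types (G : set 'X_{1..d.+1}) (m : 'X_{1..d.+1}).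

(** The exponent after setting the first variable to 1. Together with the
    degree it determines the monomial. *)
Definition dehom m : 'rV[int]_d := \row_i (m (lift ord0 i))%:Z.

Lemma dehom0 : dehom 0 = 0.
Proof. by apply/rowP => i; rewrite !mxE mnm0E. Qed.

Lemma dehomD m1 m2 : dehom (m1 + m2)%R = dehom m1 + dehom m2.
Proof. by apply/rowP => i; rewrite !mxE mnmDE PoszD. Qed.

Lemma mdeg_dehom m : ((mdeg m)%:Z = (m ord0)%:Z + \sum_i dehom m 0 i)%R.
Proof.
rewrite mdegE big_ord_recl PoszD -posz_sum; congr (_ + _)%R.
by apply: eq_bigr => i _; rewrite mxE.
Qed.

Lemma dehom_inj m1 m2 : mdeg m1 = mdeg m2 -> dehom m1 = dehom m2 -> m1 = m2.
Proof.
move=> deq heq.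
have h0 : m1 ord0 = m2 ord0.
  have := congr1 Posz deq; rewrite !mdeg_dehom heq => /addIr [] //.
apply/mnmP => i; case: (unliftP ord0 i) => [j|] -> //.
by have := congr1 (fun z : 'rV_d => z 0 j) heq; rewrite !mxE => -[].
Qed.

Lemma finite_mdeg_lt n B : finite_set [set m : 'X_{1..n} | (mdeg m < B)%N].
Proof.
have -> : [set m : 'X_{1..n} | (mdeg m < B)%N] = (fun b : 'X_{1..n < B} => bmnm b) @` setT.
  apply/seteqP; split=> [m mB|_ [b _ <-]]; last exact: bmdeg.
  by exists (BMultinom mB).
exact: finite_image.
Qed.

(** The cofactor of a generator in a multiple of degree E + j is an arbitrary
    monomial of degree j, and these correspond to the lattice points of the
    simplex of size j. *)
Lemma slice_image G E j : (forall g, G g -> mdeg g = E) ->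
  dehom @` [set m | upset G m /\ mdeg m = (E + j)%N] = sadd (lsimplex j) (dehom @` G).
Proof.
move=> GE; apply/seteqP; split.
  move=> _ [m [[g Gg gm] mE] <-]; exists (dehom (m - g)%MM).
    split=> [i|]; first by rewrite mxE.
    have := mdeg_dehom (m - g)%MM.
    have -> : mdeg (m - g)%MM = j.
      by apply/eqP; rewrite -(eqn_add2r (mdeg g)) -mdegD submK // mE (GE _ Gg) addnC.
    move=> ->; rewrite lerDr //.
  exists (dehom g); first by exists g.
  by rewrite -dehomD -[in RHS](submK gm).
move=> _ [u [u0 uj] [_ [g Gg <-] <-]].
pose v : 'X_{1..d.+1} := [multinom
  (if unlift ord0 i is Some i' then absz (u 0%R i') else absz (j%:Z - \sum_i u 0 i)%R) | i < d.+1].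
have vu : dehom v = u.
  by apply/rowP => i; rewrite mxE mnmE liftK gez0_abs.
have vj : mdeg v = j.
  have := mdeg_dehom v; rewrite vu mnmE unlift_none gez0_abs ?subr_ge0 // subrK => -[] //.
exists (v + g)%R; last by rewrite dehomD vu.
split; first by exists g => //; exact: lem_addl.
by rewrite mdegD vj (GE _ Gg) addnC.
Qed.

Lemma sadd_mdeg p q : sadd [set m | mdeg m = p] [set m | mdeg m = q] =
  [set m : 'X_{1..d.+1} | mdeg m = (p + q)%N].
Proof.
apply/seteqP; split=> [_ [u up [v vq <-]]|m mpq]; first by rewrite /= mdegD up vq.
have [|||u [_ um up]] := @mnm_between _ 0 m p.
- by apply/mnm_lepP => i; rewrite mnm0E.
- by rewrite mdeg0.
- by rewrite mpq leq_addr.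
exists u => //; exists (m - u)%MM; last by rewrite -[RHS](submK um) addrC.
by apply/eqP; rewrite -(eqn_add2r (mdeg u)) -mdegD submK // mpq up addnC.
Qed.

Lemma max_ideal_exp_exp p n : ideal_exp (ideal_exp (@max_ideal k d.+1) p) n =
  @monid k d.+1 [set m | mdeg m = (n * p)%N].
Proof.
rewrite max_ideal_exp ideal_exp_monid; congr monid; elim: n => [|n IH] /=.
  apply/seteqP; split=> m; first by move=> ->; rewrite /= mdeg0.
  by move=> /eqP; rewrite mdeg_eq0 => /eqP.
by rewrite -/(nfold _ _) IH sadd_mdeg.
Qed.

(** By [upset_degree_shift], the basis of the quotient consists of the
    monomials of the ideal of degrees E, ..., E + s - 1; those of degree E + j
    form the slice j. *)
Lemma quot_dim_slices G E s : (forall g, G g -> mdeg g = E) ->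
  quot_dim (monid G) (ideal_mul (@monid k d.+1 [set m | mdeg m = s]) (monid G)) =
  (\sum_(j < s) cnt (sadd (lsimplex j) (dehom @` G)))%N.
Proof.
move=> GE; rewrite ideal_mul_monid.
have WE : upset G `\` upset (sadd [set m | mdeg m = s] G) =
    [set m | upset G m /\ (mdeg m < E + s)%N].
  apply/seteqP; split=> m /=.
    move=> [Gm nm]; split=> //; rewrite ltnNge; apply/negP => Em; apply: nm.
    exact/(upset_degree_shift s GE).
  by move=> [Gm Em]; split=> // /(upset_degree_shift s GE)[_]; rewrite leqNgt Em.
have fW : finite_set [set m | upset G m /\ (mdeg m < E + s)%N].
  by apply: sub_finite_set (finite_mdeg_lt d.+1 (E + s)) => m [].
rewrite quot_dim_monid ?WE //; last first.
  by move=> m [u _ [g Gg <-]]; exists g => //; exact: lem_addl.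
have Edeg m : upset G m -> (E <= mdeg m)%N.
  move=> [g Gg gm]; rewrite -(GE _ Gg) !mdegE; apply: leq_sum => i _.
  exact: mnm_lepP.
rewrite (@cnt_fibers _ _ (fun m => mdeg m - E)%N s) //; last first.
  by move=> m [/Edeg h1 h2]; lia.
apply: eq_bigr => j _; rewrite -(slice_image j GE) cnt_image.
- congr cnt; apply/seteqP; split=> m /=.
    by move=> [[Gm Em] mj]; split=> //; have := Edeg _ Gm; lia.
  move=> [Gm mE]; have := ltn_ord j; do !split => //; lia.
- apply: sub_finite_set fW => m /= [Gm mE]; split=> //; have := ltn_ord j; lia.
- by move=> x y [_ ex] [_ ey]; apply: dehom_inj; rewrite ex ey.
Qed.
End Slices.

(** * Mixed multiplicities as mixed volumes *)

Section MixedMultiplicityLimits.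
Variables (R : realType) (d : nat).
Hypothesis d_gt0 : (0 < d)%N.

Lemma std_simplex_body : convex_body (@std_simplex R d).
Proof.
rewrite std_simplexE; apply/cvx_body; split.
- by exists 0; split=> [i|]; rewrite ?mxE // big1 // => i _; rewrite mxE.
- exact: compact_simplex.
- exact: cvx_simplex.
Qed.

Lemma dil_std_simplex (t : R) : 0 <= t -> dil t (@std_simplex R d) = simplex t.
Proof.
rewrite le_eqVlt => /orP[/eqP <-|t0]; last by rewrite std_simplexE dil_simplex // mulr1.
rewrite dil0; last by case: std_simplex_body.
by rewrite -[RHS](sadd0s (simplex 0)) saddC sadd_simplex0.
Qed.

Lemma cvg_congr (f g : nat -> R) (l l' : R) : f @ \oo --> l ->
  (forall m, g m = f m) -> l' = l -> g @ \oo --> l'.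
Proof. by move=> fl /funext -> ->. Qed.

Definition with_simplex r (K : 'I_r -> set 'rV[R]_d) (i : 'I_r.+1) : set 'rV[R]_d :=
  if unlift ord0 i is Some j then K j else std_simplex.

Lemma copies_with_simplex r (K : 'I_r -> set 'rV[R]_d) (a : 'I_r.+1 -> nat) :
  copies (with_simplex K) a =
  nseq (a ord0) std_simplex ++ copies K (fun i => a (lift ord0 i)).
Proof.
rewrite /copies enum_ordSl /= {1}/with_simplex unlift_none -map_comp; congr (_ ++ flatten _).
by apply: eq_map => i /=; rewrite /with_simplex liftK.
Qed.

Lemma mixed_volume_form r (K : 'I_r -> set 'rV[R]_d) (v : 'I_r.+1 -> R) :
  (forall i, convex_body (K i)) -> (forall i, 0 <= v i) ->
  volume (sadd (simplex (v ord0)) (minkowski_comb (fun i => v (lift ord0 i)) K)) =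
  @hform R d r.+1 (fun a => (\prod_i (a i)`!)%N%:R^-1 *
    mixed_volume (nseq (a ord0) std_simplex ++ copies K (fun i => a (lift ord0 i)))) v.
Proof.
move=> bK v0; have bK' i : convex_body (with_simplex K i).
  by rewrite /with_simplex; case: unlift => [j|]; [exact: bK|exact: std_simplex_body].
have [_ /(_ r (with_simplex K) v bK' v0)] := mixed_volumeP R d_gt0.
rewrite minkowski_combE big_ord_recl {1}/with_simplex unlift_none dil_std_simplex //.
have -> : \big[@sadd _/[set 0]]_(i < r) dil (v (lift ord0 i)) (with_simplex K (lift ord0 i)) =
    minkowski_comb (fun i => v (lift ord0 i)) K.
  by rewrite minkowski_combE; apply: eq_bigr => i _; rewrite /with_simplex liftK.
move=> ->; apply: eq_bigr => a _; congr (_ * _ * _).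
by rewrite copies_with_simplex.
Qed.

Lemma big_ord_shift_le (f : nat -> nat) N D :
  (\sum_(j < N - D) f (j + D)%N <= \sum_(j < N) f j)%N.
Proof.
have [DN|ND] := leqP D N; last first.
  have -> : (N - D)%N = 0%N by lia.
  by rewrite big_ord0.
rewrite -[in X in (_ <= X)%N](subnKC DN) big_split_ord /=.
by apply: leq_trans (leq_addl _ _); apply: leq_sum => j _; rewrite addnC.
Qed.

(** Each monomial of the form contributes a power sum in j, asymptotic to the
    integral of the power. *)
Lemma cvg_slice_sum r (c : {ffun 'I_r.+1 -> 'I_d.+1} -> R) (n : 'I_r -> R)
    (N : nat -> nat) (D : nat) (nu : R) :
  (fun m => (N m)%:R / m%:R : R) @ \oo --> nu ->
  (fun m => (\sum_(j < N m) hform c (fun i => if unlift ord0 i is Some i' then m%:R * n i' else (j + D)%:R))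
     / m%:R ^+ d.+1) @ \oo -->
  \sum_(a : {ffun 'I_r.+1 -> 'I_d.+1} | (\sum_i a i == d)%N)
    c a * (\prod_i n i ^+ a (lift ord0 i)) * (nu ^+ (a ord0).+1 / (a ord0).+1%:R).
Proof.
move=> Nnu.
apply: (cvg_near_eq (v := fun m => \sum_(a : {ffun 'I_r.+1 -> 'I_d.+1} | (\sum_i a i == d)%N)
    c a * (\prod_i n i ^+ a (lift ord0 i)) *
    ((\sum_(j < N m) (j + D)%:R ^+ a ord0) / m%:R ^+ (a ord0).+1))); last first.
  by apply: cvg_sumr => a _; apply: cvgMl_tmp; exact: cvg_powsum.
near=> m.
have m0 : m%:R != 0 :> R by rewrite pnatr_eq0 -lt0n; near: m; exact: nbhs_infty_gt.
rewrite /hform exchange_big /= mulr_suml; apply: eq_bigr => a /eqP ad.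
have dE : m%:R ^+ d.+1 = m%:R ^+ (a ord0).+1 * m%:R ^+ (\sum_(i < r) a (lift ord0 i)) :> R.
  by rewrite -exprD; congr (_ ^+ _); rewrite -[in LHS]ad big_ord_recl addSn.
have prodE (j : nat) : \prod_(i < r.+1)
    (if unlift ord0 i is Some i' then m%:R * n i' else (j + D)%:R) ^+ a i =
    (j + D)%:R ^+ a ord0 * (m%:R ^+ (\sum_(i < r) a (lift ord0 i)) * \prod_(i < r) n i ^+ a (lift ord0 i)).
  rewrite big_ord_recl unlift_none; congr (_ * _).
  rewrite expr_sum -big_split; apply: eq_bigr => i _; rewrite liftK exprMn //.
rewrite dE -mulr_sumr (eq_bigr _ (fun (j : 'I_(N m)) _ => prodE j)).
rewrite -mulr_suml.
have h1 : m%:R ^+ (a ord0).+1 != 0 :> R by rewrite expf_neq0.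
have h2 : m%:R ^+ (\sum_(i < r) a (lift ord0 i)) != 0 :> R by rewrite expf_neq0.
move: (m%:R ^+ (a ord0).+1) h1 (m%:R ^+ (\sum_(i < r) a (lift ord0 i))) h2 => x x0 y y0.
by field; rewrite x0 y0.
Unshelve. all: by end_near. Qed.

(** The slice of index j is counted by the volume with a simplex of size
    between j - D and j + D. The sum of the counts lies between sums of such
    volumes, shifted by D in the index, and both have the same limit. *)
Lemma cvg_dim_slices r (K : 'I_r -> set 'rV[R]_d) c (n : 'I_r -> nat) (n0 C : nat)
    (Y : nat -> set 'rV[int]_d) :
  (forall i, convex_body (K i)) ->
  (forall v : 'I_r.+1 -> R, (forall i, 0 <= v i) ->
    volume (sadd (simplex (v ord0)) (minkowski_comb (fun i => v (lift ord0 i)) K)) =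
    @hform R d r.+1 c v) ->
  (forall m, near_sets C (Y m) (dil m%:R (minkowski_comb (fun i => (n i)%:R) K))) ->
  (fun m => (\sum_(j < m * n0) cnt (sadd (lsimplex j) (Y m)))%N%:R / m%:R ^+ d.+1 : R) @ \oo -->
  \sum_(a : {ffun 'I_r.+1 -> 'I_d.+1} | (\sum_i a i == d)%N)
    c a * (\prod_i (n i)%:R ^+ a (lift ord0 i)) * (n0%:R ^+ (a ord0).+1 / (a ord0).+1%:R).
Proof.
move=> bK cV nY; pose D := ((2 * C + 1) * d)%N.
pose X m := dil m%:R (minkowski_comb (fun i => (n i)%:R) K).
have bX m : convex_body (X m) by apply: dil_body => //; apply: minkowski_comb_body.
have kX m : compact (X m) by case: (bX m).
have VE m j : volume (sadd (simplex j%:R) (X m)) =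
    hform c (fun i => if unlift ord0 i is Some i' then m%:R * (n i')%:R else j%:R).
  rewrite -cV; last by move=> i; case: unlift => // i'; rewrite mulr_ge0.
  rewrite unlift_none /X dil_minkowski_comb; congr (volume (sadd _ (minkowski_comb _ _))).
  by apply/funext => i; rewrite liftK.
have N1 : (fun m : nat => (m * n0)%N%:R / m%:R : R) @ \oo --> (n0%:R : R).
  apply: (cvg_near_eq (v := fun=> n0%:R)); last exact: cvg_cst.
  near=> m; rewrite natrM mulrAC mulfV ?mul1r // pnatr_eq0 -lt0n.
  by near: m; exact: nbhs_infty_gt.
have N2 : (fun m : nat => (m * n0 - D)%N%:R / m%:R : R) @ \oo --> (n0%:R : R).
  have [->|n00] := posnP n0.
    by under eq_fun do rewrite muln0 sub0n mul0r; exact: cvg_cst.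
  apply: (cvg_near_eq (v := fun m : nat => n0%:R - D%:R * m%:R^-1)); last first.
    rewrite -[X in _ --> X]subr0; apply: cvgB; first exact: cvg_cst.
    rewrite -[X in _ --> X](mulr0 D%:R); apply: cvgMl_tmp; exact: cvg_invn.
  near=> m.
  have mD : (D <= m)%N by near: m; exact: nbhs_infty_ge.
  have m0 : (0 < m)%N by near: m; exact: nbhs_infty_gt.
  rewrite natrB; last by apply: leq_trans mD _; rewrite leq_pmulr.
  by rewrite natrM; field; rewrite pnatr_eq0 -lt0n.
have lim1 := cvg_slice_sum (c := c) (n := fun i => (n i)%:R) 0 N2.
have lim2 := cvg_slice_sum (c := c) (n := fun i => (n i)%:R) D N1.
apply: squeeze_cvgr lim1 lim2.
near=> m; apply/andP; split; apply: ler_wpM2r; rewrite ?invr_ge0 ?exprn_ge0 //.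
  apply: (@le_trans _ _ (\sum_(j < m * n0 - D) cnt (sadd (lsimplex (j + D)) (Y m)))%N%:R).
    rewrite natr_sum; apply: ler_sum => j _; rewrite addn0 -VE.
    by apply: volume_le_cnt => //; apply: compact_bounded_coord.
  by rewrite ler_nat (big_ord_shift_le (fun j => cnt (sadd (lsimplex j) (Y m)))).
rewrite natr_sum; apply: ler_sum => j _; rewrite -VE natrD.
exact: cnt_le_volume.
Unshelve. all: by end_near. Qed.

Variable k : fieldType.

Definition simplex_mixed_volume r (K : 'I_r -> set 'rV[R]_d) (d0 : nat) (dd : 'I_r -> nat) : R :=
  mixed_volume (nseq d0 std_simplex ++ copies K dd).

(** The sum over d0 and dd becomes a sum over multi-indices with d0 as first
    component. *)
Lemma mult_polynomialE r (e : nat -> ('I_r -> nat) -> R) (n0 : nat) (n : 'I_r -> nat) :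
  \sum_(d0 < d.+1)
      \sum_(dd : {ffun 'I_r -> 'I_d.+1} | (d0 + \sum_i dd i == d)%N)
        ((d0.+1)`! * \prod_i (dd i)`!)%N%:R^-1 * e d0 (fun i => dd i)
        * n0%:R ^+ d0.+1 * \prod_i (n i)%:R ^+ dd i =
  \sum_(a : {ffun 'I_r.+1 -> 'I_d.+1} | (\sum_i a i == d)%N)
    ((\prod_i (a i)`!)%N%:R^-1 * e (a ord0) (fun i => a (lift ord0 i))) *
    (\prod_i (n i)%:R ^+ a (lift ord0 i)) * (n0%:R ^+ (a ord0).+1 / (a ord0).+1%:R) :> R.
Proof.
rewrite [RHS]sum_fcons; apply: eq_bigr => x _; apply: eq_big => [a|a _].
  by rewrite sum_fcons_ord.
rewrite fcons0 big_ord_recl fcons0.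
have -> : (\prod_(i < r) (fcons x a (lift ord0 i))`! = \prod_i (a i)`!)%N.
  by apply: eq_bigr => i _; rewrite fconsS.
have -> : (fun i => nat_of_ord (fcons x a (lift ord0 i))) = (fun i => nat_of_ord (a i)).
  by apply/funext => i; rewrite fconsS.
have -> : \prod_(i < r) (n i)%:R ^+ fcons x a (lift ord0 i) = \prod_i (n i)%:R ^+ a i :> R.
  by apply: eq_bigr => i _; rewrite fconsS.
rewrite factS !natrM; field.
by rewrite nat1r !pnatr_eq0 -!lt0n fact_gt0 prodn_gt0 // => i; exact: fact_gt0.
Qed.

(** When the generators have one degree for each i and n, the dimensions are
    sums of slice counts, to which [cvg_dim_slices] applies. With the powers
    of m^rho in the first place, n0 rho slices occur for each unit of m,
    whence the power of rho. *)
Theorem is_mixed_mult_monid r (K : 'I_r -> set 'rV[R]_d) (rho : nat)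
    (I : nat -> set {mpoly k[d.+1]}) (J : 'I_r -> nat -> set {mpoly k[d.+1]})
    (G : 'I_r -> nat -> set 'X_{1..d.+1}) (E : 'I_r -> nat -> nat) :
  (forall i, convex_body (K i)) ->
  (forall n, I n = monid [set m | mdeg m = (n * rho)%N]) ->
  (forall i n, J i n = monid (G i n)) ->
  (forall i n g, G i n g -> mdeg g = E i n) ->
  (forall n : 'I_r -> nat, exists C, forall m,
     near_sets C (\big[@sadd _/[set 0]]_(i < r) (@dehom d @` G i (m * n i)%N))
       (dil m%:R (minkowski_comb (fun i => (n i)%:R) K))) ->
  is_mixed_mult_family I J
    (fun d0 dd => rho%:R ^+ d0.+1 * simplex_mixed_volume K d0 dd).
Proof.
move=> bK IE JE GE nG n0 n; have [C CP] := nG n.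
have lim := cvg_dim_slices (n0 := (n0 * rho)%N) bK (fun v => mixed_volume_form bK) CP.
apply: (cvg_congr lim).
- move=> m /=; congr (_%:R / _).
  rewrite IE; have -> : (fun i => J i (m * n i)%N) = (fun i => monid (G i (m * n i)%N)).
    by apply/funext => i; rewrite JE.
  rewrite ideal_prod_monid (@quot_dim_slices k d _ (\sum_i E i (m * n i))%N).
    rewrite mulnA; apply: eq_bigr => j _; congr (cnt (sadd _ _)).
    by rewrite image_big_sadd //; [exact: dehom0|exact: dehomD].
  move=> _ /big_saddP[y yG ->]; rewrite sum_mnm mdeg_sum; apply: eq_bigr => i _.
  exact: GE.
- apply: etrans (mult_polynomialE (fun d0 dd => rho%:R ^+ d0.+1 * simplex_mixed_volume K d0 dd) n0 n) _.
  apply: eq_bigr => a _; rewrite /simplex_mixed_volume natrM exprMn.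
  rewrite -!mulrA; congr (_ * _); ring.
Qed.

(** The limits determine the values of a form at positive integers, hence its
    coefficients. Dividing by n0 turns the polynomial of degree d + 1 into a
    form of degree d. *)
Lemma mixed_mult_family_unique r I J (e : nat -> ('I_r -> nat) -> R) :
  @is_mixed_mult_family R k d r I J e ->
  forall d0 dd, (d0 + \sum_i dd i = d)%N -> mixed_mult_family R I J d0 dd = e d0 dd.
Proof.
move=> eP d0 dd ddd; pose P := [set e | @is_mixed_mult_family R k d r I J e].
have e'P : P (mixed_mult_family R I J) by apply: (xgetPex (fun=> fun=> 0) (P := P)); exists e.
move: (mixed_mult_family _ _ _) e'P => e' e'P.
pose cf (e : nat -> ('I_r -> nat) -> R) (a : {ffun 'I_r.+1 -> 'I_d.+1}) : R :=
  (\prod_i (a i)`!)%N%:R^-1 * e (a ord0) (fun i => a (lift ord0 i)) / (a ord0).+1%:R.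
have cfE u (n : 'I_r.+1 -> nat) : (forall i, (0 < n i)%N) -> hform (cf u) (fun i => (n i)%:R) =
    (\sum_(d0 < d.+1)
      \sum_(dd : {ffun 'I_r -> 'I_d.+1} | (d0 + \sum_i dd i == d)%N)
        ((d0.+1)`! * \prod_i (dd i)`!)%N%:R^-1 * u d0 (fun i => dd i)
        * (n ord0)%:R ^+ d0.+1 * \prod_i (n (lift ord0 i))%:R ^+ dd i) / (n ord0)%:R.
  move=> npos; rewrite (mult_polynomialE u (n ord0) (fun i => n (lift ord0 i))) mulr_suml.
  apply: eq_bigr => a _; rewrite /cf exprS.
  have -> : \prod_i (n i)%:R ^+ a i =
      (n ord0)%:R ^+ a ord0 * \prod_i (n (lift ord0 i))%:R ^+ a (lift ord0 i) :> R.
    by rewrite big_ord_recl.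
  have x0 : (n ord0)%:R != 0 :> R by rewrite pnatr_eq0 -lt0n.
  have y0 : (a ord0).+1%:R != 0 :> R by rewrite pnatr_eq0.
  move: (n ord0)%:R x0 (a ord0).+1%:R y0 (_^-1 * u _ _) => x x0 y y0 z.
  by field; rewrite x0 y0.
have lt0 : (d0 < d.+1)%N by rewrite ltnS -ddd leq_addr.
have lt1 i : (dd i < d.+1)%N.
  by rewrite ltnS -ddd (bigD1 i) //= addnCA leq_addr.
pose a := fcons (Ordinal lt0) [ffun i => Ordinal (lt1 i)].
have aS i : a (lift ord0 i) = dd i :> nat by rewrite fconsS ffunE.
have ad : (\sum_i a i = d)%N.
  by rewrite sum_fcons_ord -[RHS]ddd; congr addn; apply: eq_bigr => i _; rewrite ffunE.
have cfa u : cf u a = (\prod_i (a i)`!)%N%:R^-1 * u d0 dd / (d0.+1)%:R.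
  rewrite /cf; have -> : (fun i => nat_of_ord (a (lift ord0 i))) = dd by apply/funext.
  by rewrite {2 3}/a fcons0.
have : cf e' a = cf e a.
  apply: (@hform_coef_inj _ _ _ _ _ _ a ad) => n npos; rewrite !cfE //; congr (_ / _).
  exact: cvg_unique (e'P (n ord0) (fun i => n (lift ord0 i))) (eP (n ord0) (fun i => n (lift ord0 i))).
rewrite !cfa => h; apply: (mulfI _ (mulIf _ h)).
- by rewrite invr_eq0 pnatr_eq0 -lt0n prodn_gt0 // => i; exact: fact_gt0.
- by rewrite invr_eq0 pnatr_eq0.
Qed.
End MixedMultiplicityLimits.

(** * The graded family of a convex body *)

Section Construction.
Variables (R : realType) (d : nat).
Variable w : nat.

(** The homogeneous coordinates of x with respect to the simplex of size w;
    their sum is w. *)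
Definition hcoord (x : 'rV[R]_d) (l : 'I_d.+1) : R :=
  if unlift ord0 l is Some j then x 0 j else w%:R - \sum_j x 0 j.

Lemma hcoord0 x : hcoord x ord0 = w%:R - \sum_j x 0 j.
Proof. by rewrite /hcoord unlift_none. Qed.

Lemma hcoordS x j : hcoord x (lift ord0 j) = x 0 j.
Proof. by rewrite /hcoord liftK. Qed.

Lemma sum_hcoord x : \sum_l hcoord x l = w%:R.
Proof.
rewrite big_ord_recl hcoord0 (_ : \sum_(j < d) hcoord x (lift ord0 j) = \sum_j x 0 j) ?subrK //.
by apply: eq_bigr => j _; rewrite hcoordS.
Qed.

(** The summand d + 1 allows for rounding up d + 1 coordinates. It is left out
    for n = 0, because the ideal of index 0 has to be the unit ideal. *)
Definition gdeg (n : nat) : nat := (w * n + (0 < n) * d.+1)%N.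

Definition gens (K : set 'rV[R]_d) (n : nat) : set 'X_{1..d.+1} :=
  [set u | mdeg u = gdeg n /\
     exists2 x, K x & forall l, n%:R * hcoord x l <= (u l)%:R].

Variable K : set 'rV[R]_d.
Hypothesis bK : convex_body K.
Hypothesis K_ge0 : forall x j, K x -> 0 <= x 0 j.
Hypothesis K_le : forall x, K x -> \sum_j x 0 j <= w%:R.

Lemma hcoord_ge0 x l : K x -> 0 <= hcoord x l.
Proof.
move=> Kx; case: (unliftP ord0 l) => [j|] ->; first by rewrite hcoordS K_ge0.
by rewrite hcoord0 subr_ge0 K_le.
Qed.

Definition round_up (n : nat) x : 'X_{1..d.+1} :=
  [multinom absz (Num.ceil (n%:R * hcoord x l)) | l < d.+1].

Lemma round_upE n x l : K x ->
  n%:R * hcoord x l <= (round_up n x l)%:R < n%:R * hcoord x l + 1.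
Proof.
move=> Kx; have h0 : 0 <= n%:R * hcoord x l by rewrite mulr_ge0 // hcoord_ge0.
rewrite mnmE -[X in _ <= X < _]/((_%:Z)%:~R) gez0_abs; last first.
  by rewrite -(ler_int R); apply: le_trans h0 (ceil_ge _).
have /andP[h1 h2] := ceil_itv (n%:R * hcoord x l).
by rewrite h2 /= -ltrBlDr -[1]/(1%:~R) -intrB.
Qed.

(** Rounding up increases each of the d + 1 coordinates by less than 1. *)
Lemma mdeg_round_up n x : K x -> (mdeg (round_up n x) <= gdeg n)%N.
Proof.
move=> Kx; have [->|n0] := posnP n.
  rewrite /gdeg muln0 /= mdegE big1 // => l _.
  have /andP[_] := round_upE 0 l Kx; rewrite mul0r add0r -[1]/(1%:R) ltr_nat ltnS leqn0 => /eqP //.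
rewrite /gdeg n0 mul1n -ltnS -(ltr_nat R) mdegE natr_sum.
apply: (@lt_le_trans _ _ (\sum_l (n%:R * hcoord x l + 1))).
  rewrite -subr_gt0 -sumrB (bigD1 ord0) //=.
  apply: ltr_pwDl.
    by rewrite subr_gt0; case/andP: (round_upE n ord0 Kx).
  by apply: sumr_ge0 => l _; rewrite subr_ge0 ltW //; case/andP: (round_upE n l Kx).
rewrite big_split /= -mulr_sumr sum_hcoord sumr_const card_ord -natrM -natrD ler_nat mulnC.
exact: leqnSn.
Qed.

(** The missing degree of the rounded point is filled up with the first
    variable, which dehomogenisation forgets. *)
Lemma gens_near_point n x : K x -> exists2 u, gens K n u &
  forall j, `|(u (lift ord0 j))%:R - n%:R * x 0 j| <= 1.
Proof.
move=> Kx; have le := mdeg_round_up n Kx.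
pose u := (round_up n x + U_(ord0) *+ (gdeg n - mdeg (round_up n x)))%MM.
have uS j : u (lift ord0 j) = round_up n x (lift ord0 j).
  by rewrite mnmDE mulmnE mnm1E /= mul0n addn0.
exists u; last first.
  move=> j; rewrite uS ler_norml; have := round_upE n (lift ord0 j) Kx.
  by rewrite hcoordS => /andP[h1 h2]; apply/andP; split; lra.
split; first by rewrite mdegD mdegMn mdeg1 mul1n subnKC.
exists x => // l; have /andP[h _] := round_upE n l Kx; apply: le_trans h _.
by rewrite ler_nat mnmDE leq_addr.
Qed.

Lemma gens_neq0 n : gens K n !=set0.
Proof.
by have /cvx_body[[x Kx] _ _] := bK; have [u Ku _] := gens_near_point n Kx; exists u.
Qed.

Lemma gens0 : gens K 0 = [set 0].
Proof.
apply/seteqP; split=> [u [u0 _]|_ ->].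
  by move: u0; rewrite /gdeg muln0 /= => /eqP; rewrite mdeg_eq0 => /eqP.
have /cvx_body[[x Kx] _ _] := bK.
split; first by rewrite /gdeg muln0 mdeg0.
by exists x => // l; rewrite mul0r.
Qed.

(** If u and v dominate p x and q y, their sum dominates p + q times the
    convex combination z of x and y with weights proportional to p and q,
    hence also the rounded point. Its degree is at least that of the
    generators of index p + q, one of which is found between the rounded point
    and u + v. *)
Lemma gens_sadd p q : sadd (gens K p) (gens K q) `<=` upset (gens K (p + q)%N).
Proof.
move=> _ [u [ud [x Kx xu]] [v [vd [y Ky yv]] <-]].
have /cvx_body[_ _ cK] := bK.
have [pq0|pq0] := posnP (p + q).
  have [p0 q0] : p = 0%N /\ q = 0%N by lia.
  exists (u + v)%R; last exact: lepm_refl.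
  split; first by rewrite mdegD ud vd p0 q0 /gdeg muln0.
  by exists x => // l; rewrite p0 q0 mul0r.
have pqR : (p + q)%:R != 0 :> R by rewrite pnatr_eq0 -lt0n.
pose t : R := p%:R / (p + q)%:R.
have t01 : 0 <= t <= 1.
  by rewrite divr_ge0 //= ler_pdivrMr ?ltr0n // mul1r ler_nat leq_addr.
pose z := t *: x + (1 - t) *: y.
have Kz : K z by apply: cK.
have zE l : (p + q)%:R * hcoord z l = p%:R * hcoord x l + q%:R * hcoord y l.
  have zj j : (p + q)%:R * z 0 j = p%:R * x 0 j + q%:R * y 0 j.
    rewrite !mxE /t natrD; field; by rewrite -natrD.
  case: (unliftP ord0 l) => [j|] ->; first by rewrite !hcoordS zj.
  rewrite !hcoord0 !mulrBr !mulr_sumr; under eq_bigr do rewrite zj.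
  by rewrite big_split /= natrD; ring.
have lohi : (round_up (p + q) z <= (u + v)%R)%MM.
  apply/mnm_lepP => l; rewrite -ltnS -(ltr_nat R) -natr1.
  have /andP[_ h] := round_upE (p + q) l Kz; apply: lt_le_trans h _.
  by rewrite lerD2r zE mnmDE natrD lerD.
have [||s [ls su sd]] := mnm_between (e := gdeg (p + q)) lohi.
- exact: mdeg_round_up.
- by rewrite mdegD ud vd /gdeg; case: p q pq0 {ud xu vd yv pqR t t01 z Kz zE lohi} => [|p] [|q] //=; lia.
exists s => //; split=> //; exists z => // l.
have /andP[h _] := round_upE (p + q) l Kz; apply: le_trans h _.
by rewrite ler_nat; exact: mnm_lepP.
Qed.

(** An exponent of degree wn + d + 1 dominating n x exceeds it by at most d +
    1 in each coordinate, since the excess has sum d + 1. *)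
Lemma near_gens n : near_sets d.+1 (@dehom d @` gens K n) (dil n%:R K).
Proof.
split=> [_ [u [ud [x Kx xu]] <-]|_ [x Kx <-]]; last first.
  have [u Ku ux] := gens_near_point n Kx; exists (dehom u); first by exists u.
  move=> j; rewrite !mxE; apply: le_trans (ux j) _; by rewrite ler1n.
exists (n%:R *: x); first by exists x.
move=> j; rewrite !mxE -[X in X - _]/((u (lift ord0 j))%:R) -(hcoordS x).
rewrite ger0_norm ?subr_ge0 //.
have : \sum_l ((u l)%:R - n%:R * hcoord x l) <= d.+1%:R :> R.
  rewrite sumrB -natr_sum -mdegE ud -mulr_sumr sum_hcoord lerBlDr -natrM -natrD ler_nat /gdeg.
  by case: (0 < n)%N; lia.
rewrite (bigD1 (lift ord0 j)) //=; apply: le_trans; rewrite lerDl.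
by apply: sumr_ge0 => l _; rewrite subr_ge0.
Qed.
End Construction.

(** * Powers of a single ideal of the family *)

(** The generators of the n-th power of an ideal are the n-fold sumset of its
    generators, which [near_nfold] compares with n times the hull of the
    latter. *)
Lemma hulls_of_generators (R : realType) (d : nat) (d_gt0 : (0 < d)%N) (k : fieldType) r
    (G : 'I_r -> set 'X_{1..d.+1}) (E : 'I_r -> nat) (X : 'I_r -> set 'rV[R]_d) C :
  (forall i, convex_body (X i)) -> (forall i, G i !=set0) ->
  (forall i g, G i g -> mdeg g = E i) ->
  (forall i, near_sets C (@dehom d @` G i) (X i)) ->
  exists L : 'I_r -> set 'rV[R]_d, [/\ forall i, convex_body (L i),
    forall i, X i `<=` fatten C%:R (L i),
    forall i, L i `<=` fatten C%:R (X i) &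
    forall (rho : nat) I, (forall n, I n = @monid k d.+1 [set m | mdeg m = (n * rho)%N]) ->
      is_mixed_mult_family I (fun i => ideal_exp (monid (G i)))
        (fun d0 dd => rho%:R ^+ d0.+1 * simplex_mixed_volume L d0 dd)].
Proof.
move=> bX nG GE nGX.
have fG i : finite_set (@dehom d @` G i).
  apply: (near_bounded d_gt0 (nGX i)); apply: compact_bounded_coord.
  by case: (bX i).
have nG' i : (@dehom d @` G i) !=set0 by have [g Gg] := nG i; exists (dehom g); exists g.
have [l [A AE]] := finite_ranges fG nG'.
pose L i := hull (fun a => ztor R (A i a)).
have LX i : X i `<=` fatten C%:R (L i) /\ L i `<=` fatten C%:R (X i).
  by apply: near_hull => //; rewrite AE.
have bL i : convex_body (L i) by exact: hull_body.
exists L; split=> //; [by move=> i; case: (LX i)|by move=> i; case: (LX i)|].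
move=> rho I IE.
have /choice[D DP] : forall i, exists D, forall n,
  near_sets D (nfold n (range (A i))) (dil n%:R (L i)) by move=> i; exact: near_nfold.
apply: (@is_mixed_mult_monid _ _ d_gt0 _ _ _ _ _ _ (fun i n => nfold n (G i)) (fun i n => (n * E i)%N)) => //.
- by move=> i n; rewrite ideal_exp_monid.
- move=> i n; elim: n => [|n IH] g; first by move=> ->; rewrite mdeg0.
  by move=> [a Ga [b /IH bE <-]]; rewrite mdegD bE (GE _ _ Ga) mulSn.
- move=> n; exists (\sum_i D i)%N => m.
  rewrite dil_minkowski_comb minkowski_combE; apply: near_big => i.
  rewrite image_nfold; [|exact: dehom0|exact: dehomD].
  by rewrite -natrM -AE; exact: DP.
Qed.

(** The volumes with L p rescaled by 1 / p converge, and so do the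
    coefficients of the corresponding forms. In the coefficient of multi-index
    (d0, dd), the rescaling of all bodies but the simplex yields the power of
    p. *)
Lemma cvg_simplex_mixed_volume (R : realType) (d : nat) (d_gt0 : (0 < d)%N) r
    (K : 'I_r -> set 'rV[R]_d) (L : nat -> 'I_r -> set 'rV[R]_d) (C : R) (d0 : nat) (dd : 'I_r -> nat) :
  (forall i, convex_body (K i)) -> (forall p i, convex_body (L p i)) -> 0 <= C ->
  (forall p i, dil p%:R (K i) `<=` fatten C (L p i)) ->
  (forall p i, L p i `<=` fatten C (dil p%:R (K i))) ->
  (d0 + \sum_i dd i = d)%N ->
  (fun p => simplex_mixed_volume (L p) d0 dd / p%:R ^+ (\sum_i dd i)) @ \oo -->
    simplex_mixed_volume K d0 dd.
Proof.
move=> bK bL C0 KL LK ddd.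
rewrite -(cvg_shiftS (fun p => simplex_mixed_volume (L p) d0 dd / p%:R ^+ (\sum_i dd i))) /=.
pose cf (X : 'I_r -> set 'rV[R]_d) (a : {ffun 'I_r.+1 -> 'I_d.+1}) : R :=
  (\prod_i (a i)`!)%N%:R^-1 * simplex_mixed_volume X (a ord0) (fun i => a (lift ord0 i)).
pose t (p : nat) (i : 'I_r.+1) : R := if unlift ord0 i is Some _ then p.+1%:R^-1 else 1.
have lt0 : (d0 < d.+1)%N by rewrite ltnS -ddd leq_addr.
have lt1 i : (dd i < d.+1)%N.
  by rewrite ltnS -ddd (bigD1 i) //= addnCA leq_addr.
pose a := fcons (Ordinal lt0) [ffun i => Ordinal (lt1 i)].
have aS i : a (lift ord0 i) = dd i :> nat by rewrite fconsS ffunE.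
have ad : (\sum_i a i = d)%N.
  by rewrite sum_fcons_ord -[RHS]ddd; congr addn; apply: eq_bigr => i _; rewrite ffunE.
have cfa X : cf X a = (\prod_i (a i)`!)%N%:R^-1 * simplex_mixed_volume X d0 dd.
  rewrite /cf; have -> : (fun i => nat_of_ord (a (lift ord0 i))) = dd by apply/funext.
  by rewrite {2}/a fcons0.
have tE p : \prod_i t p i ^+ a i = (p.+1%:R ^+ (\sum_i dd i))^-1.
  rewrite big_ord_recl /t unlift_none expr1n mul1r.
  rewrite (eq_bigr (fun i => p.+1%:R^-1 ^+ dd i)) => [|i _]; last by rewrite liftK aS.
  by rewrite -expr_sum exprVn.
have : (fun p => 1 * (cf (L p.+1) a * \prod_i t p i ^+ a i)) @ \oo --> cf K a.
  apply: (hform_coef_cvg (c := fun p a => 1 * (cf (L p.+1) a * \prod_i t p i ^+ a i))) => // n npos.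
  have -> : (fun p => hform (fun a => 1 * (cf (L p.+1) a * \prod_i t p i ^+ a i)) (fun i => (n i)%:R)) =
    (fun p => volume (sadd (simplex (n ord0)%:R)
      (minkowski_comb (fun i => p.+1%:R^-1 * (n (lift ord0 i))%:R) (L p.+1)))).
    apply/funext => p; rewrite -hform_rescale mul1r.
    rewrite -(@mixed_volume_form _ _ d_gt0 _ (L p.+1) (fun i => t p i * (n i)%:R)) //.
      rewrite {1}/t unlift_none mul1r; congr (volume (sadd _ (minkowski_comb _ _))).
      by apply/funext => i; rewrite /t liftK.
    by move=> i; rewrite /t mulr_ge0 //; case: unlift.
  rewrite -(@mixed_volume_form _ _ d_gt0 _ K (fun i => (n i)%:R)) //.
  apply: (@cvg_volume_hulls _ _ d_gt0 r K (fun p => L p.+1) C) => //.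
  by rewrite ltr0n.
have f0 : (\prod_i (a i)`!)%N%:R != 0 :> R.
  by rewrite pnatr_eq0 -lt0n prodn_gt0 // => i; exact: fact_gt0.
move=> /(cvgMl_tmp (a := (\prod_i (a i)`!)%N%:R)); rewrite cfa mulVKf //.
move=> h; apply: (cvg_congr h) => // p.
by rewrite mul1r cfa tE -mulrA mulVKf.
Qed.

Theorem theoremC (R : realType) (k : fieldType) (d r : nat) (hd : (0 < d)%N)
    (K : 'I_r -> set 'rV[R]_d)
    (hK : forall i, convex_body (K i))
    (hK0 : forall i, K i `<=` [set x : 'rV[R]_d | forall j, 0 <= x 0 j]) :
  exists J : 'I_r -> nat -> set {mpoly k[d.+1]},
    [/\ admissible_families J,
        (forall (d0 : nat) (dd : 'I_r -> nat), (d0 + \sum_i dd i = d)%N ->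
           let mv := mixed_volume (nseq d0 std_simplex ++ copies K dd) in
           [/\ mv = mixed_mult_family R (ideal_exp max_ideal) J d0 dd,
               (fun p : nat =>
                  mixed_mult_ideal R (ideal_exp max_ideal p)
                    (fun i => J i p) d0 dd / p%:R ^+ d.+1) @ \oo --> mv &
               (fun p : nat =>
                  mixed_mult_ideal R max_ideal (fun i => J i p) d0 dd
                    / p%:R ^+ (\sum_i dd i)) @ \oo --> mv]) &
        (r = d ->
           let mv := mixed_volume [seq K i | i <- enum 'I_r] in
           [/\ mv = mixed_mult_family R (ideal_exp max_ideal) J 0 (fun=> 1%N),
               (fun p : nat =>
                  mixed_mult_ideal R (ideal_exp max_ideal p)
                    (fun i => J i p) 0 (fun=> 1%N) / p%:R ^+ d.+1)
                 @ \oo --> mv &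
               (fun p : nat =>
                  mixed_mult_ideal R max_ideal (fun i => J i p) 0 (fun=> 1%N)
                    / p%:R ^+ d) @ \oo --> mv])].
Proof.
(* One degree w for all the bodies. *)
have [w wP] : exists w : nat, forall i x, K i x -> \sum_j x 0 j <= w%:R.
  have /choice[B BP] : forall i, exists B : R, forall x j, K i x -> `|x 0 j| <= B.
    by move=> i; have [_ kK _] := hK i; exact: compact_bounded_coord kK.
  exists (absz (Num.ceil (\sum_i d%:R * `|B i|))) => i x Kx.
  have s0 : 0 <= \sum_i d%:R * `|B i| by apply: sumr_ge0 => j _; rewrite mulr_ge0.
  rewrite -[X in _ <= X]/((_%:Z)%:~R) gez0_abs; last first.
    by rewrite -(ler_int R); apply: le_trans s0 (ceil_ge _).
  apply: le_trans (ceil_ge _); rewrite (bigD1 i) //=.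
  apply: (@le_trans _ _ (d%:R * `|B i|)); last first.
    by rewrite lerDl; apply: sumr_ge0 => j _; rewrite mulr_ge0.
  have -> : d%:R * `|B i| = \sum_(j < d) `|B i| by rewrite sumr_const card_ord mulr_natl.
  apply: ler_sum => j _; apply: le_trans (ler_norm _) _; apply: le_trans (BP _ _ _ Kx) _.
  exact: ler_norm.
pose G i n := gens w (K i) n.
have G_neq0 i n : G i n !=set0.
  by apply: gens_neq0 => //; [move=> x j Kx; exact: (hK0 i x Kx j)|exact: wP].
have G_deg i n u : G i n u -> mdeg u = gdeg d w n by case.
have G_near i n : near_sets d.+1 (@dehom d @` G i n) (dil n%:R (K i)).
  by apply: near_gens => //; [move=> x j Kx; exact: (hK0 i x Kx j)|exact: wP].
exists (fun i n => monid (G i n)).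
have max_expE n : ideal_exp (@max_ideal k d.+1) n = monid [set m | mdeg m = (n * 1)%N].
  by rewrite max_ideal_exp muln1.
(* The hulls of the generators for each p, at distance at most d + 1 from p K
   i. *)
have /choice[L LP] : forall p, exists L : 'I_r -> set 'rV[R]_d, [/\ forall i, convex_body (L i),
    forall i, dil p%:R (K i) `<=` fatten d.+1%:R (L i),
    forall i, L i `<=` fatten d.+1%:R (dil p%:R (K i)) &
    forall (rho : nat) I, (forall n, I n = @monid k d.+1 [set m | mdeg m = (n * rho)%N]) ->
      is_mixed_mult_family I (fun i => ideal_exp (monid (G i p)))
        (fun d0 dd => rho%:R ^+ d0.+1 * simplex_mixed_volume L d0 dd)].
  move=> p; apply: (hulls_of_generators hd) => //.
  - by move=> i; exact: dil_body.
  - by move=> i g; exact: G_deg.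
(* Both limits are obtained from that of the mixed volumes of the hulls: for
   m^p the multiplicity carries the additional factor p^(d0 + 1), and d + 1 =
   d0 + 1 + |dd|. *)
have main (d0 : nat) (dd : 'I_r -> nat) : (d0 + \sum_i dd i = d)%N ->
    let mv := mixed_volume (nseq d0 std_simplex ++ copies K dd) in
    [/\ mv = mixed_mult_family R (ideal_exp max_ideal) (fun i n => @monid k d.+1 (G i n)) d0 dd,
        (fun p : nat => mixed_mult_ideal R (ideal_exp max_ideal p)
            (fun i => @monid k d.+1 (G i p)) d0 dd / p%:R ^+ d.+1) @ \oo --> mv &
        (fun p : nat => mixed_mult_ideal R max_ideal (fun i => @monid k d.+1 (G i p)) d0 dd
            / p%:R ^+ (\sum_i dd i)) @ \oo --> mv].
  move=> ddd mv.
  have lim : (fun p => simplex_mixed_volume (L p) d0 dd / p%:R ^+ (\sum_i dd i)) @ \oo --> mv.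
    by apply: (cvg_simplex_mixed_volume hd (C := d.+1%:R)) => // p i; case: (LP p).
  have multE p rho I : (forall n, I n = @monid k d.+1 [set m | mdeg m = (n * rho)%N]) ->
      mixed_mult_family R I (fun i => ideal_exp (@monid k d.+1 (G i p))) d0 dd =
      rho%:R ^+ d0.+1 * simplex_mixed_volume (L p) d0 dd.
    move=> IE; have [_ _ _ /(_ rho I IE) h] := LP p.
    exact: (mixed_mult_family_unique h).
  split.
  - have h := @is_mixed_mult_monid R d hd k r K 1 (ideal_exp max_ideal)
      (fun i n => monid (G i n)) G (fun _ => gdeg d w) hK max_expE (fun _ _ => erefl) G_deg.
    rewrite (mixed_mult_family_unique (h _) ddd) ?expr1n ?mul1r //.
    move=> n; exists (\sum_(i < r) d.+1)%N => m.
    rewrite dil_minkowski_comb minkowski_combE; apply: near_big => i.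
    by rewrite -natrM; exact: G_near.
  - apply: cvg_near_eq lim; near=> p.
    have p0 : p%:R != 0 :> R by rewrite pnatr_eq0 -lt0n; near: p; exact: nbhs_infty_gt.
    rewrite /mixed_mult_ideal (multE p p); last exact: max_ideal_exp_exp.
    have -> : p%:R ^+ d.+1 = p%:R ^+ d0.+1 * p%:R ^+ (\sum_i dd i) :> R.
      by rewrite -exprD addSn ddd.
    by rewrite invfM mulrACA mulfV ?mul1r // expf_neq0.
  - apply: (cvg_congr lim) => // p.
    by rewrite /mixed_mult_ideal (multE p 1%N) // expr1n mul1r.
split=> //.
- split.
  + move=> i; apply: graded_family_monid; first exact: gens0.
    by apply: gens_sadd => //; [move=> x j Kx; exact: (hK0 i x Kx j)|exact: wP].
  + by move=> i; exists 0%N => // n _; exact: monid_neq0.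
  + exists (w + d.+1)%N => i n _; apply: generated_monid => u /G_deg ->.
    by rewrite /gdeg; case: n => [|n]; lia.
- move=> rd mv.
  have sum1 : (\sum_(i < r) 1 = d)%N by rewrite sum1_card card_ord.
  have := main 0%N (fun=> 1%N); rewrite add0n sum1 => /(_ erefl).
  have -> // : nseq 0 std_simplex ++ copies K (fun=> 1%N) = [seq K i | i <- enum 'I_r].
  by rewrite /copies /=; elim: (enum 'I_r) => //= i s ->.
Unshelve. all: by end_near. Qed.
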